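(* Let $a\in(0,1)$ and $u_0\in L^2(0,1)$, and let $\{j_n\}_{n\ge 1}$ be the increasing sequence of positive zeros of the Bessel function $J_0$. Let $u^a$ be the solution of $$\partial_t u-\partial_x((x-a)\partial_x u)=0 \ \text{ in } (a,1)\times(0,T),\quad u(1,t)=0,\quad (x-a)\partial_x u(x,t)\big|_{x=a}=0,\quad u(x,0)=u_0(x) \ \text{ for } x\in(a,1).$$ For $n\ge1$ and $t>0$ set $$f_n(t,a)=e^{-\left(\frac{j_n}{2}\right)^2\frac{t}{1-a}},\qquad U_n^0(a)=\int_0^{j_n}u_0\Big(a+(1-a)\frac{s^2}{j_n^2}\Big)\,s\,J_0(s)\,ds.$$ Then, for $t>0$: (a) the solution $u^a$ is given by $$u^a(x,t)=\sum_{n=1}^\infty \frac{2(1-a)}{j_n^2\,(J_0'(j_n))^2}\,f_n(t,a)\,U_n^0(a)\,J_0\Big(j_n\sqrt{\tfrac{x-a}{1-a}}\Big);$$ (b) consequently, $$\partial_x u^a(1,t)=\sum_{n=1}^\infty \frac{f_n(t,a)}{j_n J_0'(j_n)}\,U_n^0(a).$$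
   Context: $J_0(z)=\sum_{k\ge0}\frac{(-1)^k}{(k!)^2}(z/2)^{2k}$ is the Bessel function of the first kind of order $0$, with positive zeros $0<j_1<j_2<\cdots$. The solution $u^a$ is $u^a(\cdot,t)=e^{tA}u_0$ (with $u_0$ restricted to $(a,1)$), where $A u=\partial_x((x-a)\partial_x u)$ on $L^2(a,1)$ has domain consisting of those $u\in L^2(a,1)$ with $\int_a^1(x-a)|\partial_xu|^2dx<\infty$, $u(1)=0$ and $(x-a)\partial_x u\in H^1(a,1)$ (functions in this domain automatically satisfy $(x-a)\partial_xu|_{x=a}=0$). $A$ generates an analytic contraction semigroup, and for $t>0$ the equation and boundary conditions hold in the classical sense.
   Formalization: The formulas as given are off by a factor 1-a: the formal theorem has coefficient 2/(j_n^2 J_0'(j_n)^2) in (a) instead of 2(1-a)/(j_n^2 J_0'(j_n)^2), and f_n/((1-a) j_n J_0'(j_n)) in (b) instead of f_n/(j_n J_0'(j_n)). *)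

(* Defs.v *)
From HB Require Import structures.
From mathcomp Require Import all_boot all_order all_algebra.
From mathcomp Require Import all_classical all_reals all_analysis.
Set Implicit Arguments.
Unset Strict Implicit.
Unset Printing Implicit Defensive.
Import Order.TTheory GRing.Theory Num.Theory.
Import numFieldNormedType.Exports.
Local Open Scope classical_set_scope.
Local Open Scope ring_scope.

Section Bessel.
Context {R : realType}.

Definition besselJ0 (z : R) : R :=
  limn (series (fun k : nat =>
    (-1) ^+ k / (k`!)%:R ^+ 2 * (z / 2) ^+ (2 * k)%N)).

(* [j 0] is unused: the zeros are numbered from 1. *)
Definition besselJ0_zeros (j : nat -> R) : Prop :=
  (forall m n : nat, (1 <= m < n)%N -> j m < j n) /\
  (forall z : R, (0 < z /\ besselJ0 z = 0) <->
     exists2 n : nat, (1 <= n)%N & z = j n).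

End Bessel.

Section L2.
Context {R : realType}.

Definition leb_oo (a b : R) : {measure set (measurableTypeR R) -> \bar R} :=
  mrestr lebesgue_measure (measurable_itv `]a, b[).

(* Elements of L^2(a,b) are represented by measurable functions on R, taken up
   to equality [leb_oo a b]-almost everywhere; restricting such a function to a
   smaller interval leaves the function unchanged. *)
Definition L2 (a b : R) : {pred (R -> R)} := Lfun (leb_oo a b) 2%:E.

Definition L2norm (a b : R) (f : R -> R) : \bar R :=
  Lnorm (leb_oo a b) 2%:E (EFin \o f).

Definition L2cvg (a b : R) (F : set_system R) (v : R -> R -> R) (f : R -> R) :=
  L2norm a b (v h \- f) @[h --> F] --> 0%E.

(* C^oo functions with compact support in ]a, b[ *)
Definition test_function (a b : R) (phi : R -> R) : Prop :=
  (forall (n : nat) (x : R), derivable (derive1n n phi) x 1) /\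
  exists c d : R, [/\ a < c, d < b & forall x, x \notin `[c, d] -> phi x = 0].

Definition weak_derivative (a b : R) (f g : R -> R) : Prop :=
  [/\ locally_integrable `]a, b[ f,
      locally_integrable `]a, b[ g &
      forall phi : R -> R, test_function a b phi ->
        \int[lebesgue_measure]_(x in `]a, b[) (f x * derive1 phi x) =
        - \int[lebesgue_measure]_(x in `]a, b[) (g x * phi x)].

(* The trace of [f] at the right endpoint, as the value there of the
   representative of [f] that is continuous up to that endpoint. *)
Definition right_trace (a b : R) (f : R -> R) (l : R) : Prop :=
  exists v : R -> R, [/\ {within `]a, b], continuous v},
    f = v %[ae leb_oo a b] & v b = l].

(* A C_0-semigroup of bounded linear operators on L^2(a,b). Linearity and
   boundedness make [S t] compatible with almost everywhere equality. *)
Record C0_semigroup (a b : R) (S : R -> (R -> R) -> (R -> R)) : Prop := {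
  C0_stable : forall t f, 0 <= t -> f \in L2 a b -> S t f \in L2 a b;
  C0_linear : forall t (c : R) f g, 0 <= t -> f \in L2 a b -> g \in L2 a b ->
    S t (fun x => c * f x + g x) = (fun x => c * S t f x + S t g x)
      %[ae leb_oo a b];
  C0_bounded : forall t, 0 <= t -> exists M : R, forall f, f \in L2 a b ->
    (L2norm a b (S t f) <= M%:E * L2norm a b f)%E;
  C0_id : forall f, f \in L2 a b -> S 0 f = f %[ae leb_oo a b];
  C0_comp : forall s t f, 0 <= s -> 0 <= t -> f \in L2 a b ->
    S (s + t) f = S s (S t f) %[ae leb_oo a b];
  C0_continuous : forall f, f \in L2 a b ->
    L2cvg a b 0^'+ (fun h => S h f) f }.

(* An unbounded operator is given by its graph: [A f g] reads
   "f is in the domain of A and A f = g". *)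
Definition generates (a b : R) (A : (R -> R) -> (R -> R) -> Prop)
    (S : R -> (R -> R) -> (R -> R)) : Prop :=
  C0_semigroup a b S /\
  forall f g, f \in L2 a b -> g \in L2 a b ->
    (A f g <-> L2cvg a b 0^'+ (fun h x => h^-1 * (S h f x - f x)) g).

End L2.

Section Degenerate.
Context {R : realType}.

(* The graph of A f = ((x - a) f')' on L^2(a,1); [df] is f'. *)
Definition degenerate_op (a : R) (f g : R -> R) : Prop :=
  [/\ f \in L2 a 1, g \in L2 a 1 &
    exists df : R -> R,
      [/\ weak_derivative a 1 f df,
          (\int[lebesgue_measure]_(x in `]a, 1%R[)
             ((x - a) * df x ^+ 2)%:E < +oo)%E,
          right_trace a 1 f 0,
          (fun x => (x - a) * df x) \in L2 a 1 &
          weak_derivative a 1 (fun x => (x - a) * df x) g]].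

(* [u t x] is u(x,t). For t > 0 the function u(.,t) is the representative of
   e^{tA} u0 that is continuous up to x = 1, so that pointwise values and the
   derivative at x = 1 make sense. *)
Definition degenerate_solution (a : R) (u0 : R -> R) (u : R -> R -> R) : Prop :=
  exists2 S : R -> (R -> R) -> (R -> R), generates a 1 (degenerate_op a) S &
    forall t, 0 < t ->
      u t = S t u0 %[ae leb_oo a 1] /\ {within `]a, 1], continuous (u t)}.

Definition decay (j : nat -> R) (a t : R) (n : nat) : R :=
  expR (- ((j n / 2) ^+ 2 * (t / (1 - a)))).

(* With w_n(x) = J_0(j_n sqrt((x - a)/(1 - a))), the substitution
   x = a + (1 - a) s^2/j_n^2 gives, in L^2(a,1),
   <u0, w_n> = 2 (1 - a) / j_n^2 * bessel_coef j u0 a n and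
   <w_n, w_n> = (1 - a) J_0'(j_n)^2: the factors 1 - a cancel in the
   coefficient of w_n. *)
Definition bessel_coef (j : nat -> R) (u0 : R -> R) (a : R) (n : nat) : R :=
  \int[lebesgue_measure]_(s in `]0, j n[)
    (u0 (a + (1 - a) * (s ^+ 2 / j n ^+ 2)) * s * besselJ0 s).

(* one-sided derivative, from the left *)
Definition left_derivative (f : R -> R) (x l : R) : Prop :=
  (f y - f x) / (y - x) @[y --> x^'-] --> l.

End Degenerate.

(* Main.v *)
From HB Require Import structures.
Require Import Defs.
From mathcomp Require Import all_boot all_order all_algebra.
From mathcomp Require Import all_classical all_reals all_analysis.
From mathcomp Require Import measurable_realfun ring lra.
Set Implicit Arguments.
Unset Strict Implicit.
Unset Printing Implicit Defensive.
Import Order.TTheory GRing.Theory Num.Theory.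
Import numFieldNormedType.Exports.
Local Open Scope classical_set_scope.
Local Open Scope ring_scope.

(** Let E(y) be the sum of the (-1)^k y^k / (k!)^2, so that J_0(z) = E(z^2/4)
    ([besselJ0E]), and let L = 1 - a. The Bessel equation becomes (y E')' = - E
    ([E_ode]); hence w(x) = E(l (x - a)) satisfies ((x - a) w')' = - l w, and
    w(1) = 0 exactly when 2 sqrt(l L) is a zero of J_0. So
    J_0(j_n sqrt((x - a)/L)) is an eigenfunction of A with eigenvalue
    - lam_n, lam_n = (j_n/2)^2 / L, and (a) is the expansion of e^(tA) u_0 in
    eigenfunctions. It rests on three facts.

    The eigenfunctions are complete in L^2(a,1) ([completeness]). Instead of a
    spectral theorem, the argument uses iterated inverses r_(k+1) = (- A)^-1 r_k:
    the ratios of their consecutive norms increase to a limit, and an energy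
    estimate for the differential equation ([resolvent_estimate]) shows that
    this limit is the reciprocal of an eigenvalue whose eigenfunction is not
    orthogonal to the r_k. Hence (- A)^-1 has norm at most 1 / lam_N on the
    orthogonal complement of the first N eigenfunctions ([spectral_gap]).
    Polynomials that vanish at 1 are inverses of polynomials, so that they are
    limits of eigenfunction sums ([poly_approx]), as lam_N tends to infinity: the
    sum of the 1 / lam_n is at most L, by Bessel's inequality for the constant 1
    ([sum_lam]). Explicit polynomials approximate the indicator functions of
    ]a,c[, and these are total.

    The semigroup multiplies an eigenfunction by e^(- lam_n t)
    ([eigen_evolution]). Both sides have the same derivative at 0, and the
    difference is propagated by telescoping over n steps of length t / n. This
    takes a bound on S_t that is uniform for small t, and a gliding hump argument
    based on the Riesz-Fischer theorem extracts it from the axioms of a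
    C_0-semigroup ([semigroup_local_bound]).

    For t > 0 the evolved series converges uniformly on [a,1] together with its
    derivative near 1: the exponential factors dominate all powers of lam_n, and
    the sum of the 1 / lam_n is finite. Its sum is continuous and equals S_t u_0
    almost everywhere, hence it equals the continuous representative on ]a,1]
    ([evol_pointwise]), and the left derivative at 1 is the sum of the
    derivatives ([evol_left_derivative]), which is (b).

    The substitution x = a + L s^2/j_n^2 ([integral_quadratic_substitution])
    turns the inner products with the eigenfunctions into the numbers U_n^0(a),
    and the primitive y (E^2 + y E'^2) of E^2 gives their norms. *)

(** * Functions with an everywhere defined derivative *)

Section Calculus.
Context {R : realType}.
Implicit Types f g df dg : R -> R.

(** The derivative is carried as a total function, so that it can in turn be
    integrated over an interval or differentiated. *)
Definition has_deriv f df := forall x : R, is_derive x 1 f (df x).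

Lemma has_deriv_eq f df dg : has_deriv f df -> df =1 dg -> has_deriv f dg.
Proof. by move=> h e x; rewrite -e; exact: h. Qed.

Lemma has_deriv_cst (c : R) : has_deriv (fun=> c) (fun=> 0).
Proof. by move=> x; exact: is_derive_cst. Qed.

Lemma has_deriv_id : has_deriv id (fun=> 1).
Proof. by move=> x; exact: is_derive_id. Qed.

Lemma has_derivD f g df dg : has_deriv f df -> has_deriv g dg ->
  has_deriv (fun x => f x + g x) (fun x => df x + dg x).
Proof. by move=> hf hg x; exact: is_deriveD. Qed.

Lemma has_derivM f g df dg : has_deriv f df -> has_deriv g dg ->
  has_deriv (fun x => f x * g x) (fun x => df x * g x + f x * dg x).
Proof.
move=> hf hg x; apply: (is_derive_eq (is_deriveM (hf x) (hg x))).
by rewrite addrC; congr (_ + _); rewrite /GRing.scale/= mulrC.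
Qed.

Lemma has_derivZ (c : R) f df : has_deriv f df ->
  has_deriv (fun x => c * f x) (fun x => c * df x).
Proof.
move=> hf; apply: (has_deriv_eq (has_derivM (has_deriv_cst c) hf)) => x.
by rewrite mul0r add0r.
Qed.

Lemma has_derivB f g df dg : has_deriv f df -> has_deriv g dg ->
  has_deriv (fun x => f x - g x) (fun x => df x - dg x).
Proof. by move=> hf hg x; exact: is_deriveB. Qed.

Lemma has_deriv_shift (c : R) : has_deriv (fun x => x - c) (fun=> 1).
Proof.
apply: (has_deriv_eq (has_derivB has_deriv_id (has_deriv_cst c))) => x.
by rewrite subr0.
Qed.

Lemma has_deriv_sqr f df : has_deriv f df ->
  has_deriv (fun x => f x ^+ 2) (fun x => 2 * f x * df x).
Proof.
move=> hf; rewrite (_ : (fun x => f x ^+ 2) = fun x => f x * f x); last first.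
  by apply/funext => x; rewrite expr2.
apply: (has_deriv_eq (has_derivM hf hf)) => x; ring.
Qed.

Lemma has_deriv_affine f df (l c : R) : has_deriv f df ->
  has_deriv (fun x => f (l * (x - c))) (fun x => l * df (l * (x - c))).
Proof.
move=> hf x.
have h := has_derivZ l (has_deriv_shift c).
have h2 := @is_derive1_comp R f (fun x => l * (x - c)) x _ _
  (hf (l * (x - c))) (h x).
rewrite mulr1 mulrC in h2; exact: h2.
Qed.

Lemma has_deriv_sum (I : Type) (r : seq I) (F dF : I -> R -> R) :
  (forall i, has_deriv (F i) (dF i)) ->
  has_deriv (fun x => \sum_(i <- r) F i x) (fun x => \sum_(i <- r) dF i x).
Proof.
move=> h; elim: r => [|i r ih].
  rewrite (_ : (fun x => \sum_(i <- [::]) F i x) = fun=> 0); last first.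
    by apply/funext => x; rewrite big_nil.
  by apply: (has_deriv_eq (has_deriv_cst 0)) => x; rewrite big_nil.
rewrite (_ : (fun x => \sum_(j <- i :: r) F j x)
           = fun x => F i x + \sum_(j <- r) F j x); last first.
  by apply/funext => x; rewrite big_cons.
by apply: (has_deriv_eq (has_derivD (h i) ih)) => x; rewrite big_cons.
Qed.

Lemma has_deriv_continuous f df : has_deriv f df -> continuous f.
Proof.
move=> hf x; have [d _] := hf x.
by apply: differentiable_continuous; exact/derivable1_diffP.
Qed.

Lemma has_deriv_horner (p : {poly R}) :
  has_deriv (fun x => p.[x]) (fun x => p^`().[x]).
Proof. by move=> x; exact: is_derive_poly. Qed.

Lemma has_deriv_MVT f df (a b : R) : has_deriv f df -> a <= b ->
  exists2 c, a <= c <= b & f b - f a = df c * (b - a).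
Proof.
move=> hf ab.
have := @MVT_segment R f df a b ab (fun x _ => hf x).
move=> /(_ (continuous_subspaceT (has_deriv_continuous hf)))[c].
by rewrite in_itv/=; exists c.
Qed.

Lemma has_deriv_nd f df (a b : R) : has_deriv f df -> a <= b ->
  (forall x, a <= x <= b -> 0 <= df x) -> f a <= f b.
Proof.
move=> hf ab df0; have [c cab e] := has_deriv_MVT hf ab.
by rewrite -subr_ge0 e mulr_ge0 ?subr_ge0// df0.
Qed.

Lemma has_deriv_ni f df (a b : R) : has_deriv f df -> a <= b ->
  (forall x, a <= x <= b -> df x <= 0) -> f b <= f a.
Proof.
move=> hf ab df0; have [c cab e] := has_deriv_MVT hf ab.
by rewrite -subr_le0 e mulr_le0_ge0 ?subr_ge0// df0.
Qed.

Lemma has_deriv_derive1 f df (x : R) : has_deriv f df -> derive1 f x = df x.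
Proof. by move=> hf; rewrite derive1E; have [_ ->] := hf x. Qed.

Lemma FTC_Rintegral f df (a b : R) : a < b -> has_deriv f df -> continuous df ->
  \int[lebesgue_measure]_(x in `]a, b[) df x = f b - f a.
Proof.
move=> ab hf cf.
have cf' (A : set R) : {within A, continuous df} by exact: continuous_subspaceT.
have intf : lebesgue_measure.-integrable `[a, b] (EFin \o df).
  by apply: continuous_compact_integrable => //; exact: segment_compact.
have s1 : `]a, b] `<=` `[a, b] by apply: subset_itvr; rewrite bnd_simp.
have s2 : `]a, b[ `<=` `[a, b] by apply: subset_itv; rewrite bnd_simp.
rewrite Rintegral_itv_bndo_bndc; last by apply: integrableS intf.
rewrite Rintegral_itv_obnd_cbnd; last by apply: integrableS intf.
rewrite /Rintegral (@continuous_FTC2 _ df f)//.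
- split.
  + by move=> x _; have [] := hf x.
  + by apply: cvg_at_right_filter; exact: has_deriv_continuous hf _.
  + by apply: cvg_at_left_filter; exact: has_deriv_continuous hf _.
- by move=> x _; exact: has_deriv_derive1.
Qed.

End Calculus.

(** * The Bessel function as an entire series in z^2/4 *)

Section BesselSeries.
Context {R : realType}.

(** In the variable y = z^2/4 the Bessel equation of order 0 reads
    (y E')' = - E, which is the eigenvalue equation of the degenerate operator
    up to an affine change of variable. [E1] and [E2] are E' and E''. *)
Definition Ecoef (k : nat) : R := (-1) ^+ k / (k`!)%:R ^+ 2.

Definition E (y : R) : R := limn (pseries Ecoef y).
Definition E1 (y : R) : R := limn (pseries (pseries_diffs Ecoef) y).
Definition E2 (y : R) : R :=
  limn (pseries (pseries_diffs (pseries_diffs Ecoef)) y).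

Lemma fact_gt0R (k : nat) : 0 < (k`!)%:R :> R.
Proof. by rewrite ltr0n fact_gt0. Qed.

(** The coefficients of E and of its derivatives are dominated by those of the
    exponential, so that all these series converge everywhere and can be
    differentiated termwise. *)
Lemma cvg_pseries_fact (c : R^nat) (x : R) :
  (forall k, `|c k| <= (k`!)%:R^-1) -> cvgn (pseries c x).
Proof.
move=> h; apply: normed_cvg.
apply: (@series_le_cvg R _ (exp_coeff `|x|)) => [n|n|n|].
- exact: normr_ge0.
- by rewrite exp_coeff_ge0.
- rewrite /= normrM normrX /exp_coeff/= mulrC; exact: ler_wpM2l.
- exact: is_cvg_series_exp_coeff.
Qed.

Lemma Ecoef_le k : `|Ecoef k| <= (k`!)%:R^-1.
Proof.
rewrite /Ecoef normrM normrX normrN1 expr1n mul1r normfV ger0_norm ?sqr_ge0//.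
rewrite lef_pV2 ?posrE ?exprn_gt0 ?fact_gt0R//.
by rewrite expr2 ler_peMr ?ler0n// ler1n fact_gt0.
Qed.

Lemma EcoefS k : k.+1%:R * Ecoef k.+1 = - (Ecoef k / k.+1%:R).
Proof.
rewrite /Ecoef exprS factS natrM.
field.
by rewrite gt_eqF ?fact_gt0R//= addrC natr1 pnatr_eq0.
Qed.

Lemma fact_le_div (m : nat -> nat) (c e : R^nat) :
  (forall k, c k = e k / (m k).+1%:R) -> (forall k, `|e k| <= (k`!)%:R^-1) ->
  forall k, `|c k| <= (k`!)%:R^-1.
Proof.
move=> ce h k; rewrite ce normrM (le_trans _ (h k))//.
by rewrite ler_piMr// normfV invf_le1 ?ger0_norm ?ltr0n ?ler1n.
Qed.

Lemma diffs_Ecoef_le k : `|pseries_diffs Ecoef k| <= (k`!)%:R^-1.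
Proof.
apply: (@fact_le_div id _ (fun k => - Ecoef k)) => {}k.
  by rewrite /pseries_diffs EcoefS mulNr.
by rewrite normrN Ecoef_le.
Qed.

Lemma diffs2_Ecoef_le k : `|pseries_diffs (pseries_diffs Ecoef) k| <= (k`!)%:R^-1.
Proof.
apply: (@fact_le_div id _ (fun k => Ecoef k / k.+2%:R)) => {}k.
  rewrite /pseries_diffs EcoefS mulrN mulrA EcoefS mulNr opprK.
  by rewrite mulrAC.
exact: (@fact_le_div S (fun k => Ecoef k / k.+2%:R) Ecoef _ Ecoef_le).
Qed.

Lemma diffs3_Ecoef_le k :
  `|pseries_diffs (pseries_diffs (pseries_diffs Ecoef)) k| <= (k`!)%:R^-1.
Proof.
apply: (@fact_le_div id _ (fun k => - (Ecoef k / k.+2%:R / k.+3%:R))) => {}k.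
  rewrite /pseries_diffs EcoefS mulrN mulrN mulrA mulrA -(mulrA k.+1%:R) EcoefS.
  by rewrite mulrN mulNr opprK mulrA EcoefS !mulNr; congr (- _); ring.
rewrite normrN.
apply: (@fact_le_div (fun k => k.+2) (fun k => Ecoef k / k.+2%:R / k.+3%:R)
  (fun k => Ecoef k / k.+2%:R)) => // i.
exact: (@fact_le_div S (fun k => Ecoef k / k.+2%:R) Ecoef _ Ecoef_le).
Qed.

Lemma lt_norm1 (x : R) : `|x| < `| `|x| + 1 |.
Proof. by rewrite [ltRHS]ger0_norm ?addr_ge0// ltrDl. Qed.

Lemma has_deriv_E : has_deriv E E1.
Proof.
move=> x; apply: (pseries_snd_diffs _ _ _ (lt_norm1 x)).
- exact: cvg_pseries_fact Ecoef_le.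
- exact: cvg_pseries_fact diffs_Ecoef_le.
- exact: cvg_pseries_fact diffs2_Ecoef_le.
Qed.

Lemma has_deriv_E1 : has_deriv E1 E2.
Proof.
move=> x; apply: (pseries_snd_diffs _ _ _ (lt_norm1 x)).
- exact: cvg_pseries_fact diffs_Ecoef_le.
- exact: cvg_pseries_fact diffs2_Ecoef_le.
- exact: cvg_pseries_fact diffs3_Ecoef_le.
Qed.

(** The identity (k+1)^2 c_(k+1) = - c_k between the coefficients of E says
    that (y E')' = - E. *)
Lemma E_ode y : y * E2 y + E1 y = - E y.
Proof.
pose d (k : nat) := k%:R * Ecoef k.
have diffd k : pseries_diffs d k = - Ecoef k.
  by rewrite /pseries_diffs /d EcoefS mulrN mulrCA mulfV ?mulr1.
have diffdE : pseries_diffs d = fun k => - Ecoef k by apply/funext.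
have hd x : limn (pseries d x) = x * E1 x.
  apply/cvg_lim => //; rewrite -(cvg_shiftn 1).
  rewrite (_ : (fun n => pseries d x (n + 1)%N)
      = fun n => x * pseries (pseries_diffs Ecoef) x n); last first.
    apply/funext => n; rewrite /pseries /series/= addn1 big_nat_recl//.
    rewrite {1}/d mul0r mul0r add0r big_distrr/=; apply: eq_bigr => i _.
    by rewrite /pseries_diffs /d exprS mulrCA mulrA.
  apply: cvgMr; exact: cvg_pseries_fact diffs_Ecoef_le.
have cd x : cvgn (pseries d x).
  apply: cvg_pseries_fact => k; rewrite /d; case: k => [|k].
    by rewrite mul0r normr0 fact0 invr1.
  rewrite EcoefS normrN normrM normfV (@ger0_norm _ k.+1%:R)//.
  rewrite factS natrM invfM [leRHS]mulrC; apply: ler_wpM2r (Ecoef_le _).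
  by rewrite invr_ge0.
have dD : has_deriv (fun x => x * E1 x) (fun x => - E x).
  move=> x; rewrite -(_ : (fun x => limn (pseries d x)) = (fun x => x * E1 x)); last first.
    by apply/funext => z; rewrite hd.
  have h : limn (pseries (pseries_diffs d) x) = - E x.
    rewrite diffdE /E -limN; last exact: cvg_pseries_fact Ecoef_le.
    congr (limn _); apply/funext => n.
    transitivity (- (\sum_(0 <= i < n) Ecoef i * x ^+ i)) => //.
    by rewrite -sumrN; apply: eq_bigr => i _ /=; rewrite mulNr.
  rewrite -h; apply: (pseries_snd_diffs _ _ _ (lt_norm1 x)); rewrite ?diffdE.
  - exact: cd.
  - by apply: cvg_pseries_fact => k; rewrite normrN; exact: Ecoef_le.
  - apply: cvg_pseries_fact => k.
    by rewrite /pseries_diffs mulrN normrN; exact: diffs_Ecoef_le.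
have := has_deriv_derive1 y (has_derivM has_deriv_id has_deriv_E1).
by rewrite (has_deriv_derive1 y dD) => ->; rewrite mul1r addrC.
Qed.

Lemma E0 : E 0 = 1.
Proof.
apply/cvg_lim => //; apply: cvg_near_cst; exists 1%N => // n /= n1.
rewrite /pseries /series/= -(subnK n1) addn1 big_nat_recl//.
rewrite expr0 mulr1 /Ecoef fact0 expr0 expr1n divr1 big1 ?addr0// => i _.
by rewrite [0 ^+ _]exprS mul0r mulr0.
Qed.

(** The energy E^2 + y E'^2 has derivative - E'^2, and it is 1 at 0. *)
Lemma E_energy_le1 y : 0 <= y -> E y ^+ 2 + y * E1 y ^+ 2 <= 1.
Proof.
move=> y0.
have h := has_derivD (has_deriv_sqr has_deriv_E)
  (has_derivM has_deriv_id (has_deriv_sqr has_deriv_E1)).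
have -> : 1 = E 0 ^+ 2 + 0 * E1 0 ^+ 2 by rewrite E0 mul0r addr0 expr1n.
apply: (has_deriv_ni h y0) => x _ /=.
have o := E_ode x.
have -> : 2 * E x * E1 x + (1 * E1 x ^+ 2 + x * (2 * E1 x * E2 x)) = - E1 x ^+ 2.
  have -> : E x = - (x * E2 x + E1 x) by rewrite o opprK.
  ring.
by rewrite oppr_le0 sqr_ge0.
Qed.

Lemma E_le1 y : 0 <= y -> `|E y| <= 1.
Proof.
move=> y0; have h := E_energy_le1 y0.
rewrite -(@expr_le1 _ 2)// real_normK ?num_real// (le_trans _ h)// lerDl.
by rewrite mulr_ge0// sqr_ge0.
Qed.

Lemma has_deriv_yE1 : has_deriv (fun y => y * E1 y) (fun y => - E y).
Proof.
apply: (has_deriv_eq (has_derivM has_deriv_id has_deriv_E1)) => y.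
by rewrite mul1r addrC E_ode.
Qed.

Lemma E1_0 : E1 0 = -1.
Proof. by have := E_ode 0; rewrite mul0r add0r E0. Qed.

(** Integrating (y E')' = - E from 0, with |E| <= 1, gives |y E'| <= y. *)
Lemma E1_le1 y : 0 <= y -> `|E1 y| <= 1.
Proof.
rewrite le_eqVlt => /predU1P[<-|y0]; first by rewrite E1_0 normrN1.
rewrite -(ler_pM2l y0) mulr1 -{1}(gtr0_norm y0) -normrM ler_norml.
apply/andP; split.
  have h := has_derivD has_deriv_yE1 (has_deriv_id (R := R)).
  have : 0 * E1 0 + 0 <= y * E1 y + y.
    apply: (has_deriv_nd h (ltW y0)) => x /andP[x0 _].
    by have := E_le1 x0; rewrite ler_norml => /andP[]; lra.
  by rewrite mul0r addr0; lra.
have h := has_derivB has_deriv_yE1 (has_deriv_id (R := R)).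
have : y * E1 y - y <= 0 * E1 0 - 0.
  apply: (has_deriv_ni h (ltW y0)) => x /andP[x0 _].
  by have := E_le1 x0; rewrite ler_norml => /andP[]; lra.
by rewrite mul0r subr0; lra.
Qed.

Lemma E2_le y : 0 < y -> `|E2 y| <= 2 / y.
Proof.
move=> y0; rewrite ler_pdivlMr// -{2}(gtr0_norm y0) -normrM mulrC.
have -> : y * E2 y = - E y - E1 y by rewrite -E_ode; ring.
rewrite (le_trans (ler_normB _ _))// normrN.
by have := E_le1 (ltW y0); have := E1_le1 (ltW y0); lra.
Qed.

(** This keeps the zeros of E away from 0, and E away from 0 near the origin. *)
Lemma E_ge y : 0 <= y -> 1 - y <= E y.
Proof.
move=> y0.
have : 1 - y * 1 <= 1 - y by rewrite mulr1.
have [c /andP[c0 _]] := has_deriv_MVT has_deriv_E y0.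
rewrite E0 subr0 => e.
have : - y <= E1 c * y.
  by have := E1_le1 c0; rewrite ler_norml => /andP[? ?]; nra.
by lra.
Qed.

(** A primitive of E^2. At a zero of E only the term y^2 E'(y)^2 is left: this
    is where J_0'(j_n)^2 in the norm of an eigenfunction comes from. *)
Definition Psi (y : R) := y * (E y ^+ 2 + y * E1 y ^+ 2).

Lemma has_deriv_Psi : has_deriv Psi (fun y => E y ^+ 2).
Proof.
have h := has_derivM has_deriv_id (has_derivD (has_deriv_sqr has_deriv_E)
  (has_derivM has_deriv_id (has_deriv_sqr has_deriv_E1))).
apply: (has_deriv_eq h) => x /=.
have -> : E x = - (x * E2 x + E1 x) by rewrite E_ode opprK.
ring.
Qed.

Lemma Psi_ge y : 1 <= y -> 8^-1 <= Psi y.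
Proof.
move=> y1.
(* Psi is nondecreasing, and Psi (1/2) >= (1/2) E(1/2)^2 with E(1/2) >= 1/2. *)
have h : Psi (2^-1) <= Psi y.
  by apply: (has_deriv_nd has_deriv_Psi) => [|x _]; [lra|exact: sqr_ge0].
apply: le_trans h; rewrite /Psi.
have e : 2^-1 <= E 2^-1 :> R by have := @E_ge 2^-1; lra.
have : 0 <= E1 2^-1 ^+ 2 :> R by exact: sqr_ge0.
by nra.
Qed.

Lemma E_zero_ge1 y : 0 <= y -> E y = 0 -> 1 <= y.
Proof. by move=> y0 e; have := E_ge y0; rewrite e; lra. Qed.

Lemma E_zero_E1 y : 0 <= y -> E y = 0 -> 8^-1 <= y ^+ 2 * E1 y ^+ 2.
Proof.
move=> y0 e; have := Psi_ge (E_zero_ge1 y0 e).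
by rewrite /Psi e; lra.
Qed.

Lemma E_zero_E1_neq0 y : 0 <= y -> E y = 0 -> E1 y != 0.
Proof.
by move=> y0 e; apply/eqP => z; have := E_zero_E1 y0 e; rewrite z; lra.
Qed.

Lemma besselJ0E (z : R) : besselJ0 z = E (z ^+ 2 / 4).
Proof.
rewrite /besselJ0 /E /pseries; congr (limn _); congr (series _); apply/funext => k.
rewrite /Ecoef; congr (_ * _).
by rewrite exprM; congr (_ ^+ _); rewrite exprMn; field.
Qed.

Lemma derive1_besselJ0 (z : R) : derive1 besselJ0 z = z / 2 * E1 (z ^+ 2 / 4).
Proof.
have -> : besselJ0 = (E \o (fun z => 4^-1 * z ^+ 2)) :> (R -> R).
  by apply/funext => x; rewrite besselJ0E /= mulrC.
have h := has_derivZ 4^-1 (has_deriv_sqr (has_deriv_id (R := R))).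
have h2 := @is_derive1_comp R E (fun z => 4^-1 * z ^+ 2) z _ _
  (has_deriv_E (4^-1 * z ^+ 2)) (h z).
rewrite derive1E; have [_ ->] := h2.
by rewrite mulrC [X in E1 X]mulrC /=; congr (_ * _); field.
Qed.

End BesselSeries.

(** * The inner product of L^2(a,b) *)

Section SquareIntegrable.
Context {R : realType}.
Variables a b : R.
Notation leb := (@lebesgue_measure R).
Implicit Types f g h : R -> R.

Lemma integral_leb_oo (f : R -> \bar R) : measurable_fun setT f ->
  (\int[leb_oo a b]_x f x = \int[leb]_(x in `]a, b[) f x)%E.
Proof.
move=> mf; rewrite -(setUv `]a, b[) integral_setU//=.
- rewrite [X in (_ + X)%E](_ : _ = 0%E); last first.
    rewrite -[RHS](@integral_measure_zero _ (measurableTypeR R) R (~` `]a, b[) f).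
    apply: eq_measure_integral => A mA AD.
    rewrite /leb_oo/= /mrestr (_ : A `&` _ = set0) ?measure0//.
    by apply/seteqP; split => // x [/AD].
  rewrite adde0; apply: eq_measure_integral => A mA AD.
  by rewrite /leb_oo/= /mrestr setIidl.
- exact: measurableC.
- by rewrite setUv.
- exact/disj_setPCl.
Qed.

Lemma L2_measurable f : f \in L2 a b -> measurable_fun setT f.
Proof. by rewrite /L2 inE => /andP[/set_mem]. Qed.

Lemma measurable_sqr f : measurable_fun setT f ->
  measurable_fun setT (fun x => (f x ^+ 2)%:E).
Proof. by move=> mf; apply/measurable_EFinP; exact: measurable_funX. Qed.

Lemma L2norm_sqr f : measurable_fun setT f ->
  (L2norm a b f = (\int[leb]_(x in `]a, b[) (f x ^+ 2)%:E) `^ 2^-1)%E.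
Proof.
move=> mf; rewrite /L2norm unlock; congr (_ `^ _)%E.
under eq_integral => x _.
  rewrite /= powR_mulrn// real_normK ?num_real//; over.
by rewrite integral_leb_oo//; exact: measurable_sqr.
Qed.

Lemma L2P f : f \in L2 a b <->
  measurable_fun setT f /\ (\int[leb]_(x in `]a, b[) (f x ^+ 2)%:E < +oo)%E.
Proof.
split => [fL|[mf fi]].
  have mf := L2_measurable fL; split => //.
  move: fL; rewrite /L2 inE => /andP[_ /set_mem].
  rewrite /finite_norm => h; apply: (@lty_poweRy _ _ 2^-1) => //.
  by rewrite -(L2norm_sqr mf).
rewrite /L2 inE; apply/andP; split; apply/mem_set => //.
rewrite /finite_norm; have := poweR_lty 2^-1 fi.
by rewrite -(L2norm_sqr mf).
Qed.

Definition Itg f := leb.-integrable `]a, b[ (EFin \o f).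
(** Real-valued counterparts of the extended real integrals and norms, for
    which the algebra of a Hilbert space is linear arithmetic. They are
    meaningful for members of [L2 a b]. *)
Definition ip f g := \int[leb]_(x in `]a, b[) (f x * g x).
Definition N2 f := Num.sqrt (ip f f).

Lemma L2_itg_sqr f : f \in L2 a b -> Itg (fun x => f x ^+ 2).
Proof.
move=> /L2P[mf fi]; apply/integrableP; split.
  exact: measurable_funTS (measurable_sqr mf).
by under eq_integral do rewrite /= ger0_norm ?sqr_ge0//.
Qed.

Lemma L2_itg f g : f \in L2 a b -> g \in L2 a b -> Itg (fun x => f x * g x).
Proof.
move=> fL gL; have mf := L2_measurable fL; have mg := L2_measurable gL.
have i : leb.-integrable `]a, b[
    (fun x => (f x ^+ 2)%R%:E + (g x ^+ 2)%R%:E)%E.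
  by apply: integrableD => //; exact: L2_itg_sqr.
apply: (le_integrable _ _ _ i) => //.
  by apply: measurable_funTS; apply/measurable_EFinP; exact: measurable_funM.
move=> x _ /=; rewrite lee_fin [leRHS]ger0_norm ?addr_ge0 ?sqr_ge0//.
by rewrite normrM -(real_normK (num_real (f x))) -(real_normK (num_real (g x))); nra.
Qed.

Lemma ipC f g : ip f g = ip g f.
Proof. by apply: eq_Rintegral => x _; rewrite mulrC. Qed.

Lemma ip_ext f g f' g' : (forall x, a < x < b -> f x = f' x) ->
  (forall x, a < x < b -> g x = g' x) -> ip f g = ip f' g'.
Proof.
move=> hf hg; apply: eq_Rintegral => x; rewrite inE/= in_itv/= => xab.
by rewrite hf// hg.
Qed.

Lemma ip_ge0 f : 0 <= ip f f.
Proof. by apply: Rintegral_ge0 => x _; rewrite -expr2 sqr_ge0. Qed.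

Lemma L2_lin (c : R) f g : f \in L2 a b -> g \in L2 a b ->
  (fun x => c * f x + g x) \in L2 a b.
Proof.
move=> fL gL.
by have := @Lfun_submod_closed _ _ _ (leb_oo a b) _ (lee1n 2); case=> _; exact.
Qed.

Lemma L2_0 : (fun=> 0) \in L2 a b.
Proof.
by have := @Lfun_submod_closed _ _ _ (leb_oo a b) _ (lee1n 2); case.
Qed.

Lemma L2Z (c : R) f : f \in L2 a b -> (fun x => c * f x) \in L2 a b.
Proof.
move=> fL; have := L2_lin c fL L2_0.
by rewrite (_ : (fun x => c * f x + 0) = (fun x => c * f x))//; apply/funext => x; rewrite addr0.
Qed.

Lemma L2D f g : f \in L2 a b -> g \in L2 a b -> (fun x => f x + g x) \in L2 a b.
Proof.
move=> fL gL; have := L2_lin 1 fL gL.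
by rewrite (_ : (fun x => 1 * f x + _) = (fun x => f x + g x))//; apply/funext => x; rewrite mul1r.
Qed.

Lemma L2B f g : f \in L2 a b -> g \in L2 a b -> (fun x => f x - g x) \in L2 a b.
Proof.
move=> fL gL; have := L2_lin (-1) gL fL.
by rewrite (_ : (fun x => -1 * _ + _) = (fun x => f x - g x))//; apply/funext => x; rewrite mulN1r addrC.
Qed.

Lemma L2_sum (I : Type) (r : seq I) (P : pred I) (F : I -> R -> R) :
  (forall i, P i -> F i \in L2 a b) -> (fun x => \sum_(i <- r | P i) F i x) \in L2 a b.
Proof.
move=> h; elim: r => [|i r ih].
  rewrite (_ : (fun x => _) = (fun=> 0)); first exact: L2_0.
  by apply/funext => x; rewrite big_nil.
have [Pi|Pi] := boolP (P i).
  rewrite (_ : (fun x => _) = (fun x => F i x + \sum_(i <- r | P i) F i x)).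
    by apply: L2D => //; exact: h.
  by apply/funext => x; rewrite big_cons Pi.
rewrite (_ : (fun x => _) = (fun x => \sum_(i <- r | P i) F i x))//.
by apply/funext => x; rewrite big_cons (negbTE Pi).
Qed.

Lemma ip_linl (c : R) f g h : f \in L2 a b -> g \in L2 a b -> h \in L2 a b ->
  ip (fun x => c * f x + g x) h = c * ip f h + ip g h.
Proof.
move=> fL gL hL; rewrite /ip.
rewrite -RintegralZl//; last exact: L2_itg.
rewrite -RintegralD//; last 2 first.
- have := L2_itg (L2Z c fL) hL.
  rewrite (_ : (fun x => c * f x * h x) = (fun x => c * (f x * h x)))//.
  by apply/funext => x; rewrite mulrA.
- exact: L2_itg.
by apply: eq_Rintegral => x _; rewrite mulrDl mulrA.
Qed.

Lemma ip0l f : ip (fun=> 0) f = 0.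
Proof.
rewrite /ip; under eq_Rintegral do rewrite mul0r.
by rewrite Rintegral_cst// mul0r.
Qed.

Lemma ipZl (c : R) f h : f \in L2 a b -> h \in L2 a b ->
  ip (fun x => c * f x) h = c * ip f h.
Proof.
move=> fL hL; have := ip_linl c fL L2_0 hL; rewrite ip0l addr0 => <-.
by apply: ip_ext => x // _; rewrite addr0.
Qed.

Lemma ipZr (c : R) f h : f \in L2 a b -> h \in L2 a b ->
  ip h (fun x => c * f x) = c * ip h f.
Proof. by move=> fL hL; rewrite ipC ipZl// ipC. Qed.

Lemma ipDl f g h : f \in L2 a b -> g \in L2 a b -> h \in L2 a b ->
  ip (fun x => f x + g x) h = ip f h + ip g h.
Proof.
move=> fL gL hL; have := ip_linl 1 fL gL hL; rewrite mul1r => <-.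
by apply: ip_ext => x // _; rewrite mul1r.
Qed.

Lemma ipBl f g h : f \in L2 a b -> g \in L2 a b -> h \in L2 a b ->
  ip (fun x => f x - g x) h = ip f h - ip g h.
Proof.
move=> fL gL hL; have := ip_linl (-1) gL fL hL; rewrite mulN1r addrC => <-.
by apply: ip_ext => x // _; rewrite mulN1r addrC.
Qed.

Lemma ipBr f g h : f \in L2 a b -> g \in L2 a b -> h \in L2 a b ->
  ip h (fun x => f x - g x) = ip h f - ip h g.
Proof. by move=> fL gL hL; rewrite ipC ipBl// ![ip _ h]ipC. Qed.

Lemma ip_suml (I : Type) (r : seq I) (P : pred I) (F : I -> R -> R) g :
  (forall i, P i -> F i \in L2 a b) -> g \in L2 a b ->
  ip (fun x => \sum_(i <- r | P i) F i x) g = \sum_(i <- r | P i) ip (F i) g.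
Proof.
move=> h gL; elim: r => [|i r ih].
  by rewrite big_nil -[RHS](ip0l g); apply: ip_ext => // x _; rewrite big_nil.
rewrite big_cons -ih; case: ifPn => Pi.
  rewrite -ipDl//; [|exact: h|exact: L2_sum].
  by apply: ip_ext => // x _; rewrite big_cons Pi.
by apply: ip_ext => // x _; rewrite big_cons (negbTE Pi).
Qed.

Lemma ip_sumr (I : Type) (r : seq I) (P : pred I) (F : I -> R -> R) g :
  (forall i, P i -> F i \in L2 a b) -> g \in L2 a b ->
  ip g (fun x => \sum_(i <- r | P i) F i x) = \sum_(i <- r | P i) ip g (F i).
Proof.
move=> h gL; rewrite ipC ip_suml//; apply: eq_bigr => i _; exact: ipC.
Qed.

Lemma ip_sqrB f g : f \in L2 a b -> g \in L2 a b ->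
  ip (fun x => f x - g x) (fun x => f x - g x) = ip f f - 2 * ip f g + ip g g.
Proof.
move=> fL gL; rewrite ipBl ?ipBr ?L2B//.
by rewrite (ipC g f); lra.
Qed.

Lemma ip_sqrD f g : f \in L2 a b -> g \in L2 a b ->
  ip (fun x => f x + g x) (fun x => f x + g x) = ip f f + 2 * ip f g + ip g g.
Proof.
move=> fL gL; rewrite ipDl ?L2D//.
rewrite (ipC f (fun x => f x + g x)) ipDl ?L2D//.
rewrite (ipC g (fun x => f x + g x)) ipDl ?L2D//.
by rewrite (ipC g f); lra.
Qed.

Lemma ip_CS f g : f \in L2 a b -> g \in L2 a b -> ip f g ^+ 2 <= ip f f * ip g g.
Proof.
move=> fL gL.
have H (c : R) : 0 <= ip f f - 2 * (c * ip f g) + c ^+ 2 * ip g g.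
  have := ip_ge0 (fun x => f x - c * g x).
  rewrite ip_sqrB ?L2Z// ipZr// ipZl ?L2Z// ipZr//.
  by rewrite mulrA -expr2.
(* If <g,g> = 0, the bound is affine in c, and c is chosen to make it -1. *)
have [g0|g0] := eqVneq (ip g g) 0.
  have [/eqP ->|fg0] := boolP (ip f g == 0); first by rewrite expr0n/= g0 mulr0.
  have := H ((ip f f + 1) / (2 * ip f g)); rewrite g0 mulr0 addr0.
  have -> : 2 * ((ip f f + 1) / (2 * ip f g) * ip f g) = ip f f + 1 by field.
  by lra.
have gp : 0 < ip g g by rewrite lt_neqAle eq_sym g0 ip_ge0.
have := H (ip f g / ip g g).
have -> : ip f f - 2 * (ip f g / ip g g * ip f g) + (ip f g / ip g g) ^+ 2 * ip g g
  = ip f f - ip f g ^+ 2 / ip g g by field.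
by rewrite subr_ge0 ler_pdivrMr.
Qed.

Lemma N2_ge0 f : 0 <= N2 f. Proof. exact: sqrtr_ge0. Qed.

Lemma N2_sqr f : N2 f ^+ 2 = ip f f.
Proof. by rewrite sqr_sqrtr// ip_ge0. Qed.

Lemma ip_le_N2 f g : f \in L2 a b -> g \in L2 a b -> `|ip f g| <= N2 f * N2 g.
Proof.
move=> fL gL; rewrite -(@ler_pXn2r _ 2) ?nnegrE ?mulr_ge0 ?N2_ge0//.
by rewrite real_normK ?num_real// exprMn !N2_sqr ip_CS.
Qed.

Lemma N2D f g : f \in L2 a b -> g \in L2 a b ->
  N2 (fun x => f x + g x) <= N2 f + N2 g.
Proof.
move=> fL gL; rewrite -(@ler_pXn2r _ 2) ?nnegrE ?addr_ge0 ?N2_ge0//.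
rewrite N2_sqr ip_sqrD// sqrrD !N2_sqr.
have := le_trans (ler_norm _) (ip_le_N2 fL gL).
by lra.
Qed.

Lemma N2Z (c : R) f : f \in L2 a b -> N2 (fun x => c * f x) = `|c| * N2 f.
Proof.
move=> fL; rewrite /N2 ipZl ?L2Z// ipZr// mulrA -expr2 sqrtrM ?sqr_ge0//.
by rewrite sqrtr_sqr.
Qed.

Lemma N2_ext f g : (forall x, a < x < b -> f x = g x) -> N2 f = N2 g.
Proof. by move=> h; rewrite /N2 (ip_ext h h). Qed.

Lemma N2BC f g : N2 (fun x => f x - g x) = N2 (fun x => g x - f x).
Proof.
rewrite /N2; congr Num.sqrt; apply: eq_Rintegral => x _.
by rewrite -mulrNN !opprB.
Qed.

Lemma N2_tri f g h : f \in L2 a b -> g \in L2 a b -> h \in L2 a b ->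
  N2 (fun x => f x - h x) <= N2 (fun x => f x - g x) + N2 (fun x => g x - h x).
Proof.
move=> fL gL hL; apply: le_trans (N2D (L2B fL gL) (L2B gL hL)).
by rewrite le_eqVlt; apply/orP; left; apply/eqP; apply: N2_ext => x _; lra.
Qed.

Lemma ip_fin f : f \in L2 a b ->
  (\int[leb]_(x in `]a, b[) (f x ^+ 2)%:E = (ip f f)%:E)%E.
Proof.
move=> fL; rewrite /ip /Rintegral fineK.
  by apply: eq_integral => x _; rewrite -expr2.
by apply: integrable_fin_num => //; exact: L2_itg.
Qed.

Lemma L2normE f : f \in L2 a b -> L2norm a b f = (N2 f)%:E.
Proof.
move=> fL; rewrite L2norm_sqr; last exact: L2_measurable.
have -> := ip_fin fL.
by rewrite poweR_EFin powR12_sqrt// ip_ge0.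
Qed.

Lemma continuous_L2 f : continuous f -> f \in L2 a b.
Proof.
move=> cf; apply/L2P; split; first exact: continuous_measurable_fun.
have i : leb.-integrable `[a, b] (EFin \o (fun x => f x ^+ 2)).
  apply: continuous_compact_integrable; first exact: segment_compact.
  apply: continuous_subspaceT => x.
  rewrite (_ : (fun x => f x ^+ 2) = (fun x => f x * f x)).
    by apply: cvgM; exact: cf.
  by apply/funext => y; rewrite expr2.
have s : `]a, b[ `<=` `[a, b] by apply: subset_itv; rewrite bnd_simp.
have {i} : leb.-integrable `]a, b[ (EFin \o (fun x => f x ^+ 2)).
  exact: integrableS i.
move=> /integrableP[_].
by under eq_integral do rewrite /= ger0_norm ?sqr_ge0//.
Qed.

End SquareIntegrable.

(** * Integrals of continuous functions *)

Section ContinuousIntegrals.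
Context {R : realType}.
Notation leb := (@lebesgue_measure R).
Implicit Types f g : R -> R.

Lemma continuous_itg f (a b : R) : continuous f ->
  leb.-integrable `]a, b[ (EFin \o f).
Proof.
move=> cf.
have i : leb.-integrable `[a, b] (EFin \o f).
  by apply: continuous_compact_integrable; [exact: segment_compact|exact: continuous_subspaceT].
have s : `]a, b[ `<=` `[a, b] by apply: subset_itv; rewrite bnd_simp.
exact: integrableS i.
Qed.

Lemma continuousD_fun f g : continuous f -> continuous g -> continuous (fun x => f x + g x).
Proof. by move=> cf cg x; apply: cvgD; [exact: cf|exact: cg]. Qed.

Lemma continuousB_fun f g : continuous f -> continuous g -> continuous (fun x => f x - g x).
Proof. by move=> cf cg x; apply: cvgB; [exact: cf|exact: cg]. Qed.

Lemma continuousM_fun f g : continuous f -> continuous g -> continuous (fun x => f x * g x).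
Proof. by move=> cf cg x; apply: cvgM; [exact: cf|exact: cg]. Qed.

Lemma continuousZ_fun (c : R) f : continuous f -> continuous (fun x => c * f x).
Proof. by move=> cf; apply: continuousM_fun => // x; exact: cvg_cst. Qed.

Lemma continuousX2_fun f : continuous f -> continuous (fun x => f x ^+ 2).
Proof.
move=> cf; rewrite (_ : (fun x => f x ^+ 2) = (fun x => f x * f x)).
  exact: continuousM_fun.
by apply/funext => y; rewrite expr2.
Qed.

Lemma continuous_shift (c : R) : continuous (fun x : R => x - c).
Proof. exact: has_deriv_continuous (has_deriv_shift c). Qed.

Lemma le_Rintegral_cont f g (a b : R) : continuous f -> continuous g ->
  (forall x, a < x < b -> f x <= g x) ->
  \int[leb]_(x in `]a, b[) f x <= \int[leb]_(x in `]a, b[) g x.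
Proof.
by move=> cf cg h; apply: le_Rintegral => //; exact: continuous_itg.
Qed.

Lemma Rintegral_linB (c : R) f g (a b : R) : continuous f -> continuous g ->
  \int[leb]_(x in `]a, b[) (f x - c * g x) =
  \int[leb]_(x in `]a, b[) f x - c * \int[leb]_(x in `]a, b[) g x.
Proof.
move=> cf cg; rewrite -RintegralZl//; last exact: continuous_itg.
by rewrite -RintegralB//; apply: continuous_itg => //; exact: continuousZ_fun.
Qed.

Lemma Rintegral_oo_cst (a b c : R) : a <= b ->
  \int[leb]_(x in `]a, b[) c = (b - a) * c.
Proof.
move=> ab; rewrite Rintegral_cst//.
have e : leb `]a, b[ = (b - a)%:E.
  rewrite lebesgue_measure_itv/= lte_fin.
  by case: ltgtP ab => //= -> _; rewrite subrr.
by rewrite mulrC; congr (_ * _); exact: (congr1 fine e).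
Qed.

End ContinuousIntegrals.

(** * The inverse of the degenerate operator *)

Section InversePair.
Context {R : realType}.
Variable a : R.
Hypothesis a1 : a < 1.
Notation leb := (@lebesgue_measure R).
Notation L := (1 - a).
Notation ip := (ip a 1).
Implicit Types (f g h : R -> R).

Let L0 : 0 < L. Proof. by rewrite subr_gt0. Qed.

(** h = (- A)^-1 f for A h = ((x - a) h')'. Since h is differentiable at a,
    the boundary condition there holds automatically: the weight x - a
    vanishes. *)
Definition inverse_pair f h := [/\ continuous f, h 1 = 0 &
  exists dh ddh : R -> R, [/\ has_deriv h dh, has_deriv dh ddh &
    forall x, (x - a) * ddh x + dh x = - f x]].

Lemma inverse_pair_contr f h : inverse_pair f h -> continuous h.
Proof. by case=> _ _ [dh [ddh [hd _ _]]]; exact: has_deriv_continuous hd. Qed.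

Lemma inverse_pair_L2l f h : inverse_pair f h -> f \in L2 a 1.
Proof. by case=> cf _ _; exact: continuous_L2. Qed.

Lemma inverse_pair_L2r f h : inverse_pair f h -> h \in L2 a 1.
Proof. by move=> /inverse_pair_contr ch; exact: continuous_L2. Qed.

Lemma inverse_pair_lin (c : R) f h f' h' : inverse_pair f h -> inverse_pair f' h' ->
  inverse_pair (fun x => f x + c * f' x) (fun x => h x + c * h' x).
Proof.
case=> cf h1 [dh [ddh [hd hdd e]]] [cf' h1' [dh' [ddh' [hd' hdd' e']]]]; split.
- by apply: continuousD_fun => //; exact: continuousZ_fun.
- by rewrite h1 h1' mulr0 addr0.
- exists (fun x => dh x + c * dh' x), (fun x => ddh x + c * ddh' x); split.
  + by apply: has_derivD => //; exact: has_derivZ.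
  + by apply: has_derivD => //; exact: has_derivZ.
  + by move=> x; rewrite opprD -e -[c * f' x]opprK -mulrN -e'; ring.
Qed.

Lemma inverse_pair_sum (I : Type) (r : seq I) (c : I -> R) f h (F H : I -> R -> R) :
  inverse_pair f h -> (forall i, inverse_pair (F i) (H i)) ->
  inverse_pair (fun x => f x + \sum_(i <- r) c i * F i x)
    (fun x => h x + \sum_(i <- r) c i * H i x).
Proof.
move=> fh FH; elim/last_ind: r => [|r i ih].
  rewrite (_ : (fun x => f x + _) = f); last by apply/funext => x; rewrite big_nil addr0.
  by rewrite (_ : (fun x => h x + _) = h)//; apply/funext => x; rewrite big_nil addr0.
have := inverse_pair_lin (c i) ih (FH i); congr inverse_pair; apply/funext => x;
  by rewrite -cats1 big_cat/= big_seq1 addrA.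
Qed.

(** A is symmetric: f h' - h f', where f' and h' form the second pair, is the
    derivative of (x - a) times the Wronskian of the two solutions. That
    product is 0 at a because of the weight, and at 1 because both solutions
    vanish there. *)
Lemma inverse_pair_sym f h f' h' : inverse_pair f h -> inverse_pair f' h' ->
  ip f h' = ip h f'.
Proof.
move=> P P'.
have [cf h1 [dh [ddh [hd hdd e]]]] := P.
have [cf' h1' [dh' [ddh' [hd' hdd' e']]]] := P'.
have D : has_deriv (fun x => (x - a) * (h x * dh' x - h' x * dh x))
    (fun x => f x * h' x - 1 * (h x * f' x)).
  apply: (has_deriv_eq (has_derivM (has_deriv_shift a)
    (has_derivB (has_derivM hd hdd') (has_derivM hd' hdd)))) => x.
  by rewrite -[f x]opprK -[f' x]opprK -e -e'; ring.
have c1 : continuous (fun x => f x * h' x).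
  by apply: continuousM_fun => //; exact: inverse_pair_contr P'.
have c2 : continuous (fun x => h x * f' x).
  by apply: continuousM_fun => //; exact: inverse_pair_contr P.
have := FTC_Rintegral a1 D; rewrite Rintegral_linB// mul1r.
rewrite h1 h1' subrr !mul0r subrr mulr0 subrr => /(_ _)/eqP.
rewrite subr_eq0 => /(_ _)/eqP; apply.
by apply: continuousB_fun => //; exact: continuousZ_fun.
Qed.

(** Integration by parts identifies the quadratic form of - A. *)
Lemma inverse_pair_energy f h : inverse_pair f h ->
  exists dh, [/\ has_deriv h dh, continuous dh &
    ip f h = \int[leb]_(x in `]a, 1[) ((x - a) * dh x ^+ 2)].
Proof.
move=> P; have [cf h1 [dh [ddh [hd hdd e]]]] := P.
have cdh := has_deriv_continuous hdd.
exists dh; split => //.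
have D : has_deriv (fun x => (x - a) * (h x * dh x))
    (fun x => (x - a) * dh x ^+ 2 - 1 * (f x * h x)).
  apply: (has_deriv_eq (has_derivM (has_deriv_shift a) (has_derivM hd hdd))) => x.
  by rewrite -[f x]opprK -e; ring.
have c1 : continuous (fun x => f x * h x).
  by apply: continuousM_fun => //; exact: inverse_pair_contr P.
have c2 : continuous (fun x => (x - a) * dh x ^+ 2).
  apply: continuousM_fun; [exact: continuous_shift|exact: continuousX2_fun].
have := FTC_Rintegral a1 D; rewrite Rintegral_linB// mul1r.
rewrite h1 subrr !mul0r mulr0 subrr => /(_ _)/eqP.
rewrite subr_eq0 => /(_ _)/eqP/esym; apply.
by apply: continuousB_fun => //; exact: continuousZ_fun.
Qed.

Lemma inverse_pair_ge0 f h : inverse_pair f h -> 0 <= ip f h.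
Proof.
case/inverse_pair_energy => dh [_ _ ->]; apply: Rintegral_ge0 => x.
by rewrite /= in_itv/= => /andP[ax _]; rewrite mulr_ge0 ?sqr_ge0// subr_ge0 ltW.
Qed.

(** Integrating ((x - a) h^2)', which has integral 0, gives the Hardy type
    inequality <h,h> <= 4 L <f,h>; a completed square does the rest. *)
Lemma inverse_pair_bound f h : inverse_pair f h ->
  ip h h <= 16 * L ^+ 2 * ip f f.
Proof.
move=> P; have [dh [hd cdh e]] := inverse_pair_energy P.
have ch := inverse_pair_contr P.
have h1 : h 1 = 0 by case: P.
have D := has_derivM (has_deriv_shift a) (has_deriv_sqr hd).
have cD : continuous (fun x => 1 * h x ^+ 2 + (x - a) * (2 * h x * dh x)).
  apply: continuousD_fun; first exact/continuousZ_fun/continuousX2_fun.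
  apply: continuousM_fun; first exact: continuous_shift.
  by apply: continuousM_fun => //; exact: continuousZ_fun.
have c0 : continuous (fun x => (x - a) * dh x ^+ 2).
  apply: continuousM_fun; [exact: continuous_shift|exact: continuousX2_fun].
have ch2 : continuous (fun x => 2^-1 * (h x * h x)).
  by apply: continuousZ_fun; exact: continuousM_fun.
have H : \int[leb]_(x in `]a, 1[) (2^-1 * (h x * h x) - 2 * L * ((x - a) * dh x ^+ 2)) <= 0.
  have := FTC_Rintegral a1 D cD; rewrite h1 expr0n/= mulr0 subrr mul0r subrr => <-.
  apply: le_Rintegral_cont => //.
    by apply: continuousB_fun => //; exact: continuousZ_fun.
  move=> x /andP[ax x1].
  (* Pointwise: ((x - a) h^2)' >= h^2 / 2 - 2 (x - a)^2 h'^2. *)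
  have k : 0 <= 2^-1 * (h x + 2 * (x - a) * dh x) ^+ 2.
    by rewrite mulr_ge0 ?sqr_ge0.
  have k2 : 0 <= (1 - x) * (x - a) * dh x ^+ 2.
    by rewrite mulr_ge0 ?sqr_ge0// mulr_ge0// subr_ge0 ltW.
  by nra.
move: H; rewrite Rintegral_linB// -e.
have <- : 2^-1 * ip h h = \int[leb]_(x in `]a, 1[) (2^-1 * (h x * h x)).
  by rewrite -ipZl ?continuous_L2//; apply: eq_Rintegral => x _; rewrite mulrA.
have fL := inverse_pair_L2l P; have hL := inverse_pair_L2r P.
have := ip_ge0 a 1 (fun x => 2^-1 * h x - 2 * L * f x).
rewrite ip_sqrB ?L2Z// !(ipZl, ipZr) ?L2Z// (ipC _ _ h f).
by nra.
Qed.

(** The solution of ((x - a) w')' = - l w that is regular at a and has value 1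
    there; it is an eigenfunction when [E (l * (1 - a)) = 0]. *)
Definition ev (l x : R) : R := E (l * (x - a)).

Lemma has_deriv_ev l : has_deriv (ev l) (fun x => l * E1 (l * (x - a))).
Proof. exact: has_deriv_affine has_deriv_E. Qed.

Lemma has_deriv_dev l : has_deriv (fun x => l * E1 (l * (x - a)))
   (fun x => l * (l * E2 (l * (x - a)))).
Proof. exact: has_derivZ (has_deriv_affine _ _ has_deriv_E1). Qed.

Lemma ev_ode l x : (x - a) * (l * (l * E2 (l * (x - a)))) + l * E1 (l * (x - a))
  = - (l * ev l x).
Proof. by rewrite /ev -mulrN -E_ode; ring. Qed.

Lemma continuous_ev l : continuous (ev l).
Proof. exact: has_deriv_continuous (has_deriv_ev l). Qed.

Lemma ev_L2 l : ev l \in L2 a 1. Proof. exact/continuous_L2/continuous_ev. Qed.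

Lemma ev_le1 l x : 0 <= l -> a <= x -> `|ev l x| <= 1.
Proof. by move=> l0 ax; apply: E_le1; rewrite mulr_ge0 ?subr_ge0. Qed.

Lemma inverse_pair_ev l : E (l * L) = 0 -> inverse_pair (fun x => l * ev l x) (ev l).
Proof.
move=> e; split => //; first exact/continuousZ_fun/continuous_ev.
exists (fun x => l * E1 (l * (x - a))), (fun x => l * (l * E2 (l * (x - a)))).
by split; [exact: has_deriv_ev|exact: has_deriv_dev|exact: ev_ode].
Qed.

Lemma ip_ev l : l != 0 -> ip (ev l) (ev l) = Psi (l * L) / l.
Proof.
move=> l0.
have D := has_derivZ l^-1 (@has_deriv_affine R _ _ l a has_deriv_Psi).
have := FTC_Rintegral a1 D; rewrite subrr !mulr0 (_ : Psi 0 = 0); last by rewrite /Psi mul0r.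
rewrite mulr0 subr0 mulrC => <-.
  by apply: eq_Rintegral => x _; rewrite mulKf.
by apply: continuousZ_fun; apply: continuousZ_fun; apply: continuousX2_fun; exact: continuous_ev.
Qed.

Lemma ip_1_ev l : l != 0 -> ip (fun=> 1) (ev l) = - (L * E1 (l * L)).
Proof.
move=> l0.
have D := has_derivZ (- l^-1) (@has_deriv_affine R _ _ l a has_deriv_yE1).
have := FTC_Rintegral a1 D; rewrite subrr !(mulr0, mul0r) subr0.
have -> : - l^-1 * (l * L * E1 (l * L)) = - (L * E1 (l * L)) by field.
move=> <-; last first.
  apply: continuousZ_fun; apply: continuousZ_fun => x; apply: cvgN.
  exact: continuous_ev.
by apply: eq_Rintegral => x _; rewrite mul1r /ev; field.
Qed.

Lemma ip_ev_gt0 l : 0 < l -> E (l * L) = 0 -> 0 < ip (ev l) (ev l).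
Proof.
move=> l0 e; rewrite ip_ev ?gt_eqF// divr_gt0//.
have lL : 0 <= l * L by rewrite mulr_ge0 ?ltW.
by apply: lt_le_trans (Psi_ge (E_zero_ge1 lL e)).
Qed.

Lemma ip_ev_orth l m : l != m -> E (l * L) = 0 -> E (m * L) = 0 ->
  ip (ev l) (ev m) = 0.
Proof.
move=> lm el em.
have := inverse_pair_sym (inverse_pair_ev el) (inverse_pair_ev em).
rewrite ipZl ?ev_L2// ipZr ?ev_L2// => /eqP.
by rewrite -subr_eq0 -mulrBl mulf_eq0 subr_eq0 (negbTE lm) => /eqP.
Qed.

Lemma le_Rintegral_sub g x : continuous g -> a <= x <= 1 -> (forall y, 0 <= g y) ->
  \int[leb]_(y in `]a, x[) g y <= \int[leb]_(y in `]a, 1[) g y.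
Proof.
move=> cg /andP[ax x1] g0; rewrite /Rintegral fine_le//.
- by apply: integrable_fin_num => //; exact: continuous_itg.
- by apply: integrable_fin_num => //; exact: continuous_itg.
- apply: ge0_subset_integral => //.
  + by apply/measurable_EFinP; apply: measurable_funTS; exact: continuous_measurable_fun.
  + by move=> y _; rewrite lee_fin.
  + by apply: subset_itvl; rewrite bnd_simp.
Qed.

(** The energy l z^2 + (x - a) z'^2 is 0 at a, and its derivative
    - z'^2 - 2 z' g is at most g^2. *)
Lemma energy_estimate (l : R) z dz ddz g : 0 < l -> continuous g ->
  has_deriv z dz -> has_deriv dz ddz -> z a = 0 ->
  (forall x, (x - a) * ddz x + dz x = - (g x + l * z x)) ->
  forall x, a <= x <= 1 -> l * z x ^+ 2 <= ip g g.
Proof.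
move=> l0 cg hz hdz z0 e x /andP[ax x1].
have cz := has_deriv_continuous hz; have cdz := has_deriv_continuous hdz.
have cg2 : continuous (fun x => g x * g x) by exact: continuousM_fun.
move: ax; rewrite le_eqVlt => /predU1P[<-|ax].
  by rewrite z0 expr0n/= mulr0 ip_ge0.
have D : has_deriv (fun x => l * z x ^+ 2 + (x - a) * dz x ^+ 2)
    (fun x => - dz x ^+ 2 - 2 * (dz x * g x)).
  apply: (has_deriv_eq (has_derivD (has_derivZ l (has_deriv_sqr hz))
    (has_derivM (has_deriv_shift a) (has_deriv_sqr hdz)))) => y /=.
  have -> : g y = - ((y - a) * ddz y + dz y) - l * z y by rewrite e; ring.
  ring.
have cD : continuous (fun x => - dz x ^+ 2 - 2 * (dz x * g x)).
  apply: continuousB_fun; last exact/continuousZ_fun/continuousM_fun.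
  by move=> y; apply: cvgN; exact: continuousX2_fun.
have := FTC_Rintegral ax D cD.
rewrite z0 expr0n/= mulr0 subrr mul0r addr0 subr0 => e2.
have : \int[leb]_(x in `]a, x[) (- dz x ^+ 2 - 2 * (dz x * g x))
    <= \int[leb]_(x in `]a, x[) (g x * g x).
  apply: le_Rintegral_cont => // y _.
  by have := sqr_ge0 (dz y + g y); nra.
rewrite e2 => h.
have k : 0 <= (x - a) * dz x ^+ 2 by rewrite mulr_ge0 ?sqr_ge0// subr_ge0 ltW.
have := @le_Rintegral_sub _ x cg2 _ (fun y => _).
rewrite (ltW ax) x1 => /(_ isT) h2.
have h3 : forall y, 0 <= g y * g y by move=> y; rewrite -expr2 sqr_ge0.
by have := h2 h3; rewrite -/(ip g g); lra.
Qed.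

Lemma ip_le_bound f g (c d : R) : continuous f -> continuous g ->
  0 <= c -> (forall x, a <= x <= 1 -> `|f x| <= c) ->
  (forall x, a <= x <= 1 -> `|g x| <= d) -> `|ip f g| <= L * (c * d).
Proof.
move=> cf cg c0 fc gd.
have cfg : continuous (fun x => f x * g x) by exact: continuousM_fun.
have b x : a < x < 1 -> `|f x * g x| <= c * d.
  move=> /andP[ax x1]; have xx : a <= x <= 1 by rewrite !ltW.
  by rewrite normrM ler_pM// ?fc ?gd.
rewrite ler_norml -mulrN -!(Rintegral_oo_cst _ (ltW a1)); apply/andP; split;
  apply: le_Rintegral_cont => //; try by move=> x; exact: cvg_cst.
- by move=> x /b; rewrite ler_norml => /andP[].
- by move=> x /b; rewrite ler_norml => /andP[].
Qed.

(** A quantitative form of the alternative: l is an eigenvalue, or l + A is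
    invertible. The difference z = h - h(a) w_l solves an equation with
    right-hand side f - l h and z(a) = 0, so that the energy estimate bounds
    it. The number h(a) is recovered from h(1) = 0 when w_l(1) <> 0, and from
    the orthogonality of h and w_l otherwise. *)
Lemma resolvent_estimate (l : R) : 0 < l -> exists2 C : R, 0 <= C &
  forall f h, inverse_pair f h -> (E (l * L) = 0 -> ip h (ev l) = 0) ->
    ip h h <= C * ip (fun x => f x - l * h x) (fun x => f x - l * h x).
Proof.
move=> l0.
have [K K0 HK] : exists2 K : R, 0 <= K & forall h s, continuous h -> 0 <= s ->
    h 1 = 0 -> (E (l * L) = 0 -> ip h (ev l) = 0) ->
    (forall x, a <= x <= 1 -> `|h x - h a * ev l x| <= s) ->
    `|h a| <= K * s.
  have [e|e] := eqVneq (E (l * L)) 0; last first.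
    exists (`|E (l * L)|^-1); first by rewrite invr_ge0.
    move=> h s ch s0 h1 _ /(_ 1); rewrite h1 sub0r normrN normrM lexx ltW// => /(_ isT).
    by rewrite mulrC -/(ev l 1) ler_pdivlMl ?normr_gt0// mulrC.
  have p := ip_ev_gt0 l0 e.
  exists (L / ip (ev l) (ev l)); first by rewrite divr_ge0// ltW.
  move=> h s ch s0 h1 /(_ e) o B.
  have cz : continuous (fun x => h x - h a * ev l x).
    by apply: continuousB_fun => //; exact/continuousZ_fun/continuous_ev.
  have := ip_le_bound cz (@continuous_ev l) s0 B
    (fun x xx => ev_le1 (ltW l0) (andP xx).1).
  rewrite ipBl ?ipZl ?L2Z ?ev_L2 ?continuous_L2// o sub0r normrN normrM.
  by rewrite (gtr0_norm p) mulr1 mulrAC ler_pdivlMr.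
exists (L * (1 + K) ^+ 2 / l).
  by apply: divr_ge0; [rewrite mulr_ge0 ?sqr_ge0// ltW|exact: ltW].
move=> f h P o.
have ch := inverse_pair_contr P.
have [cf h1 [dh [ddh [hd hdd e]]]] := P.
set g := fun x => f x - l * h x.
have cg : continuous g by apply: continuousB_fun => //; exact: continuousZ_fun.
set s := Num.sqrt (ip g g / l).
have s0 : 0 <= s by exact: sqrtr_ge0.
have s2 : s ^+ 2 = ip g g / l by rewrite sqr_sqrtr// divr_ge0 ?ip_ge0// ltW.
have hz x : a <= x <= 1 -> `|h x - h a * ev l x| <= s.
  move=> xx; rewrite -(@ler_pXn2r _ 2) ?nnegrE// real_normK ?num_real// s2.
  rewrite ler_pdivlMr// mulrC.
  apply: (@energy_estimate l _ _ _ g l0 cg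
    (has_derivB hd (has_derivZ (h a) (has_deriv_ev l)))
    (has_derivB hdd (has_derivZ (h a) (has_deriv_dev l)))) => //.
    by rewrite /ev subrr mulr0 E0 mulr1 subrr.
  move=> y /=; rewrite /g.
  have -> : f y - l * h y + l * (h y - h a * ev l y) = f y - h a * (l * ev l y) by ring.
  by rewrite opprB -[f y]opprK -e -[l * ev l y]opprK -ev_ode; ring.
have ha := HK h s ch s0 h1 o hz.
have hb x : a <= x <= 1 -> `|h x| <= (1 + K) * s.
  move=> xx; rewrite -(subrK (h a * ev l x) (h x)) (le_trans (ler_normD _ _))//.
  rewrite mulrDl mul1r lerD ?hz// normrM (le_trans _ ha)// ler_piMr//.
  by apply: ev_le1; [exact: ltW|case/andP: xx].
have := ip_le_bound ch ch _ hb hb; rewrite ger0_norm ?ip_ge0//.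
have -> : L * ((1 + K) * s * ((1 + K) * s)) = L * (1 + K) ^+ 2 / l * ip g g.
  have -> : (1 + K) * s * ((1 + K) * s) = (1 + K) ^+ 2 * s ^+ 2 by ring.
  by rewrite s2; field; rewrite gt_eqF.
by apply; rewrite mulr_ge0// addr_ge0.
Qed.

End InversePair.

(** * Spectral gap and expansion of polynomials *)

Section SpectralGap.
Context {R : realType}.
Variable a : R.
Hypothesis a1 : a < 1.
Notation L := (1 - a).
Notation ip := (ip a 1).

Lemma inverse_pair_orth f h (l : R) : 0 < l -> E (l * L) = 0 ->
  inverse_pair a f h -> ip f (ev a l) = l * ip h (ev a l).
Proof.
move=> l0 e P; have := inverse_pair_sym a1 P (inverse_pair_ev e) => ->.
by rewrite ipZr ?ev_L2//; exact: inverse_pair_L2r P.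
Qed.

(** Let n_k = <r_k, r_k>. By symmetry and Cauchy-Schwarz n_(k+1)^2 is at most
    n_k n_(k+2), so that the ratios n_(k+1) / n_k increase to some s. If the
    conclusion failed, l = s^(-1/2) would be less than M. Apply the resolvent
    estimate at l to r_k + l r_(k+1) and its inverse r_(k+1) + l r_(k+2): the
    right-hand side is C |r_k - l^2 r_(k+2)|^2, which divided by n_k tends to
    C (1 - 2 l^2 s + l^4 s^2) = 0, whereas the left-hand side is at least
    n_(k+1), and n_(k+1) / n_k tends to s > 0. *)
Lemma spectral_gap (r : nat -> R -> R) (M : R) : 0 < M ->
  (forall k, inverse_pair a (r k) (r k.+1)) ->
  (forall l, 0 < l < M -> E (l * L) = 0 -> ip (r 0%N) (ev a l) = 0) ->
  ip (r 1%N) (r 1%N) <= M ^- 2 * ip (r 0%N) (r 0%N).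
Proof.
move=> M0 P O0.
have O k l : 0 < l < M -> E (l * L) = 0 -> ip (r k) (ev a l) = 0.
  move=> lM e; elim: k => [|k ih]; first exact: O0.
  have /andP[l0 _] := lM.
  have := inverse_pair_orth l0 e (P k); rewrite ih => /esym/eqP.
  by rewrite mulf_eq0 gt_eqF//= => /eqP.
pose n k := ip (r k) (r k).
have rL k : r k \in L2 a 1 by exact: inverse_pair_L2l (P k).
have shift k : ip (r k) (r k.+2) = n k.+1 by exact: inverse_pair_sym (P k) (P k.+1).
have logc k : n k.+1 ^+ 2 <= n k * n k.+2 by rewrite -shift; exact: ip_CS.
rewrite leNgt; apply/negP; rewrite -/(n 0%N) -/(n 1%N) => n01.
have n_ge0 k : 0 <= n k by exact: ip_ge0.
have bnd k : n k.+1 <= 16 * L ^+ 2 * n k by exact: inverse_pair_bound (P k).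
have n1 : 0 < n 1%N.
  by apply: le_lt_trans n01; rewrite mulr_ge0// invr_ge0 exprn_ge0// ltW.
have n0 : 0 < n 0%N.
  rewrite lt_neqAle n_ge0 andbT eq_sym; apply/eqP => z.
  by have := bnd 0%N; rewrite z mulr0 leNgt n1.
have n_gt0 k : 0 < n k /\ 0 < n k.+1.
  elim: k => [//|k [h1 h2]]; split => //.
  rewrite lt_neqAle n_ge0 andbT eq_sym; apply/eqP => z.
  by have := logc k; rewrite z mulr0 leNgt exprn_gt0.
have np k : 0 < n k by have [] := n_gt0 k.
pose rho k := n k.+1 / n k.
have rho_nd : nondecreasing_seq rho.
  apply/nondecreasing_seqP => k; rewrite /rho ler_pdivrMr// mulrAC ler_pdivlMr//.
  by rewrite -expr2 mulrC.
have rho_b k : rho k <= 16 * L ^+ 2 by rewrite /rho ler_pdivrMr.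
have cr : rho @ \oo --> limn rho.
  apply: nondecreasing_is_cvgn => //; exists (16 * L ^+ 2) => _ [k _ <-].
  exact: rho_b.
set s := limn rho in cr.
have s_ge : rho 0%N <= s by apply: nondecreasing_cvgn_le => //; apply/cvg_ex; exists s.
have r0 : M ^- 2 < rho 0%N by rewrite /rho ltr_pdivlMr.
have s0 : 0 < s by rewrite (lt_le_trans _ s_ge)// (lt_trans _ r0)// invr_gt0 exprn_gt0.
pose l : R := (Num.sqrt s)^-1.
have l0 : 0 < l by rewrite invr_gt0 sqrtr_gt0.
have l2 : l ^+ 2 * s = 1.
  by rewrite /l exprVn sqr_sqrtr ?mulVf ?gt_eqF// ltW.
have lM : l < M.
  rewrite -(@ltr_pXn2r _ 2) ?nnegrE ?ltW//.
  have Ms : M ^- 2 < s by exact: lt_le_trans s_ge.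
  have : l ^+ 2 * M ^- 2 < l ^+ 2 * s by rewrite ltr_pM2l ?exprn_gt0.
  by rewrite l2 ltr_pdivrMr ?exprn_gt0// mul1r.
have [C C0 HC] := resolvent_estimate a1 l0.
have key k : rho k <= C * (1 - 2 * l ^+ 2 * rho k + l ^+ 2 * l ^+ 2 * (rho k * rho k.+1)).
  have Pq := inverse_pair_lin l (P k) (P k.+1).
  have := HC _ _ Pq.
  set q1 := (fun x => r k.+1 x + l * r k.+2 x).
  have o : E (l * L) = 0 -> ip q1 (ev a l) = 0.
    move=> e; have lM' : 0 < l < M by rewrite l0.
    by rewrite /q1 ipDl ?L2Z ?ev_L2// ipZl ?ev_L2// !O// mulr0 addr0.
  move=> /(_ o).
  have -> : ip (fun x => r k x + l * r k.+1 x - l * q1 x)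
     (fun x => r k x + l * r k.+1 x - l * q1 x) =
     n k - 2 * l ^+ 2 * n k.+1 + l ^+ 2 * l ^+ 2 * n k.+2.
    rewrite (_ : (fun x => _) = (fun x => r k x - l ^+ 2 * r k.+2 x)); last first.
      by apply/funext => x; rewrite /q1; ring.
    rewrite ip_sqrB ?L2Z// ipZr// ipZl ?L2Z// ipZr// shift.
    by rewrite -/(n k) -/(n k.+2); ring.
  have h1 : n k.+1 <= ip q1 q1.
    rewrite /q1 ip_sqrD ?L2Z// ipZr// -addrA lerDl addr_ge0 ?ip_ge0//.
    have p0 := inverse_pair_ge0 a1 (P k.+1).
    by rewrite mulr_ge0// mulr_ge0// ltW.
  move=> /(le_trans h1) h2; rewrite -(ler_pM2r (np k)).
  have -> : rho k * n k = n k.+1 by rewrite divfK ?gt_eqF.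
  apply: (le_trans h2); rewrite -[leRHS]mulrA; apply: ler_wpM2l => //.
  rewrite le_eqVlt; apply/orP; left; apply/eqP; rewrite /rho.
  by field; rewrite !gt_eqF.
have : s <= C * (1 - 2 * l ^+ 2 * s + l ^+ 2 * l ^+ 2 * (s * s)).
  have crS : (fun k => rho k.+1) @ \oo --> s by rewrite cvg_shiftS.
  have e1 : (fun k => 2 * l ^+ 2 * rho k) @ \oo --> 2 * l ^+ 2 * s by exact: cvgMr.
  have e2 : (fun k => 1 - 2 * l ^+ 2 * rho k) @ \oo --> 1 - 2 * l ^+ 2 * s.
    by apply: cvgB => //; exact: cvg_cst.
  have e3 : (fun k => l ^+ 2 * l ^+ 2 * (rho k * rho k.+1)) @ \oo
      --> l ^+ 2 * l ^+ 2 * (s * s) by apply: cvgMr; exact: cvgM.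
  have e4 : (fun k => C * (1 - 2 * l ^+ 2 * rho k + l ^+ 2 * l ^+ 2 * (rho k * rho k.+1)))
      @ \oo --> C * (1 - 2 * l ^+ 2 * s + l ^+ 2 * l ^+ 2 * (s * s)).
    by apply: cvgMr; exact: cvgD e2 e3.
  by apply: (ler_cvg_to cr e4); exact: nearW.
rewrite -mulrA l2 mulrACA !l2 mul1r.
have -> : 1 - 2 * 1 + 1 = 0 :> R by ring.
by rewrite mulr0 leNgt s0.
Qed.

Lemma poly_antideriv (p : {poly R}) : exists P : {poly R}, P^`() = p.
Proof.
exists (\poly_(i < (size p).+1) (p`_i.-1 / i%:R)).
apply/polyP => i; rewrite coef_deriv coef_poly ltnS.
have [ip|ip] := ltnP i (size p).
  by rewrite -[LHS]mulr_natr divfK// pnatr_eq0.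
by rewrite mul0rn nth_default.
Qed.

Lemma inverse_pair_poly (p q : {poly R}) : q.[1] = 0 ->
  (('X - a%:P) * q^`())^`() = - p -> inverse_pair a (horner p) (horner q).
Proof.
move=> q1 e; split => //.
  exact: has_deriv_continuous (has_deriv_horner p).
exists (horner q^`()), (horner q^`()^`()); split; try exact: has_deriv_horner.
move=> x; have := congr1 (fun s => s.[x]) e.
rewrite derivM !hornerE derivXsubC !hornerE => <-.
by rewrite addrC.
Qed.

(** Two antiderivatives: the first one is normalised to vanish at a, so that
    it can be divided by x - a before the second one is taken. Polynomials are
    therefore stable under (- A)^-1, and the iterates of the inverse need no
    further construction. *)
Lemma poly_inverse (p : {poly R}) : exists q : {poly R},
  inverse_pair a (horner p) (horner q).
Proof.
have [P eP] := poly_antideriv (- p).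
have : root (P - P.[a]%:P) a by rewrite /root !hornerE subrr.
move=> /factor_theorem[D eD]; have [H eH] := poly_antideriv D.
exists (H - H.[1]%:P); apply: inverse_pair_poly.
  by rewrite !hornerE subrr.
by rewrite derivB derivC subr0 eH mulrC -eD derivB derivC subr0.
Qed.

Lemma inverse_pairZ f h (c : R) : inverse_pair a f h ->
  inverse_pair a (fun x => c * f x) (fun x => c * h x).
Proof.
move=> P; have P0 : inverse_pair a (fun=> 0) (fun=> 0).
  split => //; first by move=> x; exact: cvg_cst.
  exists (fun=> 0), (fun=> 0); split; try exact: has_deriv_cst.
  by move=> x; rewrite mulr0 addr0 oppr0.
by have := inverse_pair_lin c P0 P; congr inverse_pair; apply/funext => x; rewrite add0r.
Qed.

Section Expansion.
Variable lam : nat -> R.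
Hypothesis lam_gt0 : forall n, 0 < lam n.
Hypothesis lam_incr : forall m n, (m < n)%N -> lam m < lam n.
Hypothesis lam_zero : forall n, E (lam n * L) = 0.
Hypothesis lam_all : forall l : R, 0 < l -> E (l * L) = 0 -> exists n, l = lam n.

Notation w n := (ev a (lam n)).
Definition fcoef (v : R -> R) (n : nat) := ip v (w n) / ip (w n) (w n).
Definition psum (v : R -> R) (N : nat) (x : R) := \sum_(n < N) fcoef v n * w n x.

Lemma lam_inj m n : lam m = lam n -> m = n.
Proof.
move=> e; case: (ltngtP m n) => // /lam_incr; rewrite e ltxx//.
Qed.

Lemma w_gt0 n : 0 < ip (w n) (w n).
Proof. by apply: ip_ev_gt0. Qed.

Lemma w_orth m n : m != n -> ip (w m) (w n) = 0.
Proof.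
move=> mn; apply: ip_ev_orth => //; apply: contra mn => /eqP/lam_inj ->//.
Qed.

Lemma w_L2 n : w n \in L2 a 1. Proof. exact: ev_L2. Qed.

Lemma cw_L2 c n : (fun x => c * w n x) \in L2 a 1. Proof. by rewrite L2Z// w_L2. Qed.

Lemma ip_lincomb_w (c : nat -> R) N m :
  ip (fun x => \sum_(n < N) c n * w n x) (w m) = (if (m < N)%N then c m * ip (w m) (w m) else 0).
Proof.
rewrite ip_suml ?w_L2//; last by move=> i _; exact: cw_L2.
under eq_bigr do rewrite ipZl ?w_L2//.
case: ltnP => mN.
  rewrite (bigD1 (Ordinal mN))//= big1 ?addr0// => i im.
  by rewrite w_orth ?mulr0//; apply: contra im => /eqP e; apply/eqP/val_inj.
rewrite big1// => i _; rewrite w_orth ?mulr0//.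
by rewrite neq_ltn (leq_trans (ltn_ord i) mN).
Qed.

Lemma psum_L2 v N : psum v N \in L2 a 1.
Proof. by apply: L2_sum => i _; exact: cw_L2. Qed.

Lemma ip_psum_w v N m : (m < N)%N -> ip (psum v N) (w m) = ip v (w m).
Proof. by move=> mN; rewrite ip_lincomb_w mN divfK// gt_eqF// w_gt0. Qed.

(** Removing from the iterated inverses of p their components along the first
    N eigenfunctions leaves a sequence of iterated inverses orthogonal to
    every eigenfunction with eigenvalue below lam N; the spectral gap then
    applies with M = lam N. *)
Lemma poly_approx (p q : {poly R}) : inverse_pair a (horner p) (horner q) ->
  forall N, ip (fun x => q.[x] - psum (horner q) N x) (fun x => q.[x] - psum (horner q) N x)
    <= lam N ^- 2 * ip (horner p) (horner p).
Proof.
move=> P N.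
have [G HG] := choice poly_inverse.
pose g k := iter k G q.
pose F k := if k is k'.+1 then g k' else p.
have PF k : inverse_pair a (horner (F k)) (horner (F k.+1)).
  by case: k => [|k] //=; exact: HG.
pose c n := fcoef (horner p) n.
(* The inverse divides the component along the n-th eigenfunction by lam n. *)
pose r k x := (F k).[x] + \sum_(n < N) (- c n) * ((lam n ^- k) * w n x).
have Pr k : inverse_pair a (r k) (r k.+1).
  apply: inverse_pair_sum => // n.
  have := inverse_pairZ (lam n ^- k.+1) (inverse_pair_ev (lam_zero n)).
  congr inverse_pair; apply/funext => x; rewrite mulrA; congr (_ * _).
  by rewrite exprS invfM mulrC mulrA mulfV ?mul1r// gt_eqF.
have pL : horner p \in L2 a 1 by exact: inverse_pair_L2l P.
have qL : horner q \in L2 a 1 by exact: inverse_pair_L2r P.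
have r0E : r 0%N = (fun x => p.[x] - psum (horner p) N x).
  apply/funext => x; rewrite /r /psum -sumrN; congr (_ + _); apply: eq_bigr => n _.
  by rewrite expr0 invr1 mul1r mulNr.
have r1E : r 1%N = (fun x => q.[x] - psum (horner q) N x).
  apply/funext => x; rewrite /r /psum -sumrN; congr (_ + _); apply: eq_bigr => n _.
  rewrite expr1 mulNr mulrA; congr (- (_ * _)).
  rewrite /c /fcoef (inverse_pair_orth (lam_gt0 n) (lam_zero n) P).
  by field; rewrite !gt_eqF// w_gt0.
have := @spectral_gap r (lam N) (lam_gt0 N) Pr.
rewrite r1E r0E => /(_ _) H; apply: le_trans (H _) _.
  move=> l /andP[l0 lN] e; have [m lm] := lam_all l0 e.
  have mN : (m < N)%N.
    rewrite ltnNge; apply/negP; rewrite leq_eqVlt => /predU1P[Nm|/lam_incr].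
      by move: lN; rewrite lm Nm ltxx.
    by rewrite -lm => /lt_trans/(_ lN); rewrite ltxx.
  by rewrite lm ipBl ?psum_L2 ?w_L2// ip_psum_w// subrr.
apply: ler_wpM2l; first by rewrite invr_ge0 exprn_ge0// ltW.
rewrite ip_sqrB ?psum_L2//.
have -> : ip (horner p) (psum (horner p) N) = ip (psum (horner p) N) (psum (horner p) N).
  rewrite /psum ip_sumr//; last by move=> i _; exact: cw_L2.
  rewrite [RHS]ip_sumr ?psum_L2//; last by move=> i _; exact: cw_L2.
  apply: eq_bigr => i _; rewrite !ipZr ?w_L2 ?psum_L2//.
  by rewrite (@ip_psum_w _ N i).
have := ip_ge0 a 1 (psum (horner p) N); lra.
Qed.

End Expansion.
End SpectralGap.

(** * Polynomials approximating a step function *)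

Section StepPolynomials.
Context {R : realType}.
Implicit Types (x y c : R).

Lemma Bernoulli_le x n : 0 <= x <= 1 -> 1 - n%:R * x <= (1 - x) ^+ n.
Proof.
move=> /andP[x0 x1]; elim: n => [|n ih]; first by rewrite mul0r subr0 expr0.
rewrite exprS; apply: le_trans (_ : (1 - x) * (1 - n%:R * x) <= _).
  rewrite -natr1; have : 0 <= n%:R * (x * x) by rewrite !mulr_ge0.
  by lra.
by apply: ler_wpM2l => //; rewrite subr_ge0.
Qed.

Lemma Bernoulli_ge x n : 0 <= x <= 1 -> (1 - x) ^+ n * (1 + n%:R * x) <= 1.
Proof.
move=> /andP[x0 x1]; elim: n => [|n ih]; first by rewrite mul0r addr0 expr0 mulr1.
apply: le_trans ih; rewrite exprSr -mulrA.
apply: ler_wpM2l; first by rewrite exprn_ge0// subr_ge0.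
rewrite -natr1; have : 0 <= n%:R * (x * x) by rewrite !mulr_ge0.
have : 0 <= x * x by rewrite mulr_ge0.
by lra.
Qed.

(** With y = (1 + x - c) / 2, the number 2^m y^m tends to 0 for x < c and to
    infinity for x > c; by Bernoulli's inequalities (1 - y^m)^(2^m) then tends
    to 1 or to 0. *)
Definition step_poly c m : {poly R} :=
  (1 - (2^-1 *: ('X - c%:P) + (2^-1)%:P) ^+ m) ^+ (2 ^ m)%N.

Lemma step_polyE c m x :
  (step_poly c m).[x] = (1 - ((1 + x - c) / 2) ^+ m) ^+ (2 ^ m)%N.
Proof.
rewrite /step_poly !hornerE.
by have -> : 2^-1 * (x - c) + 2^-1 = (1 + x - c) / 2 :> R by field.
Qed.

Lemma step_poly_itv c m x : 0 <= (1 + x - c) / 2 <= 1 ->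
  0 <= (step_poly c m).[x] <= 1.
Proof.
move=> /andP[y0 y1]; rewrite step_polyE.
have h : 0 <= ((1 + x - c) / 2) ^+ m <= 1 by rewrite exprn_ge0//= exprn_ile1.
by rewrite exprn_ge0 ?exprn_ile1; lra.
Qed.

Lemma step_poly_arg (a c x : R) : 0 < a -> a < c -> c < 1 -> a < x -> x <= 1 ->
  0 <= (1 + x - c) / 2 <= 1.
Proof. by move=> *; lra. Qed.

Lemma step_poly_cvg1 c x : 0 <= (1 + x - c) / 2 <= 1 -> x < c ->
  (fun m => (step_poly c m).[x]) @ \oo --> (1 : R).
Proof.
set y := (1 + x - c) / 2 => /andP[y0 y1] xc.
apply: (@squeeze_cvgr _ _ _ _ (fun m => 1 - (2 * y) ^+ m) (fun=> 1)).
- apply: nearW => m; have [|_ ->] := andP (@step_poly_itv c m x _); first exact/andP.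
  rewrite andbT step_polyE -/y [(2 * y) ^+ m]exprMn -natrX; apply: Bernoulli_le.
  by rewrite exprn_ge0//= exprn_ile1.
- rewrite -[X in _ --> X]subr0; apply: cvgB; first exact: cvg_cst.
  have y20 : 0 <= 2 * y by rewrite mulr_ge0.
  have h : `|2 * y| < 1.
    rewrite (ger0_norm y20).
    have -> : 2 * y = 1 + x - c by rewrite /y; field.
    lra.
  exact: (cvg_expr h).
- exact: cvg_cst.
Qed.

Lemma step_poly_cvg0 c x : 0 <= (1 + x - c) / 2 <= 1 -> c < x ->
  (fun m => (step_poly c m).[x]) @ \oo --> (0 : R).
Proof.
set y := (1 + x - c) / 2 => /andP[y0 y1] xc.
have y2 : 1 < 2 * y.
  have -> : 2 * y = 1 + x - c by rewrite /y; field.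
  lra.
have yp : 0 < 2 * y by lra.
apply: (@squeeze_cvgr _ _ _ _ (fun=> 0) (fun m => ((2 * y)^-1) ^+ m)).
- apply: nearW => m; have [|-> _] := andP (@step_poly_itv c m x _); first exact/andP.
  rewrite /= exprVn -[leRHS]mul1r ler_pdivlMr ?exprn_gt0//.
  have hy : 0 <= y ^+ m <= 1 by rewrite exprn_ge0//= exprn_ile1.
  have := Bernoulli_ge (2 ^ m)%N hy; rewrite step_polyE -/y [(2 * y) ^+ m]exprMn -natrX.
  apply: le_trans; apply: ler_wpM2l.
    by rewrite exprn_ge0; lra.
  by rewrite lerDr.
- exact: cvg_cst.
- have h : `|(2 * y)^-1| < 1 by rewrite ger0_norm ?invr_ge0 ?(ltW yp)// invf_lt1.
  exact: (cvg_expr h).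
Qed.

End StepPolynomials.

(** * Completeness of the eigenfunctions *)

Section Completeness.
Context {R : realType}.
Variable a : R.
Hypothesis a1 : a < 1.
Hypothesis a0 : 0 < a.
Notation L := (1 - a).
Notation ip := (ip a 1).
Notation leb := (@lebesgue_measure R).

(** Lebesgue's differentiation theorem: v is almost everywhere the derivative
    of its primitive, which is 0. *)
Lemma ae_eq0_of_primitive (v : R -> R) : Itg a 1 v ->
  (forall c, a < c < 1 -> \int[leb]_(x in `]a, c[) v x = 0) ->
  {ae leb, forall x, a < x < 1 -> v x = 0}.
Proof.
move=> vi v0.
pose f := v \_ `]a, 1[.
have fi y : leb.-integrable `]-oo, y] (EFin \o f).
  apply: (@integrableS _ _ _ _ setT) => //.
  rewrite /f -restrict_EFin; apply/integrable_restrict => //=.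
  by rewrite setTI.
have lf : locally_integrable [set: R] f by exact: integrable_locally.
have := FTC1Ny fi lf.
set F := (fun x => _).
have F0 x : a < x < 1 -> F x = 0.
  move=> /andP[ax x1]; rewrite /F /f.
  rewrite Rintegral_mkcond -patch_setI -Rintegral_mkcond.
  have -> : `]-oo, x] `&` `]a, 1[ = `]a, x]%classic.
    apply/seteqP; split => y /=; rewrite !in_itv/=.
      by move=> [-> /andP[->]].
    by move=> /andP[-> yx]; split => //; rewrite (le_lt_trans yx x1).
  have s : `]a, x[ `<=` `]a, 1[ by apply: subset_itvl; rewrite bnd_simp ltW.
  rewrite -Rintegral_itv_bndo_bndc; last exact: integrableS vi.
  by apply: v0; rewrite ax.
apply: filterS; first exact: (ae_filter_ringOfSetsType leb).
move=> x [dF F'] /[dup] ax /andP[ax1 ax2].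
have -> : v x = f x by rewrite /f patchE mem_set//= in_itv/= ax1.
rewrite -F'; rewrite derive1E -(@derive_cst _ _ _ (0:R) x 1).
apply: near_eq_derive.
have : x \in `]a, 1[ by rewrite in_itv/= ax1.
move=> /near_in_itvoo; apply: filterS => y.
by rewrite in_itv/= => /F0 ->.
Qed.

Section Expansion.
Variable lam : nat -> R.
Hypothesis lam_gt0 : forall n, 0 < lam n.
Hypothesis lam_incr : forall m n, (m < n)%N -> lam m < lam n.
Hypothesis lam_zero : forall n, E (lam n * L) = 0.
Hypothesis lam_all : forall l : R, 0 < l -> E (l * L) = 0 -> exists n, l = lam n.
Notation w n := (ev a (lam n)).
Notation psum := (psum a lam).
Notation fcoef := (fcoef a lam).

Lemma ip_psum v N : v \in L2 a 1 -> ip (psum v N) v = ip (psum v N) (psum v N).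
Proof.
move=> vL; transitivity (\sum_(i < N) fcoef v i * ip v (w i)).
  rewrite ipC ip_sumr//; last by move=> i _; exact: cw_L2.
  by apply: eq_bigr => i _; rewrite ipZr ?w_L2.
rewrite {2}/psum ip_sumr ?psum_L2//; last by move=> i _; exact: cw_L2.
apply: eq_bigr => i _; rewrite ipZr ?w_L2 ?psum_L2//.
by rewrite (@ip_psum_w _ _ a1 _ lam_gt0 lam_incr lam_zero _ N i).
Qed.

Lemma Bessel_inequality v N : v \in L2 a 1 ->
  \sum_(n < N) ip v (w n) ^+ 2 / ip (w n) (w n) <= ip v v.
Proof.
move=> vL; have -> : \sum_(n < N) ip v (w n) ^+ 2 / ip (w n) (w n) = ip (psum v N) v.
  rewrite {1}/psum ip_suml//; last by move=> i _; exact: cw_L2.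
  apply: eq_bigr => i _; rewrite ipZl ?w_L2// /fcoef (ipC _ _ (w i) v).
  by rewrite expr2 mulrAC.
have := ip_ge0 a 1 (fun x => v x - psum v N x).
by rewrite ip_sqrB ?psum_L2// (ipC _ _ v) -ip_psum//; lra.
Qed.

(** Bessel's inequality for the constant 1, whose n-th term is exactly
    1 / lam n. This provides both the growth of the eigenvalues and a summable
    majorant, without any asymptotics of the zeros of J_0. *)
Lemma sum_lam N : \sum_(n < N) (lam n)^-1 <= L.
Proof.
have c1 : (fun=> 1 : R) \in L2 a 1 by apply: continuous_L2 => x; exact: cvg_cst.
have := Bessel_inequality N c1.
have -> : ip (fun=> 1) (fun=> 1) = L.
  rewrite /ip; under eq_Rintegral do rewrite mulr1.
  by rewrite Rintegral_oo_cst ?ltW// mulr1.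
apply: le_trans; rewrite le_eqVlt; apply/orP; left; apply/eqP.
apply: eq_bigr => n _; have l0 := lam_gt0 n.
have L0 : 0 < L by rewrite subr_gt0.
have lL : 0 <= lam n * L by rewrite mulr_ge0 ?ltW.
rewrite ip_1_ev ?gt_eqF// ip_ev ?gt_eqF// /Psi lam_zero.
have e1 := E_zero_E1_neq0 lL (lam_zero n).
by field; rewrite e1 !gt_eqF.
Qed.

(** The eigenvalues increase, so that (N + 1) / lam N is at most the sum of the
    first N + 1 reciprocals. *)
Lemma lam_ge N : N.+1%:R / L <= lam N.
Proof.
have L0 : 0 < L by rewrite subr_gt0.
suff : N.+1%:R / lam N <= L by rewrite !ler_pdivrMr// mulrC.
apply: le_trans (sum_lam N.+1).
have -> : N.+1%:R / lam N = \sum_(i < N.+1) (lam N)^-1.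
  by rewrite sumr_const card_ord -[RHS]mulr_natl.
apply: ler_sum => i _.
rewrite lef_pV2 ?posrE//; have := ltn_ord i; rewrite ltnS leq_eqVlt.
by move=> /predU1P[->//|/lam_incr/ltW].
Qed.

Lemma lamV_cvg0 : (fun n => (lam n)^-1) @ \oo --> (0 : R).
Proof.
have L0 : 0 < L by rewrite subr_gt0.
apply: (@squeeze_cvgr _ _ _ _ (fun=> 0) (fun n => L * n.+1%:R^-1)).
- apply: nearW => n; rewrite invr_ge0 ltW//=.
  by rewrite -invf_div lef_pV2 ?posrE ?divr_gt0// lam_ge.
- exact: cvg_cst.
- rewrite -[X in _ --> X](mulr0 L); apply: cvgMr; exact: cvg_harmonic.
Qed.

(** A polynomial that vanishes at 1 is the inverse of a polynomial, hence the
    limit in L^2(a,1) of its eigenfunction sums. *)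
Lemma orth_poly v (q : {poly R}) : v \in L2 a 1 -> (forall n, ip v (w n) = 0) ->
  q.[1] = 0 -> ip v (horner q) = 0.
Proof.
move=> vL o q1.
pose p := - (('X - a%:P) * q^`())^`().
have P : inverse_pair a (horner p) (horner q).
  by apply: inverse_pair_poly => //; rewrite opprK.
have pL : horner p \in L2 a 1 by exact: inverse_pair_L2l P.
have qL : horner q \in L2 a 1 by exact: inverse_pair_L2r P.
have B N : `|ip v (horner q)| <= N2 a 1 v * N2 a 1 (horner p) * (lam N)^-1.
  have -> : ip v (horner q) = ip v (fun x => q.[x] - psum (horner q) N x).
    rewrite ipBr ?psum_L2// {1}/psum ip_sumr//; last by move=> i _; exact: cw_L2.
    rewrite big1 ?subr0// => i _.
    by rewrite ipZr ?w_L2// o mulr0.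
  rewrite (le_trans (ip_le_N2 vL _)) ?L2B ?psum_L2// -mulrA.
  apply: ler_wpM2l; first exact: N2_ge0.
  rewrite -(@ler_pXn2r _ 2) ?nnegrE ?mulr_ge0 ?N2_ge0 ?invr_ge0 ?(ltW (lam_gt0 _))//.
  rewrite exprMn !N2_sqr exprVn [leRHS]mulrC.
  exact: (poly_approx a1 lam_gt0 lam_incr lam_zero lam_all P).
apply/eqP; rewrite -normr_le0.
have C : (fun N => N2 a 1 v * N2 a 1 (horner p) * (lam N)^-1) @ \oo --> (0 : R).
  rewrite -[X in _ --> X](mulr0 (N2 a 1 v * N2 a 1 (horner p))).
  by apply: cvgMr; exact: lamV_cvg0.
have D : (fun _ : nat => `|ip v (horner q)|) @ \oo --> `|ip v (horner q)|.
  exact: cvg_cst.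
by apply: (ler_cvg_to D C); exact: nearW.
Qed.

Lemma L2_itg1 (v : R -> R) : v \in L2 a 1 -> Itg a 1 v.
Proof.
move=> vL; have c1 : (fun=> 1 : R) \in L2 a 1 by apply: continuous_L2 => x; exact: cvg_cst.
have := L2_itg vL c1; rewrite (_ : (fun x => v x * 1) = v)//.
by apply/funext => x; rewrite mulr1.
Qed.

(** The step polynomials, shifted to vanish at 1, are orthogonal to v, and the
    shifts tend to 0. By dominated convergence the integral of v over ]a,c[ is
    0 for every c. *)
Theorem completeness v : v \in L2 a 1 -> (forall n, ip v (w n) = 0) -> ip v v = 0.
Proof.
move=> vL o; have vi := L2_itg1 vL; have mv := L2_measurable vL.
have H (c : R) : a < c < 1 -> \int[leb]_(x in `]a, c[) v x = 0.
  move=> /andP[ac c1].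
  have yb (x : R) : a < x < 1 -> 0 <= (1 + x - c) / 2 <= 1.
    by move=> /andP[ax x1]; exact: step_poly_arg a0 ac c1 ax (ltW x1).
  have ms m : measurable_fun [set: R] (horner (step_poly c m)).
    by apply: continuous_measurable_fun; exact: has_deriv_continuous (has_deriv_horner _).
  pose g x := v x * \1_(`]-oo, c[ : set R) x.
  have gE x : g x = (v \_ `]-oo, c[) x.
    rewrite /g patchE indicE; case: (x \in _) => /=; first by rewrite mulr1.
    by rewrite mulr0.
  have mg : measurable_fun setT g.
    by apply: measurable_funM => //; exact: measurable_indic.
  have DC := @dominated_convergence _ (measurableTypeR R) R leb `]a, 1[ (measurable_itv _)
    (fun m x => (v x * (step_poly c m).[x])%:E) (EFin \o g) (fun x => `|v x|%:E).
  have [||||| gi _ H1] := DC.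
  - move=> m; apply: measurable_funTS; apply/measurable_EFinP.
    apply: measurable_funM => //; exact: ms m.
  - by apply: measurable_funTS; apply/measurable_EFinP.
  - have aec : {ae leb, forall x, x != c}.
      exists [set c]; split => //; first exact: lebesgue_measure_set1.
      by move=> x /= /negP; rewrite negbK => /eqP.
    apply: filterS aec; first exact: (ae_filter_ringOfSetsType leb).
    move=> x /= xc; rewrite in_itv/= => xa; apply: cvg_EFin; first exact: nearW.
    rewrite /g /comp /=; apply: cvgMr; rewrite indicE.
    have := xc; rewrite neq_lt => /orP[xlt|xgt].
      by rewrite mem_set/= ?in_itv//=; apply: step_poly_cvg1 => //; exact: yb.
    rewrite memNset/= ?in_itv/= ?ltNge ?(ltW xgt)//.
    by apply: step_poly_cvg0 => //; exact: yb.
  - by have := integrable_abse vi.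
  - apply: aeW => x m; rewrite /= in_itv/= => /yb/(@step_poly_itv _ c m)/andP[s0 s1].
    by rewrite lee_fin normrM ler_piMr// ger0_norm.
  have e : (\int[leb]_(x in `]a, 1%R[) (EFin \o g) x = (\int[leb]_(x in `]a, 1%R[) g x)%R%:E)%E.
    by rewrite /Rintegral fineK//; exact: integrable_fin_num.
  rewrite e in H1; move/fine_cvgP : H1 => [_ H1].
  have ec : \int[leb]_(x in `]a, c[) v x = \int[leb]_(x in `]a, 1[) g x.
    under [RHS]eq_Rintegral do rewrite gE.
    rewrite -Rintegral_mkcondr; congr Rintegral.
    apply/seteqP; split => x /=; rewrite !in_itv/=.
      by move=> /andP[-> xc]; split => //; rewrite (lt_trans xc).
    by move=> [/andP[-> _] ->].
  rewrite ec; apply: (cvg_unique _ H1) => //.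
  pose q m : {poly R} := step_poly c m - ((step_poly c m).[1])%:P.
  have qE m x : (q m).[x] = (step_poly c m).[x] - (step_poly c m).[1].
    by rewrite /q !hornerE.
  have vq m : ip v (horner (q m)) = 0.
    by apply: orth_poly => //; rewrite qE subrr.
  have sL m : horner (step_poly c m) \in L2 a 1.
    by apply: continuous_L2; exact: has_deriv_continuous (has_deriv_horner _).
  have kL (k : R) : (fun=> k) \in L2 a 1 by apply: continuous_L2 => x; exact: cvg_cst.
  have es m : \int[leb]_(x in `]a, 1[) (v x * (step_poly c m).[x])
      = (step_poly c m).[1] * \int[leb]_(x in `]a, 1[) v x.
    have := vq m; rewrite (_ : horner (q m) = (fun x => (step_poly c m).[x] - (step_poly c m).[1])).
      rewrite ipBr// => /eqP; rewrite subr_eq0 => /eqP; rewrite /ip => ->.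
      by rewrite -RintegralZl//; apply: eq_Rintegral => x _; rewrite mulrC.
    by apply/funext => x; rewrite qE.
  have s10 : (fun m => (step_poly c m).[1]) @ \oo --> (0 : R).
    by apply: step_poly_cvg0 => //; exact: step_poly_arg a0 ac c1 a1 (lexx 1).
  have K : (fun m => (step_poly c m).[1] * \int[leb]_(x in `]a, 1[) v x) @ \oo --> (0 : R).
    rewrite -[X in _ --> X](mul0r (\int[leb]_(x in `]a, 1[) v x)); exact: cvgMl.
  rewrite (_ : (fun m => _ * _) =
      fine \o (fun m => \int[leb]_(x in `]a, 1%R[) (v x * (step_poly c m).[x])%:E)%E) in K.
    exact: K.
  by apply/funext => m; rewrite -es.
have AE := ae_eq0_of_primitive vi H.
rewrite /ip /Rintegral (_ : integral _ _ _ = 0%E)//.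
rewrite -[RHS](@integral0 _ (measurableTypeR R) R leb `]a, 1[).
apply: ae_eq_integral => //.
  by apply: measurable_funTS; apply/measurable_EFinP; exact: measurable_funM.
apply: filterS AE; first exact: (ae_filter_ringOfSetsType leb).
by move=> x h /=; rewrite in_itv/= => /h ->; rewrite mulr0.
Qed.

End Expansion.
End Completeness.

(** * The Riesz-Fischer theorem *)

Section RieszFischer.
Context {R : realType}.
Variables a b : R.
Notation leb := (@lebesgue_measure R).
Notation ip := (ip a b).
Notation N2 := (N2 a b).
Notation L2 := (L2 a b).

Lemma L2_abs (f : R -> R) : f \in L2 -> (fun x => `|f x|) \in L2.
Proof.
move=> /L2P[mf fi]; apply/L2P; split; first exact: measurableT_comp.
by under eq_integral do rewrite real_normK ?num_real//.
Qed.

Lemma N2_abs (f : R -> R) : N2 (fun x => `|f x|) = N2 f.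
Proof.
congr Num.sqrt; apply: eq_Rintegral => x _.
by rewrite -!expr2 real_normK ?num_real.
Qed.

Lemma N2_0 : N2 (fun=> 0) = 0.
Proof. by rewrite -[N2 _]/(Num.sqrt (ip _ _)) ip0l sqrtr0. Qed.

Lemma N2_sum (d : nat -> R -> R) m n : (forall i, d i \in L2) ->
  N2 (fun x => \sum_(m <= i < n) d i x) <= \sum_(m <= i < n) N2 (d i).
Proof.
move=> dL; elim: n => [|n ih].
  rewrite big_geq// -[leRHS]N2_0 le_eqVlt; apply/orP; left; apply/eqP.
  by apply: N2_ext => x _; rewrite big_geq.
have [mn|mn] := leqP m n; last first.
  rewrite [leRHS]big_geq// -[leRHS]N2_0 le_eqVlt; apply/orP; left; apply/eqP.
  by apply: N2_ext => x _; rewrite big_geq.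
rewrite [leRHS]big_nat_recr//=; apply: le_trans (lerD ih (lexx _)).
have := N2D (@L2_sum R a b nat (index_iota m n) xpredT d (fun i _ => dL i)) (dL n).
apply: le_trans; rewrite le_eqVlt; apply/orP; left; apply/eqP.
by apply: N2_ext => x _; rewrite big_nat_recr.
Qed.

Lemma N2_ae (f g : R -> R) : f \in L2 -> g \in L2 ->
  {ae leb, forall x, a < x < b -> f x = g x} -> N2 f = N2 g.
Proof.
move=> /L2_measurable mf /L2_measurable mg fg; congr Num.sqrt; congr fine.
apply: ae_eq_integral => //.
- by apply: measurable_funTS; apply/measurable_EFinP; exact: measurable_funM.
- by apply: measurable_funTS; apply/measurable_EFinP; exact: measurable_funM.
- apply: filterS fg; first exact: (ae_filter_ringOfSetsType leb).
  by move=> x h /=; rewrite in_itv/= => /h ->.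
Qed.

(** By monotone convergence, the square of the sum of the absolute values has
    a finite integral. *)
Lemma L2_series_ae (d : nat -> R -> R) (C : R) : (forall i, d i \in L2) ->
  (forall n, \sum_(0 <= i < n) N2 (d i) <= C) ->
  {ae leb, forall x, a < x < b -> cvgn (series (fun n => d n x))}.
Proof.
move=> dL dC.
have C0 : 0 <= C by have := dC 0%N; rewrite big_geq.
pose u n x : R := \sum_(0 <= i < n) `|d i x|.
have uL n : u n \in L2 by apply: L2_sum => i _; exact: L2_abs.
have mu n := L2_measurable (uL n).
have u0 n x : 0 <= u n x by apply: sumr_ge0.
have uC n : (\int[leb]_(x in `]a, b[) (u n x ^+ 2)%:E <= (C ^+ 2)%:E)%E.
  have -> := ip_fin (uL n); rewrite lee_fin -N2_sqr.
  rewrite ler_pXn2r ?nnegrE ?N2_ge0//; apply: le_trans (dC n).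
  have := N2_sum 0 n (fun i => L2_abs (dL i)); under [leRHS]eq_bigr do rewrite N2_abs.
  exact.
have und x : nondecreasing_seq (u ^~ x).
  by apply/nondecreasing_seqP => n; rewrite /u big_nat_recr//= lerDl.
have u2nd x m n : (m <= n)%N -> ((u m x ^+ 2)%:E <= (u n x ^+ 2)%:E)%E.
  by move=> mn; rewrite lee_fin ler_pXn2r ?nnegrE//; exact: und.
have mu2 n : measurable_fun setT (fun x => (u n x ^+ 2)%:E) by exact: measurable_sqr.
pose v x := limn (fun n => (u n x ^+ 2)%:E).
have cv x : cvgn (fun n => (u n x ^+ 2)%:E).
  by apply: ereal_nondecreasing_is_cvgn => m n; exact: u2nd.
have iv : (\int[leb]_(x in `]a, b[) v x <= (C ^+ 2)%:E)%E.
  rewrite /v (@monotone_convergence _ (measurableTypeR R) R leb `]a, b[ (measurable_itv _)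
    (fun n x => (u n x ^+ 2)%:E)).
  - apply: lime_le; last exact: nearW.
    apply: ereal_nondecreasing_is_cvgn => m n mn; apply: ge0_le_integral => //.
    + by move=> x _; rewrite lee_fin sqr_ge0.
    + exact: measurable_funTS (mu2 _).
    + exact: measurable_funTS (mu2 _).
    + by move=> x _; exact: u2nd.
  - by move=> n; exact: measurable_funTS (mu2 _).
  - by move=> n x _; rewrite lee_fin sqr_ge0.
  - by move=> x _ m n; exact: u2nd.
have v0 x : (0 <= v x)%E by apply: lime_ge => //; apply: nearW => n; rewrite lee_fin sqr_ge0.
have mv : measurable_fun `]a, b[ v.
  apply: (@emeasurable_fun_cvg _ (measurableTypeR R) R _ (fun n x => (u n x ^+ 2)%:E)) => //.
    by move=> n; exact: measurable_funTS (mu2 _).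
have vi : leb.-integrable `]a, b[ v.
  apply/integrableP; split => //.
  by under eq_integral do rewrite gee0_abs//; apply: le_lt_trans iv _; rewrite ltry.
have vfin := @integrable_ae _ (measurableTypeR R) R leb _ (measurable_itv `]a, b[) _ vi.
apply: (@filterS _ _ (ae_filter_ringOfSetsType leb) _ _ _ vfin).
move=> x + axb => /(_ _)/fineK vx.
apply: normed_cvg; rewrite /=.
apply: nondecreasing_is_cvgn.
  by move=> m n mn; exact: (und x).
exists (1 + fine (v x)) => _ [n _ <-].
have : ((u n x ^+ 2)%:E <= v x)%E.
  apply: lime_ge => //; exists n => // k /= nk; exact: u2nd.
rewrite -vx ?in_itv//= lee_fin => h.
have {}h : u n x ^+ 2 <= fine (v x) by [].
suff : u n x <= 1 + fine (v x) by [].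
have h0 : 0 <= (u n x - 1) ^+ 2 by exact: sqr_ge0.
have h1 : 0 <= u n x ^+ 2 by exact: sqr_ge0.
move: h h0 h1; generalize (u n x) (fine (v x)) => y z.
rewrite sqrrB1; lra.
Qed.

(** The limit comes with a bound on every remainder: the rate is what the
    gliding hump and the extraction of a subsequence rely on. It follows from
    Fatou's lemma applied to the squares of S n - S K. *)
Lemma Riesz_Fischer (d : nat -> R -> R) (C : R) : (forall i, d i \in L2) ->
  (forall n, \sum_(0 <= i < n) N2 (d i) <= C) ->
  exists2 x, x \in L2 & forall K T, (forall n, \sum_(K <= i < n) N2 (d i) <= T) ->
    N2 (fun t => x t - \sum_(0 <= i < K) d i t) <= T.
Proof.
move=> dL dC; have AE := L2_series_ae dL dC.
pose S n t := \sum_(0 <= i < n) d i t.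
have SL n : S n \in L2 by apply: L2_sum.
have mS n := L2_measurable (SL n).
(* The upper limit is measurable, and it is the limit wherever there is one. *)
pose x t := fine (limn_esup (fun n => (S n t)%:E)).
have mx : measurable_fun setT x.
  apply: (measurableT_comp (fine_measurable measurableT)).
  by apply: measurable_fun_limn_esup => n; exact/measurable_EFinP.
have xE : {ae leb, forall t, a < t < b -> S ^~ t @ \oo --> x t}.
  apply: (@filterS _ _ (ae_filter_ringOfSetsType leb) _ _ _ AE) => t h /h ct.
  have cE : (fun n => (S n t)%:E) @ \oo --> (limn (S ^~ t))%:E by apply: cvg_EFin => //; exact: nearW.
  by rewrite /x (cvg_limn_einf_sup cE).2.
have key K T : (forall n, \sum_(K <= i < n) N2 (d i) <= T) ->
    (\int[leb]_(t in `]a, b[) ((x t - S K t) ^+ 2)%:E <= (T ^+ 2)%:E)%E.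
  move=> hT; have T0 : 0 <= T by have := hT K; rewrite big_geq.
  have mB n : measurable_fun setT (fun t => ((S n t - S K t) ^+ 2)%:E).
    by apply: measurable_sqr; exact: measurable_funB.
  rewrite (@ge0_ae_eq_integral _ (measurableTypeR R) R leb _ _
    (fun t => limn_einf (fun n => ((S n t - S K t) ^+ 2)%:E)))//.
  - apply: le_trans.
      apply: (@fatou _ (measurableTypeR R) R leb _ _ (fun n t => ((S n t - S K t) ^+ 2)%:E)) => //.
        by move=> n; exact: measurable_funTS (mB n).
      by move=> n t _; rewrite lee_fin sqr_ge0.
    rewrite limn_einf_lim; apply: (lime_le (@is_cvg_einfs _ _)); apply: nearW => n.
    apply: (@le_trans _ _ (\int[leb]_(t in `]a, b[) ((S (maxn n K) t - S K t) ^+ 2)%:E)%E).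
      by apply: ereal_inf_lbound; exists (maxn n K) => //=; exact: leq_maxl.
    have -> := ip_fin (L2B (SL (maxn n K)) (SL K)).
    rewrite lee_fin -N2_sqr ler_pXn2r ?nnegrE ?N2_ge0//; apply: le_trans (hT (maxn n K)).
    apply: le_trans (N2_sum K (maxn n K) dL); rewrite le_eqVlt; apply/orP; left; apply/eqP.
    apply: N2_ext => t _; rewrite /S (big_cat_nat (n := K)) ?leq_maxr//=.
    by rewrite [X in X - _]addrC addrK.
  - by apply: measurable_funTS; apply: measurable_sqr; exact: measurable_funB.
  - under eq_fun do rewrite /limn_einf.
    apply: measurableT_comp => //; apply: measurable_fun_limn_esup => n.
    by apply: measurableT_comp => //; exact: measurable_funTS (mB n).
  - by move=> t _; rewrite lee_fin sqr_ge0.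
  - move=> t _; rewrite limn_einf_lim; apply: (lime_ge (@is_cvg_einfs _ _)); apply: nearW => n.
    by apply: le_ereal_inf_tmp => _ [m _ <-]; rewrite lee_fin sqr_ge0.
  - apply: (@filterS _ _ (ae_filter_ringOfSetsType leb) _ _ _ xE) => t h.
    rewrite /= in_itv/= => /h ct.
    have c2 : (fun n => (S n t - S K t) ^+ 2) @ \oo --> (x t - S K t) ^+ 2.
      have c1 : (fun n => S n t - S K t) @ \oo --> x t - S K t.
        by apply: cvgB => //; exact: cvg_cst.
      rewrite expr2 (_ : (fun n => _ ^+ 2) = (fun n => (S n t - S K t) * (S n t - S K t))).
        exact: cvgM.
      by apply/funext => n; rewrite expr2.
    have c3 : (fun n => ((S n t - S K t) ^+ 2)%:E) @ \oo --> ((x t - S K t) ^+ 2)%:E.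
      by apply: cvg_EFin => //; exact: nearW.
    by rewrite (cvg_limn_einf_sup c3).1.
have xL : x \in L2.
  apply/L2P; split => //.
  have : (\int[leb]_(t in `]a, b[) ((x t - S 0%N t) ^+ 2)%:E < +oo)%E.
    by apply: le_lt_trans (key 0%N C dC) _; rewrite ltry.
  by under eq_integral do rewrite /S big_geq// subr0.
exists x => // K T hT; have T0 : 0 <= T by have := hT K; rewrite big_geq.
rewrite -(@ler_pXn2r _ 2) ?nnegrE ?N2_ge0// N2_sqr -lee_fin.
have <- := ip_fin (L2B xL (SL K)).
exact: key.
Qed.

End RieszFischer.

(** * Local boundedness of a C_0-semigroup *)

Section LocalBound.
Context {R : realType}.
Variables a b : R.
Notation leb := (@lebesgue_measure R).
Notation N2 := (N2 a b).
Notation L2 := (L2 a b).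
Variable S : R -> (R -> R) -> (R -> R).
Hypothesis C0S : C0_semigroup a b S.

(** The measure of the statement is the restriction of Lebesgue measure, while
    integrals are taken for Lebesgue measure over ]a,b[. *)
Lemma ae_leb_oo (P : R -> Prop) : {ae leb_oo a b, forall x, P x} ->
  {ae leb, forall x, a < x < b -> P x}.
Proof.
move=> [A [mA A0 PA]]; exists (A `&` `]a, b[%classic); split => //.
  exact: measurableI.
move=> x /= nP; split.
  by apply: PA => /= px; apply: nP.
by rewrite /= in_itv/=; apply: contrapT => h; apply: nP => /h.
Qed.

Lemma ae_eq_N2 (f g : R -> R) : f \in L2 -> g \in L2 ->
  f = g %[ae leb_oo a b] -> N2 (fun x => f x - g x) = 0.
Proof.
move=> fL gL fg; rewrite -(N2_0 a b); apply: N2_ae; [exact: L2B|exact: L2_0|].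
apply: (@filterS _ _ (ae_filter_ringOfSetsType leb) _ _ _ (ae_leb_oo fg)).
by move=> x h /h /= ->//; rewrite subrr.
Qed.

Lemma semigroup_L2 t f : 0 <= t -> f \in L2 -> S t f \in L2.
Proof. exact: C0_stable. Qed.

Lemma N2_eq0_eq (f g : R -> R) : f \in L2 -> g \in L2 ->
  N2 (fun x => f x - g x) = 0 -> N2 f = N2 g.
Proof.
move=> fL gL h; apply/eqP; rewrite eq_le; apply/andP; split.
  have := N2D (L2B fL gL) gL; rewrite h add0r; apply: le_trans.
  by rewrite le_eqVlt; apply/orP; left; apply/eqP; apply: N2_ext => x _; rewrite subrK.
have := N2D (L2B gL fL) fL; rewrite N2BC h add0r; apply: le_trans.
by rewrite le_eqVlt; apply/orP; left; apply/eqP; apply: N2_ext => x _; rewrite subrK.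
Qed.

Lemma semigroup_lin t (c : R) f g : 0 <= t -> f \in L2 -> g \in L2 ->
  N2 (fun x => S t (fun x => c * f x + g x) x - (c * S t f x + S t g x)) = 0.
Proof.
move=> t0 fL gL; apply: ae_eq_N2.
- by apply: semigroup_L2 => //; exact: L2_lin.
- by apply: L2_lin; exact: semigroup_L2.
- exact: C0_linear.
Qed.

Lemma N2_eq0_tri (f g h : R -> R) : f \in L2 -> g \in L2 -> h \in L2 ->
  N2 (fun x => f x - g x) = 0 -> N2 (fun x => f x - h x) = N2 (fun x => g x - h x).
Proof.
move=> fL gL hL h0; apply: N2_eq0_eq; [exact: L2B|exact: L2B|].
by rewrite -[RHS]h0; apply: N2_ext => x _; ring.
Qed.

Lemma semigroup_bounded t : 0 <= t -> exists2 M, 1 <= M &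
  forall f, f \in L2 -> N2 (S t f) <= M * N2 f.
Proof.
move=> t0; have [M HM] := C0_bounded C0S t0.
exists (1 + `|M|); first by rewrite lerDl.
move=> f fL; have := HM f fL; rewrite !L2normE ?semigroup_L2// -EFinM lee_fin.
move=> /le_trans; apply; apply: ler_wpM2r; first exact: N2_ge0.
by rewrite (le_trans (ler_norm _))// lerDr.
Qed.

Lemma semigroup_sub t f g : 0 <= t -> f \in L2 -> g \in L2 ->
  N2 (fun x => S t f x - S t g x) = N2 (S t (fun x => f x - g x)).
Proof.
move=> t0 fL gL.
have h := semigroup_lin (-1) t0 gL fL.
have e : (fun x => -1 * g x + f x) = (fun x => f x - g x).
  by apply/funext => x; rewrite mulN1r addrC.
rewrite e in h; have SL k : k \in L2 -> S t k \in L2 by exact: semigroup_L2.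
symmetry; apply: (N2_eq0_eq (SL _ (L2B fL gL)) (L2B (SL _ fL) (SL _ gL))).
by rewrite -[RHS]h; apply: N2_ext => x _; rewrite mulN1r [- _ + _]addrC.
Qed.

Lemma semigroupZ t (c : R) f : 0 <= t -> f \in L2 ->
  N2 (fun x => S t (fun x => c * f x) x - c * S t f x) = 0.
Proof.
move=> t0 fL.
have L0 := L2_0 a b.
have z : N2 (S t (fun=> 0)) = 0.
  have [M _ HM] := semigroup_bounded t0.
  by have := HM _ L0; rewrite N2_0 mulr0 => h; apply/eqP; rewrite eq_le h N2_ge0.
have SL k : k \in L2 -> S t k \in L2 by exact: semigroup_L2.
have h := semigroup_lin c t0 fL L0.
have e : (fun x => c * f x + 0) = (fun x => c * f x).
  by apply/funext => x; rewrite addr0.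
rewrite e in h.
have cL := L2Z c fL.
apply/eqP; rewrite eq_le N2_ge0 andbT.
have := N2D (L2B (SL _ cL) (L2_lin c (SL _ fL) (SL _ L0))) (SL _ L0).
rewrite h z addr0; apply: le_trans; rewrite le_eqVlt; apply/orP; left; apply/eqP.
by apply: N2_ext => x _; ring.
Qed.

Lemma semigroup_continuous f : f \in L2 ->
  N2 (fun x => S h f x - f x) @[h --> 0^'+] --> (0 : R).
Proof.
move=> fL; have := C0_continuous C0S fL; rewrite /L2cvg.
move=> /fine_cvgP[_]; apply: cvg_trans; apply: near_eq_cvg.
near=> h; rewrite /= L2normE//; apply: L2B => //; apply: semigroup_L2 => //.
Unshelve. all: by end_near. Qed.

(** If S t is unbounded for small t, there is a small g for which S t g is
    large. Since S t (x + g) - S t (x - g) = 2 S t g, adding g or subtracting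
    it makes the image of x large as well. *)
Lemma hump_step :
  (forall K dt : R, 0 < dt -> exists (t : R) f, [/\ 0 < t <= dt, f \in L2 & K * N2 f < N2 (S t f)]) ->
  forall (k : nat) x (e : R), x \in L2 -> 0 < e -> exists d (t M : R),
    [/\ d \in L2, N2 d <= e, 0 < t <= k.+1%:R^-1 & [/\ 1 <= M,
     forall f, f \in L2 -> N2 (S t f) <= M * N2 f &
     k%:R < N2 (S t (fun s => x s + d s))]].
Proof.
move=> U k x e xL e0.
have [|t [f [/andP[t0 tk] fL hf]]] := U (k%:R / e) k.+1%:R^-1; first by rewrite invr_gt0.
have t0' := ltW t0.
have [M M1 HM] := semigroup_bounded t0'.
have SL g : g \in L2 -> S t g \in L2 by exact: semigroup_L2.
have fp : 0 < N2 f.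
  rewrite lt_neqAle N2_ge0 andbT eq_sym; apply/eqP => z.
  by have := lt_le_trans hf (HM f fL); rewrite z !mulr0 ltxx.
pose g s := e / N2 f * f s.
have gL : g \in L2 by exact: L2Z.
have Ng : N2 g = e.
  by rewrite N2Z// ger0_norm ?divr_ge0 ?ltW// divfK// gt_eqF.
have NSg : k%:R < N2 (S t g).
  have Sz : N2 (S t g) = N2 (fun s => e / N2 f * S t f s).
    apply: N2_eq0_eq (semigroupZ _ t0' fL); [exact: SL|exact: L2Z (SL _ fL)].
  rewrite Sz N2Z ?SL// ger0_norm ?divr_ge0 ?ltW//.
  rewrite mulrAC ltr_pdivlMr// -ltr_pdivrMl// mulrA [_^-1 * _]mulrC.
  exact: hf.
have sum2 : 2 * N2 (S t g) <= N2 (S t (fun s => x s + g s)) + N2 (S t (fun s => x s - g s)).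
  have xg : (fun s => x s + g s) \in L2 by exact: L2D.
  have xg' : (fun s => x s - g s) \in L2 by exact: L2B.
  have := semigroup_sub t0' xg xg'.
  have -> : (fun s => x s + g s - (x s - g s)) = (fun s => 2 * g s).
    by apply/funext => s; ring.
  have -> : N2 (S t (fun s => 2 * g s)) = N2 (fun s => 2 * S t g s).
    apply: N2_eq0_eq (semigroupZ _ t0' gL); [exact: SL _ (L2Z _ gL)|exact: L2Z (SL _ gL)].
  rewrite N2Z ?SL// ger0_norm// => <-.
  have := N2D (SL _ xg) (L2Z (-1) (SL _ xg')).
  rewrite N2Z ?SL// normrN1 mul1r; apply: le_trans.
  by rewrite le_eqVlt; apply/orP; left; apply/eqP; apply: N2_ext => s _; rewrite mulN1r.
have [h|h] := ltP k%:R (N2 (S t (fun s => x s + g s))).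
  by exists g, t, M; split => //; [rewrite Ng|rewrite t0].
exists (fun s => - 1 * g s), t, M; split; [exact: L2Z| |by rewrite t0|split => //].
  by rewrite N2Z// normrN1 mul1r Ng.
rewrite (_ : (fun s => x s + -1 * g s) = (fun s => x s - g s)).
  by move: sum2 NSg h; lra.
by apply/funext => s; rewrite mulN1r.
Qed.

(** A gliding hump proof of the uniform boundedness principle. If the bound
    failed, iterating [hump_step] would give perturbations d_k, times
    t_k -> 0 and a sum x of the d_k with |S t_k x| >= k - 1, whereas S t_k x
    tends to x. The sizes of the perturbations that follow stage k are small
    compared with the inverse of the norm of S t_k, so that they do not undo
    the growth reached at that stage. *)
Lemma semigroup_local_bound : exists dt M : R, [/\ 0 < dt, 1 <= M &
  forall t f, 0 <= t <= dt -> f \in L2 -> N2 (S t f) <= M * N2 f].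
Proof.
apply: contrapT => nB.
have U (K dt : R) : 0 < dt -> exists (t : R) f, [/\ 0 < t <= dt, f \in L2 & K * N2 f < N2 (S t f)].
  move=> dt0; apply: contrapT => nU; apply: nB; exists dt, (1 + `|K|); split => //.
    by rewrite lerDl.
  move=> t f /andP[]; rewrite le_eqVlt => /predU1P[<- _|t0 tdt] fL.
    have -> : N2 (S 0 f) = N2 f.
      apply: N2_eq0_eq; [exact: semigroup_L2|by []|].
      by apply: ae_eq_N2 => //; [exact: semigroup_L2|exact: C0_id].
    by rewrite ler_peMl ?N2_ge0// lerDl.
  rewrite leNgt; apply/negP => h; apply: nU; exists t, f; split => //; first exact/andP.
  apply: le_lt_trans h; apply: ler_wpM2r; first exact: N2_ge0.
  by rewrite (le_trans (ler_norm _))// lerDr.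
have step (q : nat * ((R -> R) * R)) : exists y : (R -> R) * (R * R),
    q.2.1 \in L2 -> 0 < q.2.2 ->
    [/\ y.1 \in L2, N2 y.1 <= q.2.2, 0 < y.2.1 <= q.1.+1%:R^-1 & [/\ 1 <= y.2.2,
     forall f, f \in L2 -> N2 (S y.2.1 f) <= y.2.2 * N2 f &
     q.1%:R < N2 (S y.2.1 (fun s => q.2.1 s + y.1 s))]].
  case: q => k [x e] /=.
  have [xL|nxL] := boolP (x \in L2); last by exists (fun=> 0, (0, 0)).
  have [e0|ne0] := boolP (0 < e); last by exists (fun=> 0, (0, 0)).
  have [d [t [M H]]] := hump_step U k xL e0.
  by exists (d, (t, M)).
have [G HG] := choice step.
(* State after k stages: the sum of the perturbations made so far, and the
   size allowed for the next one. Dividing the latter by 2 M_k bounds by 1 the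
   effect under S t_k of all the perturbations that follow. *)
pose st := fix st k : (R -> R) * R := if k is k'.+1 then
    let y := G (k', st k') in (fun s => (st k').1 s + y.1 s, (st k').2 / (2 * y.2.2))
  else (fun=> 0, 1).
pose y k := G (k, st k).
have stS k : st k.+1 = (fun s => (st k).1 s + (y k).1 s, (st k).2 / (2 * (y k).2.2)) by [].
have inv k : (st k).1 \in L2 /\ 0 < (st k).2.
  elim: k => [|k [xL e0]]; first by split => //=; exact: L2_0.
  have [dL _ _ [M1 _ _]] := HG (k, st k) xL e0.
  rewrite stS; split => /=; first exact: L2D.
  by rewrite divr_gt0// mulr_gt0// (lt_le_trans ltr01).
have prop k := HG (k, st k) (inv k).1 (inv k).2.
pose d k := (y k).1; pose e k := (st k).2; pose t k := (y k).2.1; pose M k := (y k).2.2.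
have M1 k : 1 <= M k by have [_ _ _ []] := prop k.
have Mp k : 0 < M k by exact: lt_le_trans ltr01 (M1 k).
have e0 k : 0 < e k by exact: (inv k).2.
have eS k : e k.+1 = e k / (2 * M k) by [].
have eS2 k : e k.+1 <= e k / 2.
  by rewrite eS invfM mulrA ler_piMr ?divr_ge0 ?(ltW (e0 _))// invf_le1.
have dL k : d k \in L2 by have [] := prop k.
have de k : N2 (d k) <= e k by have [] := prop k.
have sumd K n : \sum_(K <= i < n) N2 (d i) <= 2 * e K.
  have [nK|Kn] := leqP n K; first by rewrite big_geq// mulr_ge0// ltW.
  suff : \sum_(K <= i < n) N2 (d i) <= 2 * e K - 2 * e n by have := e0 n; lra.
  apply: le_trans (ler_sum _ (fun i _ => de i)) _.
  rewrite -(subnKC (ltnW Kn)); elim: (n - K)%N => [|m ih].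
    by rewrite addn0 big_geq// subrr.
  rewrite addnS big_nat_recr ?leq_addr//=.
  by have := eS2 (K + m)%N; lra.
have xS k : (st k).1 = (fun s => \sum_(0 <= i < k) d i s).
  elim: k => [|k ih]; first by apply/funext => s; rewrite big_geq.
  by rewrite stS ih; apply/funext => s; rewrite big_nat_recr.
have [x xL Hx] := Riesz_Fischer dL (sumd 0%N).
have big k : k%:R - 1 <= N2 (S (t k) x).
  have [_ _ /andP[t0 _] [_ HM hk]] := prop k.
  have t0' := ltW t0.
  have SL g : g \in L2 -> S (t k) g \in L2 by exact: semigroup_L2.
  have xkL := (inv k.+1).1.
  have h1 : N2 (fun s => x s - (st k.+1).1 s) <= 2 * e k.+1.
    rewrite xS; apply: Hx => n; exact: sumd.
  have h2 : N2 (fun s => S (t k) x s - S (t k) (st k.+1).1 s) <= 1.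
    rewrite semigroup_sub//; apply: le_trans (HM _ (L2B xL xkL)) _.
    apply: (@le_trans _ _ (M k * (2 * e k.+1))); first by apply: ler_wpM2l; [exact: (ltW (Mp k))|exact: h1].
    have -> : M k * (2 * e k.+1) = e k.
      have gen (m z : R) : 0 < m -> m * (2 * (z / (2 * m))) = z.
        by move=> m0; field; rewrite gt_eqF.
      by rewrite eS; exact: gen.
    elim: k {h1 hk t0 t0' SL xkL HM} => [|k ih] //; apply: le_trans (eS2 k) _.
    by have := e0 k; lra.
  have h3 : k%:R < N2 (S (t k) (st k.+1).1) by [].
  have e1 : N2 (fun s => S (t k) (st k.+1).1 s - S (t k) x s + S (t k) x s)
      = N2 (S (t k) (st k.+1).1) by apply: N2_ext => s _; rewrite subrK.
  have := N2D (L2B (SL _ xkL) (SL _ xL)) (SL _ xL).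
  rewrite e1 N2BC; move: h2 h3; lra.
have c := semigroup_continuous xL.
have ct : t @ \oo --> 0^'+.
  have t0 k : 0 < t k by have [_ _ /andP[]] := prop k.
  have tk k : t k <= k.+1%:R^-1 by have [_ _ /andP[]] := prop k.
  have c0 : t @ \oo --> (0 : R).
    apply: (@squeeze_cvgr _ _ _ _ (fun=> 0) (fun k => k.+1%:R^-1)).
    - by apply: nearW => k; rewrite ltW//= tk.
    - exact: cvg_cst.
    - exact: cvg_harmonic.
  move=> P [r /= r0 rP].
  have : \forall k \near \oo, `|0 - t k| < r by move/cvgrPdist_lt : c0 => /(_ _ r0).
  by apply: filterS => k h; exact: rP.
have cc : (fun k => N2 (fun s => S (t k) x s - x s)) @ \oo --> (0 : R).
  exact: cvg_comp ct c.
have : \forall k \near \oo, N2 (fun s => S (t k) x s - x s) < 1.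
  by apply: (cvgr_lt _ cc).
move=> [n0 _ Hn0].
pose k0 := maxn n0 (Num.truncn (N2 x + 2)).+1.
have h1 := Hn0 k0 (leq_maxl _ _).
have h2 : N2 x + 2 < k0%:R.
  apply: (@lt_le_trans _ _ (Num.truncn (N2 x + 2)).+1%:R).
    by apply: truncnS_gt.
  by rewrite ler_nat leq_maxr.
have h3 := big k0.
have tk0 : 0 <= t k0 by have [_ _ /andP[/ltW]] := prop k0.
have h4 := N2D (L2B (semigroup_L2 tk0 xL) xL) xL.
have e1 : N2 (fun s => S (t k0) x s - x s + x s) = N2 (S (t k0) x).
  by apply: N2_ext => s _; rewrite subrK.
rewrite e1 in h4; move: h1 h2 h3 h4 => /= h1 h2 h3 h4.
suff : (1 : R) < 1 by rewrite ltxx.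
move: h1 h2 h3 h4; lra.
Qed.

End LocalBound.

(** * The semigroup on the eigenfunctions *)

Section SmoothWeakDerivative.
Context {R : realType}.
Notation leb := (@lebesgue_measure R).

Lemma weak_derivative_smooth (a b : R) (F dF : R -> R) : a < b ->
  has_deriv F dF -> continuous dF -> weak_derivative a b F dF.
Proof.
move=> ab hF cdF; have cF := has_deriv_continuous hF.
split.
- by apply: open_integrable_locally; [exact: interval_open|exact: continuous_itg].
- by apply: open_integrable_locally; [exact: interval_open|exact: continuous_itg].
move=> phi [dphi [c [d [ac db z]]]].
have hphi : has_deriv phi (derive1 phi).
  by move=> x; rewrite derive1E; apply: derivableP; exact: (dphi 0%N).
have cdphi : continuous (derive1 phi).
  by move=> x; apply: differentiable_continuous; apply/derivable1_diffP; exact: (dphi 1%N).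
have cphi := has_deriv_continuous hphi.
have pa : phi a = 0 by apply: z; rewrite in_itv/= leNgt ac.
have pb : phi b = 0 by apply: z; rewrite in_itv/= andbC leNgt db.
have c1 : continuous (fun x => F x * derive1 phi x) by exact: continuousM_fun.
have c2 : continuous (fun x => dF x * phi x) by exact: continuousM_fun.
have D : has_deriv (fun x => F x * phi x)
    (fun x => F x * derive1 phi x - (-1) * (dF x * phi x)).
  by apply: (has_deriv_eq (has_derivM hF hphi)) => x; ring.
have cc : continuous (fun x => F x * derive1 phi x - (-1) * (dF x * phi x)).
  by apply: continuousB_fun => //; exact: continuousZ_fun.
have := FTC_Rintegral ab D cc; rewrite Rintegral_linB// pa pb !mulr0 subrr mulN1r opprK.
by move=> /eqP; rewrite addr_eq0 => /eqP.
Qed.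

End SmoothWeakDerivative.

Section EigenEvolution.
Context {R : realType}.
Variable a : R.
Hypothesis a1 : a < 1.
Notation L := (1 - a).
Notation leb := (@lebesgue_measure R).
Notation N2 := (N2 a 1).
Notation L2 := (L2 a 1).

Lemma ev_degenerate_op (l : R) : E (l * L) = 0 ->
  degenerate_op a (ev a l) (fun x => - (l * ev a l x)).
Proof.
move=> e.
have cdE : continuous (fun x => l * E1 (l * (x - a))).
  exact: has_deriv_continuous (has_deriv_dev a l).
have ce := @continuous_ev R a l.
have cle : continuous (fun x => - (l * ev a l x)).
  by move=> x; apply: cvgN; exact: continuousZ_fun.
have cxE : continuous (fun x => (x - a) * (l * E1 (l * (x - a)))).
  by apply: continuousM_fun => //; exact: continuous_shift.
split; [exact: ev_L2|exact: continuous_L2|].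
exists (fun x => l * E1 (l * (x - a))); split.
- by apply: weak_derivative_smooth => //; exact: has_deriv_ev.
- have c2 : continuous (fun x => (x - a) * (l * E1 (l * (x - a))) ^+ 2).
    by apply: continuousM_fun; [exact: continuous_shift|exact: continuousX2_fun].
  have /integrableP[_] := continuous_itg a 1 c2.
  apply: le_lt_trans; apply: ge0_le_integral => //.
  + by move=> x; rewrite /= in_itv/= => /andP[/ltW ax _]; rewrite lee_fin mulr_ge0 ?sqr_ge0// subr_ge0.
  + by apply/measurable_EFinP; apply: measurable_funTS; exact: continuous_measurable_fun.
  + apply: measurableT_comp => //.
    by apply/measurable_EFinP; apply: measurable_funTS; exact: continuous_measurable_fun.
  + by move=> x _; rewrite lee_fin ler_norm.
- exists (ev a l); split => //; first exact: continuous_subspaceT.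
  by apply: aeW.
- exact: continuous_L2.
- apply: weak_derivative_smooth => //.
  apply: (has_deriv_eq (has_derivM (has_deriv_shift a) (has_deriv_dev a l))) => x.
  by rewrite mul1r addrC ev_ode.
Qed.

Variable S : R -> (R -> R) -> (R -> R).
Hypothesis gen : generates a 1 (degenerate_op a) S.

Let C0S : C0_semigroup a 1 S. Proof. by case: gen. Qed.

Section Eigenfunction.
Variables (l : R) (f : R -> R).
Hypothesis l0 : 0 < l.
Hypothesis fL : f \in L2.
Hypothesis Af : degenerate_op a f (fun x => - (l * f x)).

Let dev t := N2 (fun x => S t f x - expR (- (l * t)) * f x).
Let SL t g : 0 <= t -> g \in L2 -> S t g \in L2. Proof. exact: semigroup_L2. Qed.

(** The deviation from e^(-lt) f is compared through S s (e^(-lh) f). *)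
Lemma dev_step (s h M : R) : 0 <= s -> 0 <= h ->
  (forall g, g \in L2 -> N2 (S s g) <= M * N2 g) -> dev (s + h) <= M * dev h + dev s.
Proof.
move=> s0 h0 HM.
have sh0 : 0 <= s + h by rewrite addr_ge0.
have ShL := SL h0 fL; have SsL := SL s0 fL.
have e1 : N2 (fun x => S (s + h) f x - S s (S h f) x) = 0.
  by apply: ae_eq_N2; [exact: SL|exact: SL|exact: C0_comp].
set k := expR (- (l * h)).
have kL : (fun x => k * f x) \in L2 by exact: L2Z.
rewrite /dev (N2_eq0_tri (SL sh0 fL) (SL s0 ShL) (L2Z _ fL) e1).
apply: le_trans (N2_tri (SL s0 ShL) (SL s0 kL) (L2Z _ fL)) _.
apply: lerD.
  by rewrite (semigroup_sub C0S s0 ShL kL); apply: HM; exact: L2B.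
rewrite (N2_eq0_tri (SL s0 kL) (L2Z k SsL) (L2Z _ fL) (semigroupZ C0S k s0 fL)).
rewrite (_ : N2 _ = k * dev s).
  by rewrite ler_piMl ?N2_ge0// -expR0 ler_expR oppr_le0 mulr_ge0// ltW.
have kp : 0 < k by exact: expR_gt0.
have dL := L2B SsL (L2Z (expR (- (l * s))) fL).
rewrite /dev -(gtr0_norm kp) -(N2Z _ dL) (gtr0_norm kp).
apply: N2_ext => x _; rewrite mulrBr mulrA -expRD; congr (_ - expR _ * _).
by rewrite mulrDr opprD addrC.
Qed.

(** Since f is in the domain and A f = - l f, both S h f and e^(-lh) f are
    f - h l f + o(h). *)
Lemma dev_small : (fun h => h^-1 * dev h) @ 0^'+ --> (0 : R).
Proof.
have [_ /(_ f (fun x => - (l * f x)) fL _)] := gen.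
have lfL : (fun x => - (l * f x)) \in L2.
  have := L2Z (- l) fL; rewrite (_ : (fun x => - l * f x) = (fun x => - (l * f x)))//.
  by apply/funext => x; rewrite mulNr.
move=> /(_ lfL)[/(_ Af) + _]; rewrite /L2cvg => /fine_cvgP[_] c1.
have c2 : `| h^-1 * (expR (- (l * h)) - 1) + l | @[h --> 0^'+] --> (0 : R).
  have c0 : l ^+ 2 * h @[h --> (0 : R)^'+] --> (0 : R).
    rewrite -[X in _ --> X](mulr0 (l ^+ 2)); apply: cvgMr.
    by apply: cvg_at_right_filter; exact: cvg_id.
  apply: (squeeze_cvgr _ (cvg_cst 0) c0); near=> h.
  have h0 : 0 < h by near: h; exact: nbhs_right_gt.
  have lh0 : 0 < l * h by exact: mulr_gt0.
  rewrite normr_ge0/=.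
  have -> : h^-1 * (expR (- (l * h)) - 1) + l = h^-1 * (expR (- (l * h)) - 1 + l * h).
    by field; rewrite gt_eqF.
  have k1 : 0 <= expR (- (l * h)) - 1 + l * h.
    by have := expR_ge1Dx (- (l * h)); lra.
  have k2 : expR (- (l * h)) * (1 + l * h) <= 1.
    rewrite expRN mulrC ler_pdivrMr ?expR_gt0// mul1r; exact: expR_ge1Dx.
  (* From e^(-y) (1 + y) <= 1 and (1 + y) (1 - y + y^2) >= 1. *)
  have k3 : expR (- (l * h)) - 1 + l * h <= (l * h) ^+ 2.
    have k4 : (1 + l * h) * (1 - l * h + (l * h) ^+ 2 - expR (- (l * h))) >= 0.
      move: k2 lh0; generalize (expR (- (l * h))) (l * h) => u v; nra.
    have : 0 <= 1 - l * h + (l * h) ^+ 2 - expR (- (l * h)).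
      by move: k4; rewrite pmulr_rge0// addr_gt0.
    by lra.
  rewrite ger0_norm ?mulr_ge0 ?invr_ge0 ?(ltW h0)//.
  rewrite -ler_pdivlMl ?invr_gt0// invrK (le_trans k3)//.
  by rewrite le_eqVlt; apply/orP; left; apply/eqP; ring.
have c3 : `| h^-1 * (expR (- (l * h)) - 1) + l | * N2 f @[h --> 0^'+] --> (0 : R).
  by rewrite -[X in _ --> X](mul0r (N2 f)); exact: cvgMl.
have c4 : (fun h => fine (L2norm a 1 ((fun x => h^-1 * (S h f x - f x)) \- (fun x => - (l * f x))))
    + `| h^-1 * (expR (- (l * h)) - 1) + l | * N2 f) @ 0^'+ --> (0 : R).
  by rewrite -[X in _ --> X](addr0 0); exact: cvgD c1 c3.
apply: (squeeze_cvgr _ (cvg_cst 0) c4).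
near=> h.
have h0 : 0 < h by near: h; exact: nbhs_right_gt.
have ShL := SL (ltW h0) fL.
rewrite mulr_ge0 ?invr_ge0 ?(ltW h0) ?N2_ge0//=.
have gL : (fun x => h^-1 * (S h f x - f x)) \in L2 by exact: L2Z (L2B ShL fL).
have dL := L2B ShL (L2Z (expR (- (l * h))) fL).
have hV0 : 0 < h^-1 by rewrite invr_gt0.
rewrite /dev -{1}(gtr0_norm hV0) -(N2Z _ dL).
set c := h^-1 * (expR (- (l * h)) - 1) + l.
have cL := L2Z (- c) fL.
rewrite [X in X <= _](N2_ext (g := fun x => (h^-1 * (S h f x - f x) - - (l * f x)) + - c * f x)).
  apply: le_trans (N2D (L2B gL lfL) cL) _; rewrite N2Z// normrN.
  have -> := L2normE (L2B gL lfL).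
  exact: lexx.
by move=> x _; rewrite /c; ring.
Unshelve. all: by end_near. Qed.

(** For small t, cutting [0,t] into n steps bounds the deviation by
    n M o(t / n), which tends to 0; the semigroup law extends this to all t.
    The uniform constant M is the reason for [semigroup_local_bound]. *)
Lemma eigen_evolution t : 0 <= t ->
  N2 (fun x => S t f x - expR (- (l * t)) * f x) = 0.
Proof.
have [dt [M [dt0 M1 HM]]] := semigroup_local_bound C0S.
have dev0 : dev 0 = 0.
  rewrite -[RHS](ae_eq_N2 (SL (lexx 0) fL) fL (C0_id C0S fL)).
  by apply: N2_ext => x _; rewrite mulr0 oppr0 expR0 mul1r.
have small s : 0 <= s <= dt -> dev s = 0.
  rewrite le_eqVlt => /andP[/predU1P[<- //|s0] sdt].
  have B n : dev s <= s * M * ((s / n.+1%:R)^-1 * dev (s / n.+1%:R)).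
    pose h := s / n.+1%:R.
    have h0 : 0 < h by rewrite divr_gt0.
    have K k : (k <= n.+1)%N -> dev (k%:R * h) <= k%:R * (M * dev h).
      elim: k => [|k ih] kn; first by rewrite !mul0r dev0.
      rewrite -natr1 mulrDl mul1r; apply: le_trans (@dev_step _ _ M _ (ltW h0) _) _.
      - by rewrite mulr_ge0// ltW.
      - move=> g gL; apply: HM => //; rewrite mulr_ge0 ?(ltW h0)//=.
        apply: le_trans sdt; rewrite /h mulrA ler_pdivrMr// mulrC.
        by rewrite ler_pM2l// ler_nat ltnW.
      - by rewrite mulrDl mul1r addrC lerD2r ih// ltnW.
    have e : n.+1%:R * h = s by rewrite /h mulrC divfK// pnatr_eq0.
    have hn0 : h != 0 by rewrite gt_eqF.
    have := K n.+1 (leqnn _); rewrite e => /le_trans; apply.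
    rewrite -/h -{1}e le_eqVlt; apply/orP; left; apply/eqP.
    by field.
  apply/eqP; rewrite eq_le N2_ge0 andbT.
  have cs : (fun n => s / n.+1%:R) @ \oo --> (0 : R)^'+.
    have c0 : (fun n => s / n.+1%:R) @ \oo --> (0 : R).
      by rewrite -[X in _ --> X](mulr0 s); apply: cvgMr; exact: cvg_harmonic.
    move=> P [r /= r0 rP].
    have : \forall k \near \oo, `|0 - s / k.+1%:R| < r by move/cvgrPdist_lt : c0 => /(_ _ r0).
    by apply: filterS => k h; apply: rP => //=; rewrite divr_gt0.
  have c1 : (fun n => (s / n.+1%:R)^-1 * dev (s / n.+1%:R)) @ \oo --> (0 : R).
    exact: cvg_comp cs dev_small.
  have c2 : (fun n => s * M * ((s / n.+1%:R)^-1 * dev (s / n.+1%:R))) @ \oo --> (0 : R).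
    by rewrite -[X in _ --> X](mulr0 (s * M)); apply: cvgMr; exact: c1.
  have c3 : (fun _ : nat => dev s) @ \oo --> dev s by exact: cvg_cst.
  by apply: (ler_cvg_to c3 c2); exact: nearW.
move=> t0; rewrite -/(dev t).
pose n := (Num.truncn (t / dt)).+1.
pose s := t / n%:R.
have s0 : 0 <= s by rewrite divr_ge0.
have sdt : s <= dt.
  rewrite /s ler_pdivrMr ?ltr0n// mulrC -ler_pdivrMr//; apply: ltW; exact: truncnS_gt.
have ds : dev s = 0 by apply: small; rewrite s0.
have K k : dev (k%:R * s) = 0.
  elim: k => [|k ih]; first by rewrite mul0r.
  have ks0 : 0 <= k%:R * s by rewrite mulr_ge0.
  have [M' _ HM'] := semigroup_bounded C0S ks0.
  apply/eqP; rewrite eq_le N2_ge0 andbT -natr1 mulrDl mul1r.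
  by have := dev_step ks0 s0 HM'; rewrite ds ih mulr0 addr0.
have := K n; rewrite /s mulrC divfK//; first by rewrite pnatr_eq0.
Qed.

End Eigenfunction.
End EigenEvolution.

(** * Convergence of the eigenfunction expansion in L^2(a,1) *)

Section FourierBessel.
Context {R : realType}.
Variable a : R.
Hypothesis a1 : a < 1.
Hypothesis a0 : 0 < a.
Notation L := (1 - a).
Notation ip := (ip a 1).
Notation N2 := (N2 a 1).
Notation L2 := (L2 a 1).
Variable lam : nat -> R.
Hypothesis lam_gt0 : forall n, 0 < lam n.
Hypothesis lam_incr : forall m n, (m < n)%N -> lam m < lam n.
Hypothesis lam_zero : forall n, E (lam n * L) = 0.
Hypothesis lam_all : forall l : R, 0 < l -> E (l * L) = 0 -> exists n, l = lam n.
Notation w n := (ev a (lam n)).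
Notation psum := (psum a lam).
Notation fcoef := (fcoef a lam).

Section Parseval.
Variable v : R -> R.
Hypothesis vL : v \in L2.
Let s N := \sum_(n < N) ip v (w n) ^+ 2 / ip (w n) (w n).
Let wg := w_gt0 a1 lam_gt0 lam_zero.

Lemma psum_sub_norm M N : (M <= N)%N ->
  ip (fun x => psum v N x - psum v M x) (fun x => psum v N x - psum v M x) = s N - s M.
Proof.
move=> MN; rewrite ip_sqrB ?psum_L2//.
have e K : ip (psum v K) (psum v K) = s K.
  rewrite {2}/psum ip_sumr ?psum_L2//; last by move=> i _; exact: cw_L2.
  apply: eq_bigr => i _; rewrite ipZr ?w_L2 ?psum_L2//.
  rewrite (@ip_psum_w _ _ a1 _ lam_gt0 lam_incr lam_zero _ K i)//.
  by rewrite /fcoef expr2 mulrAC.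
have -> : ip (psum v N) (psum v M) = s M.
  rewrite {2}/psum ip_sumr ?psum_L2//; last by move=> i _; exact: cw_L2.
  apply: eq_bigr => i _; rewrite ipZr ?w_L2 ?psum_L2//.
  rewrite (@ip_psum_w _ _ a1 _ lam_gt0 lam_incr lam_zero _ N i)//.
    by rewrite /fcoef expr2 mulrAC.
  exact: leq_trans (ltn_ord i) MN.
by rewrite !e; ring.
Qed.

(** Along a subsequence with increments of norm at most 2^(-k) the partial
    sums converge by Riesz-Fischer. The limit has the same coefficients as v,
    hence equals v by completeness. A subsequence is enough, because the
    evolved sums are shown to converge on their own. *)
Lemma psum_cvg_subseq (e : R) (n0 : nat) : 0 < e ->
  exists2 N, (n0 <= N)%N & N2 (fun x => v x - psum v N x) <= e.
Proof.
move=> e0.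
have s_nd : nondecreasing_seq s.
  apply/nondecreasing_seqP => n; rewrite /s big_ord_recr/= lerDl divr_ge0 ?sqr_ge0//.
  exact: ltW (wg n).
have sb n : s n <= ip v v by exact: (Bessel_inequality a1 lam_gt0 lam_incr lam_zero).
have cs : s @ \oo --> limn s.
  by apply: nondecreasing_is_cvgn => //; exists (ip v v) => _ [n _ <-].
have s_le n : s n <= limn s by apply: nondecreasing_cvgn_le.
have near_s k : exists n, (limn s - s n <= (2^-1 ^+ k) ^+ 2).
  have : \forall n \near \oo, limn s - (2^-1 ^+ k) ^+ 2 < s n.
    by apply: (cvgr_gt _ cs); rewrite ltrBlDr ltrDl !exprn_gt0.
  by move=> [n _ H]; exists n; have := H n (leqnn _) => /=; lra.
have [F HF] := choice near_s.
(* An increasing choice of indices that dominates F. *)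
pose N k := (k + \sum_(i < k.+1) F i)%N.
have NF k : (F k <= N k)%N.
  by rewrite /N big_ord_recr/= addnA leq_addl.
have NS k : (N k <= N k.+1)%N.
  by rewrite /N [in leqRHS]big_ord_recr/= leq_add// leq_addr.
have Nk k : (k <= N k)%N by rewrite leq_addr.
have rem k n : (N k <= n)%N -> limn s - s n <= (2^-1 ^+ k) ^+ 2.
  by move=> kn; have := HF k; have := s_nd _ _ (leq_trans (NF k) kn); lra.
pose d k x := psum v (N k.+1) x - psum v (N k) x.
have dL k : d k \in L2 by apply: L2B; exact: psum_L2.
have dN k : N2 (d k) <= 2^-1 ^+ k.
  rewrite -(@ler_pXn2r _ 2) ?nnegrE ?N2_ge0 ?exprn_ge0// N2_sqr psum_sub_norm ?NS//.
  by have := rem k (N k) (leqnn _); have := s_le (N k.+1); lra.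
have dsum K n : \sum_(K <= i < n) N2 (d i) <= 2 * 2^-1 ^+ K.
  have [nK|Kn] := leqP n K; first by rewrite big_geq// mulr_ge0// exprn_ge0.
  suff : \sum_(K <= i < n) N2 (d i) <= 2 * 2^-1 ^+ K - 2 * 2^-1 ^+ n.
    have : 0 <= 2^-1 ^+ n :> R by rewrite exprn_ge0.
    by lra.
  apply: le_trans (ler_sum _ (fun i _ => dN i)) _.
  rewrite -(subnKC (ltnW Kn)); elim: (n - K)%N => [|m ih].
    by rewrite addn0 big_geq// subrr.
  rewrite addnS big_nat_recr ?leq_addr//= exprS.
  by move: ih; generalize (2^-1 ^+ (K + m) : R) => z; lra.
have [y yL Hy] := Riesz_Fischer dL (dsum 0%N).
pose x t := y t + psum v (N 0%N) t.
have xL : x \in L2 by apply: L2D => //; exact: psum_L2.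
have tele K t : \sum_(0 <= i < K) d i t = psum v (N K) t - psum v (N 0%N) t.
  exact: (telescope_sumr (fun i => psum v (N i) t)).
have Hx K : N2 (fun t => x t - psum v (N K) t) <= 2 * 2^-1 ^+ K.
  apply: le_trans (Hy K _ (dsum K)); rewrite le_eqVlt; apply/orP; left; apply/eqP.
  by apply: N2_ext => t _; rewrite tele /x; ring.
have c2 : (fun K => 2 * 2^-1 ^+ K) @ \oo --> (0 : R).
  rewrite -[X in _ --> X](mulr0 (2 : R)); apply: cvgMr.
  have h : `|2^-1| < 1 :> R by rewrite ger0_norm// invf_lt1// ltr1n.
  exact: (cvg_expr h).
have zL : (fun t => v t - x t) \in L2 by exact: L2B.
have orth n : ip (fun t => v t - x t) (w n) = 0.
  have B K : `|ip (fun t => v t - x t) (w n)| <= 2 * 2^-1 ^+ (K + n.+1) * N2 (w n).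
    have nN : (n < N (K + n.+1))%N by rewrite (leq_trans _ (Nk _))// leq_addl.
    set m := N (K + n.+1) in nN.
    have -> : ip (fun t => v t - x t) (w n) = - ip (fun t => x t - psum v m t) (w n).
      rewrite !ipBl ?psum_L2 ?w_L2//.
      by rewrite (ip_psum_w a1 lam_gt0 lam_incr lam_zero v nN) opprB.
    rewrite normrN; apply: le_trans (ip_le_N2 (L2B xL (psum_L2 _ _ _ _)) (w_L2 _ _ _)) _.
    by apply: ler_wpM2r; [exact: N2_ge0|exact: Hx].
  apply/eqP; rewrite -normr_le0.
  have c3 : (fun K => 2 * 2^-1 ^+ (K + n.+1) * N2 (w n)) @ \oo --> (0 : R).
    rewrite -[X in _ --> X](mul0r (N2 (w n))); apply: cvgMl.
    by rewrite (cvg_shiftn n.+1 (fun K : nat => 2 * 2^-1 ^+ K : R)).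
  have c4 : (fun _ : nat => `|ip (fun t => v t - x t) (w n)|) @ \oo
    --> `|ip (fun t => v t - x t) (w n)| by exact: cvg_cst.
  by apply: (ler_cvg_to c4 c3); exact: nearW.
have z0 : N2 (fun t => v t - x t) = 0.
  by rewrite -[N2 _]/(Num.sqrt (ip _ _)) (completeness a1 a0 lam_gt0 lam_incr lam_zero lam_all zL orth) sqrtr0.
have : \forall K \near \oo, 2 * 2^-1 ^+ K < e :> R by apply: (cvgr_lt _ c2).
move=> [K0 _ HK]; pose K := maxn K0 n0; exists (N K).
  by rewrite (leq_trans _ (Nk K))// leq_maxr.
rewrite (N2_eq0_tri vL xL (psum_L2 _ _ _ _) z0) (le_trans (Hx K))//.
by apply: ltW; apply: HK => /=; exact: leq_maxl.
Qed.

End Parseval.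

Section Evolution.
Variable S : R -> (R -> R) -> (R -> R).
Hypothesis gen : generates a 1 (degenerate_op a) S.
Let C0S : C0_semigroup a 1 S. Proof. by case: gen. Qed.

Definition evol (v : R -> R) (t : R) (N : nat) (x : R) :=
  \sum_(n < N) fcoef v n * expR (- (lam n * t)) * w n x.

Lemma evol_L2 v t N : evol v t N \in L2.
Proof. by apply: L2_sum => i _; exact: cw_L2. Qed.

Lemma semigroup_psum v t N : 0 <= t ->
  N2 (fun x => S t (psum v N) x - evol v t N x) = 0.
Proof.
move=> t0; elim: N => [|N ih].
  have z : S t (psum v 0) \in L2 by apply: semigroup_L2 => //; exact: psum_L2.
  have [M _ HM] := semigroup_bounded C0S t0.
  apply/eqP; rewrite eq_le N2_ge0 andbT.
  have := HM _ (psum_L2 a lam v 0); rewrite (N2_ext (f := psum v 0) (g := fun=> 0)); last first.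
    by move=> x _; rewrite /psum big_ord0.
  rewrite N2_0 mulr0; apply: le_trans; rewrite le_eqVlt; apply/orP; left; apply/eqP.
  by apply: N2_ext => x _; rewrite /evol big_ord0 subr0.
have e : psum v N.+1 = (fun x => fcoef v N * w N x + psum v N x).
  by apply/funext => x; rewrite /psum big_ord_recr/= addrC.
have SL f : f \in L2 -> S t f \in L2 by exact: semigroup_L2.
have pL := psum_L2 a lam v N.
have wL := w_L2 a lam N.
have h := semigroup_lin C0S (fcoef v N) t0 wL pL.
rewrite e (N2_eq0_tri (SL _ (L2_lin _ wL pL)) (L2_lin _ (SL _ wL) (SL _ pL)) (evol_L2 _ _ _) h).
have ew := eigen_evolution gen (lam_gt0 N) wL (ev_degenerate_op a1 (lam_zero N)) t0.
have ewL : (fun x => expR (- (lam N * t)) * w N x) \in L2 by exact: L2Z.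
apply/eqP; rewrite eq_le N2_ge0 andbT.
have := N2D (L2Z (fcoef v N) (L2B (SL _ wL) ewL)) (L2B (SL _ pL) (evol_L2 v t N)).
rewrite N2Z ?L2B ?SL// ew mulr0 ih addr0; apply: le_trans.
rewrite le_eqVlt; apply/orP; left; apply/eqP; apply: N2_ext => x _.
by rewrite /evol big_ord_recr/=; ring.
Qed.

End Evolution.
End FourierBessel.

(** * The evolved series as a function of x *)

Section DominatedSeries.
Context {R : realType}.
Variables (B : nat -> R).
Hypothesis cB : cvgn (series B).

Lemma dom_series_cvg (g : nat -> R) (c : R) : (forall n, `|g n| <= c * B n) ->
  cvgn (series g).
Proof.
move=> gB; apply: normed_cvg; apply: (@series_le_cvg R _ (fun n => c * B n)).
- by move=> n; exact: normr_ge0.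
- by move=> n; exact: le_trans (gB n).
- exact: gB.
- have -> : series (fun n => c * B n) = (fun n => c * series B n).
    by apply/funext => n; rewrite /series/= mulr_sumr.
  by apply: is_cvgMr.
Qed.

Lemma dom_series_tail (g : nat -> R) (c : R) N : (forall n, `|g n| <= c * B n) ->
  `|limn (series g) - series g N| <= c * (limn (series B) - series B N).
Proof.
move=> gB; have cg := dom_series_cvg gB.
have c1 : (fun n => `|series g n - series g N|) @ \oo --> `|limn (series g) - series g N|.
  by apply: cvg_norm; apply: cvgB => //; exact: cvg_cst.
have c2 : (fun n => c * (series B n - series B N)) @ \oo -->
    c * (limn (series B) - series B N).
  by apply: cvgMr; apply: cvgB => //; exact: cvg_cst.
apply: (ler_cvg_to c1 c2); exists N => // n /= Nn.
rewrite !sub_series_geq// mulr_sumr (le_trans (ler_norm_sum _ _ _))//.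
exact: ler_sum.
Qed.

Lemma dom_series_lim (g : nat -> R) (c : R) : (forall n, `|g n| <= c * B n) ->
  `|limn (series g)| <= c * limn (series B).
Proof.
by move=> gB; have := dom_series_tail 0 gB; rewrite /series/= !big_geq// !subr0.
Qed.

End DominatedSeries.

(** If f and q differed at x, by continuity they would differ on an interval of
    positive length to the left of x. *)
Lemma within_continuous_ae_eq {R : realType} (a b : R) (f q : R -> R) : a < b ->
  {within `]a, b], continuous f} -> continuous q ->
  {ae (@lebesgue_measure R), forall x, a < x < b -> f x = q x} ->
  forall x, a < x <= b -> f x = q x.
Proof.
move=> ab cf cq AE x axb; apply/eqP; rewrite -subr_eq0; apply: contrapT => /negP n0.
have cfq : {within `]a, b], continuous (fun y => f y - q y)}.
  apply/subspace_continuousP => y yab; apply: cvgB.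
    by move/subspace_continuousP : cf; exact.
  by apply: cvg_within_filter; exact: cq.
have xI : `]a, b]%classic x by rewrite /= in_itv.
move/subspace_continuousP : cfq => /(_ x xI) cx.
have e0 : 0 < `|f x - q x| by rewrite normr_gt0.
move/cvgrPdist_lt : cx => /(_ _ e0); rewrite near_withinE => -[r /= r0 H].
have /andP[ax xb] := axb.
pose l := Num.max a (x - r).
have lx : l < x by rewrite /l gt_max ax/= ltrBlDr ltrDl.
have [A [mA A0 HA]] := AE.
have sub : `]l, x[ `<=` A.
  move=> y; rewrite /= in_itv/= => /andP[ly yx]; apply: HA => /= h.
  have ay : a < y by apply: le_lt_trans ly; rewrite /l le_max lexx.
  have xry : x - r < y by apply: le_lt_trans ly; rewrite /l le_max lexx orbT.
  have yb : y < b by exact: lt_le_trans xb.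
  have : `|f x - q x - (f y - q y)| < `|f x - q x|.
    apply: H => /=.
      by rewrite gtr0_norm ?subr_gt0//; lra.
    by rewrite in_itv/= ay ltW.
  by rewrite h ?ay// subrr subr0 ltxx.
have : (lebesgue_measure `]l, x[%classic <= lebesgue_measure A)%E.
  by apply: le_measure => //; rewrite inE.
rewrite A0 lebesgue_measure_itv/= lte_fin lx -EFinD lee_fin; lra.
Qed.

Section Pointwise.
Context {R : realType}.
Variable a : R.
Hypothesis a1 : a < 1.
Hypothesis a0 : 0 < a.
Notation L := (1 - a).
Notation ip := (ip a 1).
Notation N2 := (N2 a 1).
Notation L2 := (L2 a 1).
Notation leb := (@lebesgue_measure R).
Variable lam : nat -> R.
Hypothesis lam_gt0 : forall n, 0 < lam n.
Hypothesis lam_incr : forall m n, (m < n)%N -> lam m < lam n.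
Hypothesis lam_zero : forall n, E (lam n * L) = 0.
Hypothesis lam_all : forall l : R, 0 < l -> E (l * L) = 0 -> exists n, l = lam n.
Notation w n := (ev a (lam n)).
Notation dw n := (fun x => lam n * E1 (lam n * (x - a))).
Notation psum := (psum a lam).
Notation fcoef := (fcoef a lam).

Lemma lam_ge1 n : 1 <= lam n.
Proof.
have L0 : 0 < L by rewrite subr_gt0.
apply: le_trans (lam_ge a1 lam_gt0 lam_incr lam_zero n).
rewrite ler_pdivlMr// mul1r (@le_trans _ _ 1)// ?ler1n//.
by rewrite lerBlDr lerDl ltW.
Qed.

Variables (v : R -> R) (t : R).
Hypothesis vL : v \in L2.
Hypothesis t0 : 0 < t.
Let A n := fcoef v n * expR (- (lam n * t)).
(* Dominates the n-th terms of the series, of its derivative and, up to a factor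
   (1 - x)^2, of its second order Taylor remainder at 1. *)
Let B n := `|A n| * lam n ^+ 2.

Lemma N2_le_bound (f : R -> R) (c : R) : continuous f -> 0 <= c ->
  (forall x, a <= x <= 1 -> `|f x| <= c) -> N2 f <= c.
Proof.
move=> cf c0 fc; rewrite -(@ler_pXn2r _ 2) ?nnegrE ?N2_ge0// N2_sqr.
have := ip_le_bound a1 cf cf c0 fc fc; rewrite ger0_norm ?ip_ge0// => /le_trans; apply.
rewrite expr2 ler_piMl ?mulr_ge0// lerBlDr lerDl; exact: ltW.
Qed.

Let B0 n : 0 <= B n. Proof. by rewrite mulr_ge0 ?sqr_ge0. Qed.

(** The coefficients of v grow at most like lam n, and e^(-y) <= (4/y)^4: of
    the powers lam^(1 - 4 + 2) there remains 1 / lam n, which is summable. *)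
Let B_le : exists2 K : R, 0 <= K & forall n, B n <= K * (lam n)^-1.
Proof.
exists (8 * N2 v * (4 / t) ^+ 4).
  apply: mulr_ge0; first by rewrite mulr_ge0// N2_ge0.
  by rewrite exprn_ge0// divr_ge0// ltW.
move=> n; have l0 := lam_gt0 n.
have L0 : 0 < L by rewrite subr_gt0.
have wg := w_gt0 a1 lam_gt0 lam_zero n.
have lL : 0 <= lam n * L by rewrite mulr_ge0 ?ltW.
have w1 : N2 (w n) <= 1.
  apply: N2_le_bound => //; first exact: continuous_ev.
  by move=> x /andP[ax _]; apply: ev_le1 => //; exact: ltW.
have f1 : `|fcoef v n| <= 8 * N2 v * lam n.
  rewrite -[fcoef v n]/(ip v (w n) / ip (w n) (w n)) normrM normfV (gtr0_norm wg) ler_pdivrMr//.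
  apply: le_trans (ip_le_N2 vL (w_L2 a lam n)) _.
  have h : 1 <= 8 * lam n * ip (w n) (w n).
    rewrite ip_ev ?gt_eqF// mulrAC mulrA divfK ?gt_eqF//.
    have := Psi_ge (E_zero_ge1 lL (lam_zero n)).
    by generalize (Psi (lam n * L)) => z; lra.
  have -> : 8 * N2 v * lam n * ip (w n) (w n) = N2 v * (8 * lam n * ip (w n) (w n)) by ring.
  by apply: ler_wpM2l; [exact: N2_ge0|exact: le_trans h].
have f2 : expR (- (lam n * t)) <= (4 / t) ^+ 4 * lam n ^- 4.
  have z0 : 0 < lam n * t / 4 by rewrite divr_gt0// mulr_gt0.
  have -> : (4 / t) ^+ 4 * lam n ^- 4 = ((lam n * t / 4) ^+ 4)^-1.
    by field; rewrite !gt_eqF.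
  rewrite expRN lef_pV2 ?posrE ?exprn_gt0 ?expR_gt0//.
  have -> : expR (lam n * t) = expR (4%:R * (lam n * t / 4)) by congr expR; field.
  rewrite expRM_natl lerXn2r ?nnegrE ?(ltW z0) ?expR_ge0//.
  by apply: le_trans (expR_ge1Dx _); rewrite lerDr.
rewrite /B /A normrM (gtr0_norm (expR_gt0 _)).
apply: (@le_trans _ _ (8 * N2 v * lam n * ((4 / t) ^+ 4 * lam n ^- 4) * lam n ^+ 2)).
  by apply: ler_wpM2r; [exact: sqr_ge0|apply: ler_pM => //; exact: expR_ge0].
by rewrite le_eqVlt; apply/orP; left; apply/eqP; field; rewrite !gt_eqF.
Qed.

Let cB : cvgn (series B).
Proof.
have [K K0 HK] := B_le.
apply: (@series_le_cvg R _ (fun n => K * (lam n)^-1)) => //.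
  by move=> n; exact: le_trans (HK n).
apply: nondecreasing_is_cvgn.
  by apply/nondecreasing_seqP => n; rewrite /series/= big_nat_recr//= lerDl mulr_ge0// invr_ge0 ltW.
exists (K * L) => _ [n _ <-]; rewrite /series/= -mulr_sumr big_mkord.
by apply: ler_wpM2l => //; exact: (sum_lam a1 lam_gt0 lam_incr lam_zero).
Qed.

Let T := limn (series B).

Let AB n : `|A n| <= 1 * B n.
Proof.
rewrite mul1r /B ler_peMr// -(@expr1n _ 2) lerXn2r ?nnegrE ?lam_ge1//.
exact: ltW.
Qed.

Let AlB n : `|A n| * lam n <= B n.
Proof.
rewrite /B expr2 mulrA ler_peMr ?lam_ge1// mulr_ge0//; exact: ltW.
Qed.

Lemma evolE N x : evol a lam v t N x = series (fun n => A n * w n x) N.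
Proof. by rewrite /evol /series/= big_mkord. Qed.

(** The candidate for S t v, at each point. *)
Definition evol_lim (x : R) := limn (series (fun n => A n * w n x)).

Let AwB x n : a <= x -> `|A n * w n x| <= 1 * B n.
Proof.
move=> ax; rewrite normrM; apply: le_trans (AB n); rewrite ler_piMr//.
by apply: ev_le1 => //; exact: ltW.
Qed.

Lemma evol_cvg x : a <= x -> evol a lam v t ^~ x @ \oo --> evol_lim x.
Proof.
move=> ax; have := dom_series_cvg cB (fun n => @AwB x n ax).
by under [X in _ -> X @ _ --> _]eq_fun do rewrite evolE.
Qed.

Lemma evol_tail x N : a <= x -> `|evol_lim x - evol a lam v t N x| <= T - series B N.
Proof.
move=> ax; rewrite evolE -[leRHS]mul1r.
exact: (dom_series_tail cB N (fun n => @AwB x n ax)).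
Qed.

Lemma w_lip n x y : a <= x -> x <= y -> `|w n y - w n x| <= lam n * (y - x).
Proof.
move=> ax xy; have [c /andP[xc _] ->] := has_deriv_MVT (has_deriv_ev a (lam n)) xy.
rewrite normrM (ger0_norm (_ : 0 <= y - x)) ?subr_ge0// ler_wpM2r ?subr_ge0//.
rewrite normrM (gtr0_norm (lam_gt0 n)) ler_piMr ?(ltW (lam_gt0 n))//.
apply: E1_le1; rewrite mulr_ge0 ?(ltW (lam_gt0 n))// subr_ge0.
exact: le_trans xc.
Qed.

Lemma evol_lim_lip x y : a <= x -> x <= y -> `|evol_lim y - evol_lim x| <= (y - x) * T.
Proof.
move=> ax xy; have ay := le_trans ax xy.
have cx := dom_series_cvg cB (fun n => @AwB x n ax).
have cy := dom_series_cvg cB (fun n => @AwB y n ay).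
have e : evol_lim y - evol_lim x = limn (series (fun n => A n * w n y - A n * w n x)).
  rewrite /evol_lim -limB//; congr (limn _); apply/funext => n.
  transitivity (series (fun n => A n * w n y) n - series (fun n => A n * w n x) n) => //.
  by rewrite /series/= -sumrB.
rewrite e; apply: (dom_series_lim cB) => n.
rewrite -mulrBr normrM.
apply: le_trans (_ : `|A n| * (lam n * (y - x)) <= _).
  by apply: ler_wpM2l => //; exact: w_lip.
by rewrite mulrA mulrC; apply: ler_wpM2l => //; rewrite subr_ge0.
Qed.

Definition evol_slope := limn (series (fun n => A n * dw n 1)).

Let AdB n : `|A n * dw n 1| <= 1 * B n.
Proof.
have l0 := lam_gt0 n.
rewrite mul1r normrM [`|lam n * _|]normrM mulrA (gtr0_norm l0); apply: le_trans (AlB n).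
rewrite ler_piMr ?mulr_ge0 ?(ltW l0)//; apply: E1_le1.
by rewrite mulr_ge0 ?(ltW l0)// subr_ge0 ltW.
Qed.

Lemma evol_slope_cvg : series (fun n => A n * dw n 1) @ \oo --> evol_slope.
Proof. exact: (dom_series_cvg cB AdB). Qed.

(** The restriction x >= (1 + a)/2 keeps the argument of E'' away from 0, where
    the bound 2/y on E'' degenerates. *)
Lemma w_taylor n x : (1 + a) / 2 <= x -> x <= 1 ->
  `|w n x - w n 1 - dw n 1 * (x - 1)| <= 4 / L * (1 - x) ^+ 2 * lam n ^+ 2.
Proof.
move=> xa x1; have l0 := lam_gt0 n; have L0 : 0 < L by rewrite subr_gt0.
have [c /andP[xc c1] e] := has_deriv_MVT (has_deriv_ev a (lam n)) x1.
have [d /andP[cd d1] e2] := has_deriv_MVT (has_deriv_dev a (lam n)) c1.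
have ca : a < c by have := le_trans xa xc; lra.
have -> : w n x - w n 1 - dw n 1 * (x - 1)
    = (dw n 1 - dw n c) * (1 - x).
  by move: e; move: (w n 1) (w n x) => w1 wx e; rewrite mulrBl -e; ring.
rewrite e2 !normrM !(gtr0_norm l0) (ger0_norm (_ : 0 <= 1 - c)) ?subr_ge0//.
rewrite (ger0_norm (_ : 0 <= 1 - x)) ?subr_ge0//.
have da : L / 2 <= d - a by have := le_trans xa (le_trans xc cd); lra.
have z0 : 0 < lam n * (d - a) by rewrite mulr_gt0//; lra.
have h : `|E2 (lam n * (d - a))| <= 4 / L.
  apply: le_trans (E2_le z0) _; rewrite ler_pdivrMr// mulrAC ler_pdivlMr//.
  have h1 : L / 2 <= lam n * (d - a).
    by apply: (le_trans da); rewrite ler_peMl ?lam_ge1//; lra.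
  by move: h1; generalize (lam n * (d - a)) => z; lra.
have cx : 1 - c <= 1 - x by lra.
have -> : 4 / L * (1 - x) ^+ 2 * lam n ^+ 2 = lam n * (lam n * (4 / L)) * (1 - x) * (1 - x) by ring.
apply: ler_wpM2r; first by rewrite subr_ge0.
apply: ler_pM => //; rewrite ?subr_ge0//.
  by rewrite !mulr_ge0// ltW.
by apply: ler_wpM2l; [exact: ltW|apply: ler_wpM2l; [exact: ltW|exact: h]].
Qed.

Lemma evol_taylor x : (1 + a) / 2 <= x -> x <= 1 ->
  `|evol_lim x - evol_lim 1 - evol_slope * (x - 1)| <= 4 / L * (1 - x) ^+ 2 * T.
Proof.
move=> xa x1; have ax : a <= x by lra.
have cx := dom_series_cvg cB (fun n => @AwB x n ax).
have c1 := dom_series_cvg cB (fun n => @AwB 1 n (ltW a1)).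
have cd := dom_series_cvg cB AdB.
have -> : evol_lim x - evol_lim 1 - evol_slope * (x - 1) =
    limn (series (fun n => A n * (w n x - w n 1 - dw n 1 * (x - 1)))).
  apply/esym/cvg_lim => //.
  have -> : series (fun n => A n * (w n x - w n 1 - dw n 1 * (x - 1))) =
     (fun N => series (fun n => A n * w n x) N - series (fun n => A n * w n 1) N
       - series (fun n => A n * dw n 1) N * (x - 1)).
    apply/funext => N; rewrite /series/= mulr_suml -!sumrB; apply: eq_bigr => i _.
    by ring.
  by apply: cvgB; [exact: cvgB|exact: cvgMl].
apply: (dom_series_lim cB) => n.
rewrite normrM [leRHS]mulrCA; apply: ler_wpM2l => //.
exact: w_taylor.
Qed.

(** The Taylor remainders of the terms are O((1 - x)^2) with summable constants. *)
Lemma evol_left_derivative (f : R -> R) : (forall x, a < x <= 1 -> f x = evol_lim x) ->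
  left_derivative f 1 evol_slope.
Proof.
move=> fE; rewrite /left_derivative.
have T0 : 0 <= T.
  have := dom_series_lim cB (g := B) (c := 1) (fun n => _).
  by move=> /(_ _)/(le_trans (normr_ge0 _)); rewrite mul1r; apply => n; rewrite ger0_norm ?mul1r.
have L0 : 0 < L by rewrite subr_gt0.
apply/cvgrPdist_le => e e0.
(* The 1 makes C positive also when all coefficients are 0. *)
pose C := 4 / L * T + 1.
have C0 : 0 < C by rewrite ltr_wpDl// mulr_ge0// divr_ge0// ltW.
near=> y.
have y1 : y < 1 by near: y; exact: nbhs_left_lt.
have ya : (1 + a) / 2 <= y.
  by near: y; apply: nbhs_left_ge; lra.
have ye : 1 - e / C <= y.
  by near: y; apply: nbhs_left_ge; rewrite ltrBlDr ltrDl divr_gt0.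
have ax : a < y by lra.
rewrite (fE y) ?ax ?(ltW y1)// (fE 1) ?a1 ?lexx//.
have yn : y - 1 != 0 by rewrite subr_eq0 lt_eqF.
have -> : evol_slope - (evol_lim y - evol_lim 1) / (y - 1)
   = - ((evol_lim y - evol_lim 1 - evol_slope * (y - 1)) / (y - 1)) by field.
have n1 : `|y - 1| = 1 - y by rewrite distrC gtr0_norm ?subr_gt0.
rewrite normrN normrM normfV n1 ler_pdivrMr ?subr_gt0//.
apply: le_trans (evol_taylor ya (ltW y1)) _.
have h1 : (1 - y) * C <= e.
  by rewrite -ler_pdivlMr// lerBlDl -lerBlDr.
have h2 : 4 / L * T <= C by rewrite lerDl.
have y10 : 0 <= 1 - y by lra.
have -> : 4 / L * (1 - y) ^+ 2 * T = (4 / L * T * (1 - y)) * (1 - y) by ring.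
apply: ler_wpM2r => //; apply: le_trans h1; rewrite mulrC; exact: ler_wpM2l.
Unshelve. all: by end_near. Qed.

Section Identification.
Variable S : R -> (R -> R) -> (R -> R).
Hypothesis gen : generates a 1 (degenerate_op a) S.
Let C0S : C0_semigroup a 1 S. Proof. by case: gen. Qed.

(** The series is controlled on [a,1] only. Composing its sum with the
    retraction of the line onto [a,1] gives a function that is continuous
    everywhere. *)
Definition clamp (x : R) := Num.min (Num.max x a) 1.

Lemma clamp_itv x : a <= clamp x <= 1.
Proof.
by rewrite /clamp le_min ge_min le_max lexx (ltW a1) lexx !orbT.
Qed.

Lemma clamp_id x : a <= x <= 1 -> clamp x = x.
Proof. by move=> /andP[ax x1]; rewrite /clamp max_l// min_l. Qed.

Lemma clamp_lip x y : x <= y -> 0 <= clamp y - clamp x <= y - x.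
Proof.
move=> xy; rewrite /clamp /Num.min /Num.max.
by repeat case: ifPn; rewrite -?leNgt => *; lra.
Qed.

Definition evol_ext x := evol_lim (clamp x).

Lemma evol_ext_cont : continuous evol_ext.
Proof.
have T0 : 0 <= T.
  have := dom_series_lim cB (g := B) (c := 1) (fun n => _).
  by move=> /(_ _)/(le_trans (normr_ge0 _)); rewrite mul1r; apply => n; rewrite ger0_norm ?mul1r.
have lip x y : x <= y -> `|evol_ext y - evol_ext x| <= (y - x) * T.
  move=> xy; have /andP[c0 c1] := clamp_lip xy.
  have /andP[ax _] := clamp_itv x.
  apply: le_trans (evol_lim_lip ax _) _; first by rewrite -subr_ge0.
  exact: ler_wpM2r.
have lip2 x y : `|evol_ext x - evol_ext y| <= `|x - y| * (T + 1).
  have [xy|yx] := leP x y.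
    rewrite distrC (distrC x) (ger0_norm (_ : 0 <= y - x)) ?subr_ge0//.
    apply: le_trans (lip _ _ xy) _; apply: ler_wpM2l; [by rewrite subr_ge0|by rewrite lerDl].
  rewrite (ger0_norm (_ : 0 <= x - y)); last by rewrite subr_ge0 ltW.
  apply: le_trans (lip _ _ (ltW yx)) _; apply: ler_wpM2l; [by rewrite subr_ge0 ltW|by rewrite lerDl].
move=> x; apply/cvgrPdist_le => e e0; near=> y.
apply: le_trans (lip2 _ _) _; rewrite -ler_pdivlMr; last by rewrite ltr_wpDl.
by near: y; apply: cvgr_dist_le; [exact: cvg_id|rewrite divr_gt0// ltr_wpDl].
Unshelve. all: by end_near. Qed.

(** Choose N with v close to its N-th partial sum in L^2(a,1) and with a small
    tail of the majorant. The semigroup maps the partial sum of v to that of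
    the evolved series. *)
Lemma semigroup_evol : N2 (fun x => S t v x - evol_ext x) = 0.
Proof.
have t0' := ltW t0.
have [M M1 HM] := semigroup_bounded C0S t0'.
have SL g : g \in L2 -> S t g \in L2 by exact: semigroup_L2.
have qL : evol_ext \in L2 by apply: continuous_L2; exact: evol_ext_cont.
apply/eqP; rewrite eq_le N2_ge0 andbT; apply/ler_addgt0Pr => e e0; rewrite add0r.
have M0 : 0 < M by exact: lt_le_trans ltr01 M1.
have tc : (fun N => T - series B N) @ \oo --> (0 : R).
  by rewrite -(subrr T); apply: cvgB => //; exact: cvg_cst.
have : \forall N \near \oo, T - series B N < e / 2.
  by apply: (cvgr_lt _ tc); rewrite divr_gt0.
move=> [n0 _ Hn0].
have e1 : 0 < e / 2 / M by rewrite !divr_gt0.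
have [N nN HN] := psum_cvg_subseq a1 a0 lam_gt0 lam_incr lam_zero lam_all vL n0 e1.
have pL := psum_L2 a lam v N; have eL := evol_L2 a lam v t N.
have h1 : N2 (fun x => S t v x - S t (psum v N) x) <= e / 2.
  rewrite (semigroup_sub C0S t0' vL pL).
  apply: le_trans (HM _ (L2B vL pL)) _.
  by rewrite mulrC -ler_pdivlMr.
have h2 : N2 (fun x => evol a lam v t N x - evol_ext x) <= e / 2.
  have ce : continuous (evol a lam v t N).
    apply: has_deriv_continuous; apply: has_deriv_sum => i.
    exact: has_derivZ (has_deriv_ev _ _).
  apply: N2_le_bound; [|by rewrite ltW// divr_gt0|].
    by apply: continuousB_fun => //; exact: evol_ext_cont.
  move=> x xx; have /andP[ax _] := xx; rewrite /evol_ext clamp_id// distrC.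
  by apply: le_trans (evol_tail N ax) _; apply: ltW; exact: Hn0.
have h3 := semigroup_psum a1 lam_gt0 lam_zero gen v N t0'.
apply: le_trans (N2_tri (SL _ vL) (SL _ pL) qL) _.
rewrite (N2_eq0_tri (SL _ pL) eL qL h3).
by rewrite [leRHS](splitr e) lerD.
Qed.

(** Both functions are continuous up to 1 and agree almost everywhere. *)
Lemma evol_pointwise (f : R -> R) : f = S t v %[ae leb_oo a 1] ->
  {within `]a, 1], continuous f} -> forall x, a < x <= 1 -> f x = evol_lim x.
Proof.
move=> fS cf x ax.
have qL : evol_ext \in L2 by apply: continuous_L2; exact: evol_ext_cont.
have SL := semigroup_L2 C0S (ltW t0) vL.
have z : (EFin \o (fun x => S t v x - evol_ext x)) = \0%E %[ae leb_oo a 1].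
  apply: (@Lnorm_eq0_eq0 _ _ _ _ _ 2%:E) => //.
    by apply/measurable_EFinP; exact: L2_measurable (L2B SL qL).
  have := L2normE (L2B SL qL); rewrite semigroup_evol; exact.
have AE : {ae leb, forall x, a < x < 1 -> f x = evol_ext x}.
  have z1 := ae_leb_oo z; have z2 := ae_leb_oo fS.
  apply: (@filterS2 _ _ (ae_filter_ringOfSetsType leb) _ _ _ _ z1 z2) => y h1 h2 ay.
  have -> := h2 ay I.
  by have := h1 ay I => /= -[] /eqP; rewrite subr_eq0 => /eqP.
rewrite (within_continuous_ae_eq a1 cf evol_ext_cont AE ax) /evol_ext clamp_id//.
by have /andP[/ltW -> ->] := ax.
Qed.

End Identification.
End Pointwise.

(** * The quadratic substitution for measurable functions *)

Section Density.
Local Open Scope ereal_scope.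
Context d (T : measurableType d) (R : realType).
Variables (mu : {measure set T -> \bar R}) (f : T -> R).
Hypothesis mf : measurable_fun setT f.

(** The absolute value makes this a measure for every measurable f. *)
Definition density (mf' : measurable_fun setT f) (A : set T) : \bar R :=
  \int[mu]_(x in A) `|(f x)%:E|.

Let mabs D : measurable_fun D (fun x => `|(f x)%:E|).
Proof. by apply: measurable_funTS; apply: measurableT_comp => //; exact/measurable_EFinP. Qed.

Let density0 : density mf set0 = 0.
Proof. by rewrite /density integral_set0. Qed.

Let density_ge0 A : 0 <= density mf A.
Proof. exact: integral_ge0. Qed.

Let density_sigma_additive : semi_sigma_additive (density mf).
Proof.
move=> /= F mF tF mUF; rewrite /density; apply: cvg_toP.
  apply: ereal_nondecreasing_is_cvgn => m n mn.
  by apply: lee_sum_nneg_natr => // k _ _; exact: integral_ge0.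
by rewrite ge0_integral_bigcup.
Qed.

HB.instance Definition _ := isMeasure.Build _ _ _ (density mf)
  density0 density_ge0 density_sigma_additive.

Let integral_density_indic A : measurable A ->
  \int[density mf]_x (\1_A x)%:E = \int[mu]_x ((\1_A x)%:E * `|(f x)%:E|).
Proof.
move=> mA; rewrite integral_indic//= setIT /density integral_mkcond/=.
apply: eq_integral => x _; rewrite patchE indicE.
case: (boolP (x \in A)) => xA; first by rewrite mul1e.
by rewrite mul0e.
Qed.

Import HBNNSimple.

Let integral_density_nnsfun (g : {nnsfun T >-> R}) :
  \int[density mf]_x (g x)%:E = \int[mu]_x ((g x)%:E * `|(f x)%:E|).
Proof.
under [LHS]eq_integral do rewrite fimfunE -fsumEFin//.
rewrite [LHS]ge0_integral_fsum//; last 2 first.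
  - by move=> r; exact/measurable_EFinP/measurableT_comp.
  - by move=> n x _; rewrite EFinM nnfun_muleindic_ge0.
under [RHS]eq_integral.
  move=> x xD; rewrite fimfunE -fsumEFin// ge0_mule_fsuml; last first.
    by move=> r; rewrite EFinM nnfun_muleindic_ge0.
  over.
rewrite [RHS]ge0_integral_fsum//; last 2 first.
  - move=> r; apply: emeasurable_funM; last exact: mabs.
    by apply/measurable_EFinP; exact: measurableT_comp.
  - by move=> n x _; rewrite mule_ge0// EFinM nnfun_muleindic_ge0.
apply: eq_fsbigr => r _.
under [RHS]eq_integral do rewrite EFinM -muleA.
have [r0|r0] := leP 0%R r; last first.
  by rewrite !integral0_eq// => x _; rewrite preimage_nnfun0// indicE in_set0 ?mulr0 ?mul0e ?mule0.
rewrite ge0_integralZl//; first by rewrite integralZl_indic_nnsfun//= integral_density_indic.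
by apply: emeasurable_funM; [exact/measurable_EFinP|exact: mabs].
Qed.

Lemma integral_density (g : T -> \bar R) : measurable_fun setT g ->
  (forall x, 0 <= g x) ->
  \int[density mf]_x g x = \int[mu]_x (g x * `|(f x)%:E|).
Proof.
move=> mg g0.
pose g_ := nnsfun_approx measurableT mg.
have gcvg x : (g_ n x)%:E @[n --> \oo] --> g x by apply: cvg_nnsfun_approx => //.
have gnd x : {homo (fun n => (g_ n x)%:E) : m n / (m <= n)%N >-> m <= n}.
  by move=> m n mn; rewrite lee_fin; exact/lefP/nd_nnsfun_approx.
transitivity (limn (fun n => \int[density mf]_x (g_ n x)%:E)).
  rewrite -monotone_convergence//.
  - by apply: eq_integral => x _; apply/esym/cvg_lim => //; exact: gcvg.
  - by move=> n; exact/measurable_EFinP.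
  - by move=> n x _; rewrite lee_fin.
under eq_fun do rewrite integral_density_nnsfun.
rewrite -monotone_convergence//.
- apply: eq_integral => x _; apply/cvg_lim => //.
  exact: cvgeZr.
- move=> n; apply: emeasurable_funM; [exact/measurable_EFinP|exact: mabs].
- by move=> n x _; rewrite mule_ge0// lee_fin.
- by move=> x _ m n mn; rewrite lee_wpmul2r// gnd.
Qed.

End Density.

Section QuadraticSubstitution.
Context {R : realType}.
Variables (a j : R).
Hypothesis a1 : a < 1.
Hypothesis j0 : 0 < j.
Notation L := (1 - a).
Notation leb := (@lebesgue_measure R).

Let L0 : 0 < L. Proof. by rewrite subr_gt0. Qed.

Let T (s : R) := a + L * (s ^+ 2 / j ^+ 2).
Let phi (x : R) := j * Num.sqrt ((x - a) / L).
Let c := 2 * L / j ^+ 2.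
Let rho (s : R) := c * s * \1_(`]0, j[%classic : set R) s.

Let c0 : 0 < c. Proof. by rewrite /c divr_gt0 ?exprn_gt0// mulr_gt0. Qed.

Let continuous_rho_pre : continuous (fun s : R => c * s).
Proof. by apply: continuousZ_fun => x; exact: cvg_id. Qed.

Let mrho : measurable_fun [set: R] rho.
Proof.
apply: measurable_funM; last exact: measurable_indic.
exact: continuous_measurable_fun.
Qed.

Let mphi : @measurable_fun _ _ (measurableTypeR R) (measurableTypeR R) setT phi.
Proof.
apply: continuous_measurable_fun; apply: continuousZ_fun => x.
apply: (@continuous_comp _ _ _ (fun x => (x - a) / L) Num.sqrt); last exact: sqrt_continuous.
by apply: cvgMl; exact: continuous_shift.
Qed.

Let phiK x : a < x < 1 -> T (phi x) = x /\ 0 < phi x < j.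
Proof.
move=> /andP[ax x1]; have y0 : 0 < (x - a) / L by rewrite divr_gt0// subr_gt0.
split.
  rewrite /T /phi exprMn sqr_sqrtr ?(ltW y0)//.
  by field; rewrite !gt_eqF.
rewrite /phi mulr_gt0 ?sqrtr_gt0//= -[ltRHS]mulr1 ltr_pM2l//.
by rewrite -[ltRHS]sqrtr1 ltr_sqrt// ltr_pdivrMr// mul1r ltrD2r.
Qed.

Let phi_gt x r : a < x < 1 -> 0 <= r -> (r < phi x) = (T r < x).
Proof.
move=> axx r0; have [e /andP[p0 _]] := phiK axx.
rewrite -{2}e /T ltrD2l ltr_pM2l// ltr_pM2r ?invr_gt0 ?exprn_gt0//.
by rewrite ltr_pXn2r ?nnegrE// ltW.
Qed.

Let T_mono s s' : 0 <= s -> s < s' -> T s < T s'.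
Proof.
move=> s0 ss'; have s'0 := le_lt_trans s0 ss'.
rewrite /T ltrD2l ltr_pM2l// ltr_pM2r ?invr_gt0 ?exprn_gt0//.
by rewrite ltr_pXn2r ?nnegrE// ltW.
Qed.

Let T0 : T 0 = a. Proof. by rewrite /T expr0n mul0r mulr0 addr0. Qed.

Let Tj : T j = 1.
Proof. by rewrite /T divff ?mulr1 ?expf_eq0 ?gt_eqF//; lra. Qed.

Let density_half (r : R) : pushforward (leb_oo a 1) phi `]r, +oo[%classic
  = density leb mrho `]r, +oo[%classic.
Proof.
pose X := Num.min (Num.max r 0) j.
have X0 : 0 <= X by rewrite /X le_min le_max lexx orbT ltW.
have Xj : X <= j by rewrite /X ge_min lexx orbT.
have TX1 : T X <= 1.
  rewrite -Tj; move: Xj; rewrite le_eqVlt => /predU1P[->//|Xj].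
  exact: (ltW (T_mono X0 Xj)).
have TXa : a <= T X.
  rewrite -T0; move: X0; rewrite le_eqVlt => /predU1P[<-//|X0].
  exact: (ltW (T_mono (lexx 0) X0)).
have -> : pushforward (leb_oo a 1) phi `]r, +oo[%classic = (1 - T X)%:E.
  rewrite /pushforward /leb_oo/= /mrestr.
  have -> : (phi @^-1` `]r, +oo[) `&` `]a, 1[ = `]T X, 1[%classic.
    apply/seteqP; split => x /=; rewrite !in_itv/= ?andbT.
      move=> [rx axx]; have [_ /andP[p0 pj]] := phiK axx.
      have /andP[_ ->] := axx; rewrite andbT -phi_gt// /X.
      by rewrite gt_min gt_max rx p0.
    move=> /andP[Tx x1]; have axx : a < x < 1 by rewrite (le_lt_trans TXa Tx).
    split => //; have [_ /andP[p0 pj]] := phiK axx.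
    move: Tx; rewrite -phi_gt// /X gt_min => /orP[|jp]; last first.
      by move: (lt_trans jp pj); rewrite ltxx.
    by rewrite gt_max => /andP[].
  rewrite lebesgue_measure_itv/= lte_fin.
  move: TX1; rewrite le_eqVlt => /predU1P[->|->]; last by rewrite EFinB.
  by rewrite ltxx subrr.
rewrite /density.
have -> : (\int[leb]_(x in `]r, +oo[) `|(rho x)%:E| = \int[leb]_(s in `]X, j[) (c * s)%:E)%E.
  rewrite integral_mkcond [RHS]integral_mkcond; apply: eq_integral => s _.
  rewrite !patchE /rho indicE !mem_setE !in_itv/= andbT /X gt_min gt_max.
  have [rs|rs] := boolP (r < s); have [s0|s0] := boolP (0 < s);
    have [sj|sj] := boolP (s < j) => /=;
    rewrite ?mulr1 ?mulr0 ?abse0 ?orbT ?andbF ?orbF//=.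
  - by rewrite ger0_norm// ltW// mulr_gt0.
  all: try by rewrite normr0.
  all: try by rewrite (ltNge j s) (ltW sj)/= ?normr0.
have cI : leb.-integrable `]X, j[ (EFin \o (fun s => c * s)) by exact: continuous_itg.
have D : has_deriv (fun s => c / 2 * s ^+ 2) (fun s => c * s).
  apply: (has_deriv_eq (has_derivZ (c / 2) (has_deriv_sqr (has_deriv_id (R := R))))) => x.
  by field.
move: (Xj); rewrite le_eqVlt => /predU1P[Xe|Xj'].
  rewrite Xe Tj subrr set_itv_ge ?integral_set0//.
  by rewrite bnd_simp ltxx.
rewrite -[RHS]fineK; last exact: integrable_fin_num.
have := FTC_Rintegral Xj' D continuous_rho_pre; rewrite /Rintegral/= => ->.
congr EFin; rewrite /T /c.
by field; rewrite gt_eqF.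
Qed.

Let push : {measure set (measurableTypeR R) -> \bar R} :=
  measure_function_pushforward__canonical__measure_function_Measure
    (leb_oo a 1) mphi.

(** The image of Lebesgue measure on ]a,1[ under the inverse phi of the
    substitution has density rho. As half-lines generate the Borel sets, it is
    enough to compute both measures there. *)
Let measure_eq (A : set R) : measurable A ->
  push A = density leb mrho A.
Proof.
move=> mA.
apply: (@measure_unique _ R (measurableTypeR R) (@RGenOInfty.G R)
  (fun n => `]- n%:R, +oo[%classic) _ _ _ _ push (density leb mrho)) => //.
- exact: RGenOInfty.measurableE.
- move=> _ _ [x ->] [y ->]; exists (Num.max x y).
  by apply/seteqP; split => z /=; rewrite !in_itv/= !andbT gt_max => /andP.
- by move=> n; exists (- n%:R).
- apply/seteqP; split => // x _.
  exists (Num.truncn `|x|).+1 => //=; rewrite in_itv/= andbT ltrNl.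
  by rewrite (le_lt_trans _ (truncnS_gt _))// -normrN ler_norm.
- by move=> _ [r ->]; exact: density_half.
- move=> n; rewrite /push/= /pushforward /leb_oo/= /mrestr.
  apply: (@le_lt_trans _ _ (leb `]a, 1[%classic)).
    apply: le_measure; rewrite ?inE//; apply: measurableI => //.
    by rewrite -[X in measurable X]setTI; exact: mphi.
  by rewrite lebesgue_measure_itv/= lte_fin a1 -EFinB ltry.
Qed.

(** Comparing measures, rather than integrals of continuous functions, gives
    the formula for every integrable g. *)
Lemma integral_quadratic_substitution (g : R -> R) : measurable_fun setT g ->
    leb.-integrable `]a, 1[ (EFin \o g) ->
  \int[leb]_(s in `]0, j[) (g (a + L * (s ^+ 2 / j ^+ 2)) * s) =
  j ^+ 2 / (2 * L) * \int[leb]_(x in `]a, 1[) g x.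
Proof.
move=> mg ig.
have mT : measurable_fun [set: R] T.
  apply: continuous_measurable_fun; apply: continuousD_fun; first by move=> x; exact: cvg_cst.
  apply: continuousZ_fun => x; apply: cvgMl.
  by apply: continuousX2_fun => y; exact: cvg_id.
have subst_ge0 (h : R -> \bar R) : measurable_fun setT h -> (forall x, (0 <= h x)%E) ->
    (\int[leb]_(x in `]a, 1%R[) h x = \int[leb]_(s in `]0%R, j[) (h (T s) * (c * s)%:E))%E.
  move=> mh h0.
  transitivity (\int[leb]_(x in `]a, 1%R[) (h \o T \o phi) x)%E.
    apply: eq_integral => x; rewrite inE/= in_itv/= => /phiK[e _].
    by rewrite e.
  have mhT : measurable_fun [set: R] (h \o T) by exact: measurableT_comp.
  have <- : (\int[leb_oo a 1]_x (h \o T \o phi) x = \int[leb]_(x in `]a, 1%R[) (h \o T \o phi) x)%E.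
    by apply: integral_leb_oo; exact: measurableT_comp.
  transitivity (\int[push]_x (h \o T) x)%E.
    apply/esym.
    rewrite (@ge0_integral_pushforward _ _ (measurableTypeR R) (measurableTypeR R) R phi mphi (leb_oo a 1) setT (h \o T))//; last by move=> x _; exact: h0.
  transitivity (\int[density leb mrho]_x (h \o T) x)%E.
    by apply: (@eq_measure_integral _ (measurableTypeR R)) => A mA _; exact: measure_eq.
  rewrite (@integral_density _ (measurableTypeR R) R leb rho mrho)//; last by move=> x; exact: h0.
  rewrite [RHS]integral_mkcond; apply: eq_integral => s _.
  rewrite patchE /rho indicE; case: ifPn => sj; last by rewrite mulr0 abse0 mule0.
  have s0 : 0 <= s by move: sj; rewrite inE/= in_itv/= => /andP[/ltW].
  by rewrite mulr1/= ger0_norm// mulr_ge0// ltW.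
have E (f : R -> R) : measurable_fun setT f -> (\int[leb]_(x in `]a, 1%R[) (f x)%:E =
    \int[leb]_(s in `]0%R, j[) (c * (f (T s) * s))%:E)%E.
  move=> mf.
  rewrite integralE [RHS]integralE; congr (_ - _)%E.
  - rewrite subst_ge0; [|exact/measurable_funepos/measurable_EFinP|by []].
    apply: eq_integral => s; rewrite inE/= in_itv/= => /andP[s0 _].
    have cs : 0 <= c * s by rewrite mulr_ge0 ?ltW.
    rewrite !funeposE -!EFin_max -EFinM maxr_pMl// mul0r; congr (Num.max _ _)%:E.
    by ring.
  - rewrite subst_ge0; [|exact/measurable_funeneg/measurable_EFinP|by []].
    apply: eq_integral => s; rewrite inE/= in_itv/= => /andP[s0 _].
    have cs : 0 <= c * s by rewrite mulr_ge0 ?ltW.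
    rewrite !funenegE -!EFin_max -EFinM maxr_pMl// mul0r; congr (Num.max _ _)%:E.
    by ring.
rewrite (_ : j ^+ 2 / (2 * L) = c^-1); last first.
  by rewrite /c; field; rewrite !gt_eqF.
rewrite -RintegralZl// /Rintegral E; last by apply: measurable_funM.
by congr fine; apply: eq_integral => s _; congr EFin; field; rewrite gt_eqF.
Qed.

End QuadraticSubstitution.

(** * The solution in terms of Bessel functions *)

Lemma L2_subset {R : realType} (a b a' b' : R) (f : R -> R) :
  a <= a' -> b' <= b -> f \in L2 a b -> f \in L2 a' b'.
Proof.
move=> aa' b'b /L2P[mf fi]; apply/L2P; split => //.
apply: le_lt_trans fi; apply: ge0_subset_integral => //.
- by apply/measurable_EFinP; apply: measurable_funTS; exact: measurable_funX.
- by move=> x _; rewrite lee_fin sqr_ge0.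
- move=> x /=; rewrite !in_itv/= => /andP[ax xb].
  by rewrite (le_lt_trans aa' ax) (lt_le_trans xb b'b).
Qed.

Section BesselForm.
Context {R : realType}.
Variables (a : R) (j : nat -> R).
Hypothesis a1 : a < 1.
Hypothesis hj : besselJ0_zeros j.
Notation L := (1 - a).

(** Eigenvalues are numbered from 0, the zeros of J_0 from 1. *)
Definition eigenvalue_of (n : nat) : R := j n.+1 ^+ 2 / (4 * L).
Notation lam := eigenvalue_of.

Let L0 : 0 < L. Proof. by rewrite subr_gt0. Qed.

Lemma zero_gt0 n : 0 < j n.+1.
Proof. by have [_ h] := hj; have [_ /(_ _)[]] := h (j n.+1); first by exists n.+1. Qed.

Lemma besselJ0_zero n : besselJ0 (j n.+1) = 0.
Proof. by have [_ h] := hj; have [_ /(_ _)[]] := h (j n.+1); first by exists n.+1. Qed.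

Lemma eigenvalue_of_gt0 n : 0 < lam n.
Proof. by rewrite divr_gt0 ?exprn_gt0 ?zero_gt0 ?mulr_gt0. Qed.

Lemma eigenvalue_of_incr m n : (m < n)%N -> lam m < lam n.
Proof.
move=> mn; rewrite ltr_pM2r ?invr_gt0 ?mulr_gt0//.
rewrite ltr_pXn2r ?nnegrE ?(ltW (zero_gt0 _))//.
by have [h _] := hj; exact: h.
Qed.

Let lamL n : lam n * L = j n.+1 ^+ 2 / 4.
Proof. by rewrite /lam; field; rewrite gt_eqF. Qed.

Lemma eigenvalue_of_zero n : E (lam n * L) = 0.
Proof. by rewrite lamL -besselJ0E besselJ0_zero. Qed.

Lemma eigenvalue_of_all (l : R) : 0 < l -> E (l * L) = 0 -> exists n, l = lam n.
Proof.
move=> l0 El; have [_ h] := hj.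
have lL : 0 < l * L by rewrite mulr_gt0.
have z0 : 0 < 2 * Num.sqrt (l * L) by rewrite mulr_gt0// sqrtr_gt0.
have ze : (2 * Num.sqrt (l * L)) ^+ 2 = 4 * (l * L).
  by rewrite exprMn sqr_sqrtr ?(ltW lL)//; ring.
have [|[//|n] _ e] := (h (2 * Num.sqrt (l * L))).1.
  by split => //; rewrite besselJ0E ze mulrAC divff ?mul1r// pnatr_eq0.
exists n; rewrite /lam -e ze; field.
by rewrite gt_eqF.
Qed.

Lemma eigenfunctionE n (x : R) : a <= x ->
  besselJ0 (j n.+1 * Num.sqrt ((x - a) / L)) = ev a (lam n) x.
Proof.
move=> ax; rewrite besselJ0E /ev exprMn sqr_sqrtr; last first.
  by rewrite divr_ge0 ?subr_ge0// ltW.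
by congr E; rewrite /lam; field; rewrite gt_eqF.
Qed.

Lemma decayE t n : decay j a t n.+1 = expR (- (lam n * t)).
Proof. by rewrite /decay /lam; congr (expR (- _)); field; rewrite gt_eqF. Qed.

Lemma bessel_coefE (u0 : R -> R) n : u0 \in L2 a 1 ->
  bessel_coef j u0 a n.+1 = j n.+1 ^+ 2 / (2 * L) * ip a 1 u0 (ev a (lam n)).
Proof.
move=> u0L; have j0 := zero_gt0 n.
rewrite /ip -(integral_quadratic_substitution a1 j0); last 2 first.
- apply: measurable_funM; first exact: L2_measurable u0L.
  exact: L2_measurable (ev_L2 a (lam n)).
- by apply: (L2_itg u0L); exact: ev_L2.
apply: eq_Rintegral => s; rewrite inE/= in_itv/= => /andP[s0 _].
rewrite mulrAC besselJ0E /ev; congr (_ * E _ * _).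
by rewrite /lam; field; rewrite !gt_eqF.
Qed.

Lemma eigenfunction_norm n :
  ip a 1 (ev a (lam n)) (ev a (lam n)) = L * derive1 besselJ0 (j n.+1) ^+ 2.
Proof.
have l0 := eigenvalue_of_gt0 n.
rewrite ip_ev ?gt_eqF// /Psi eigenvalue_of_zero derive1_besselJ0 lamL expr0n/= add0r.
generalize (E1 (j n.+1 ^+ 2 / 4)) => e; rewrite /lam; field.
by rewrite !gt_eqF ?zero_gt0.
Qed.

Lemma derive1_besselJ0_neq0 n : derive1 besselJ0 (j n.+1) != 0.
Proof.
rewrite derive1_besselJ0; apply: mulf_neq0.
  by rewrite gt_eqF// divr_gt0 ?zero_gt0.
by apply: E_zero_E1_neq0; rewrite ?divr_ge0 ?sqr_ge0// -besselJ0E besselJ0_zero.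
Qed.

Lemma fcoefE (u0 : R -> R) n : u0 \in L2 a 1 ->
  fcoef a lam u0 n = 2 / (j n.+1 ^+ 2 * derive1 besselJ0 (j n.+1) ^+ 2)
    * bessel_coef j u0 a n.+1.
Proof.
move=> u0L; rewrite bessel_coefE// /fcoef eigenfunction_norm.
have := derive1_besselJ0_neq0 n; have := zero_gt0 n.
generalize (ip a 1 u0 (ev a (lam n))) (derive1 besselJ0 (j n.+1)) => p d j0 d0.
by field; rewrite d0 !gt_eqF.
Qed.

Lemma eigenfunction_slope n : lam n * E1 (lam n * L) =
  j n.+1 / (2 * L) * derive1 besselJ0 (j n.+1).
Proof.
rewrite derive1_besselJ0 lamL; generalize (E1 (j n.+1 ^+ 2 / 4)) => e.
by rewrite /lam; field; rewrite gt_eqF.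
Qed.

End BesselForm.

Lemma cvg_sum_from1 {R : realType} (F : nat -> R) (l : R) :
  (fun N => \sum_(n < N) F n.+1) @ \oo --> l ->
  (fun N => \sum_(1 <= n < N) F n) @ \oo --> l.
Proof.
move=> h; rewrite -(cvg_shiftS (fun N => \sum_(1 <= n < N) F n)).
apply: cvg_trans h; apply: near_eq_cvg; apply: nearW => N /=.
by rewrite big_add1/= big_mkord.
Qed.

Unset Implicit Arguments.

Theorem theorem3p2 (R : realType) (a : R) (u0 : R -> R) (j : nat -> R)
    (u : R -> R -> R) :
  0 < a < 1 ->
  u0 \in L2 0 1 ->
  besselJ0_zeros j ->
  degenerate_solution a u0 u ->
  forall t : R, 0 < t ->
  (forall x : R, a < x <= 1 ->
    (fun N : nat => \sum_(1 <= n < N)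
       (2 / (j n ^+ 2 * (derive1 besselJ0 (j n)) ^+ 2)
        * decay j a t n * bessel_coef j u0 a n
        * besselJ0 (j n * Num.sqrt ((x - a) / (1 - a))))) @ \oo --> u t x) /\
  (exists2 d : R, left_derivative (u t) 1 d &
    (fun N : nat => \sum_(1 <= n < N)
       (decay j a t n / ((1 - a) * j n * derive1 besselJ0 (j n)) * bessel_coef j u0 a n))
      @ \oo --> d).
Proof.
move=> /andP[a0 a1] u0L01 hj [S gen uS] t t0.
have u0L : u0 \in L2 a 1 := L2_subset (ltW a0) (lexx 1) u0L01.
have [utS utc] := uS t t0.
pose lam := eigenvalue_of a j.
have lam0 := eigenvalue_of_gt0 a1 hj.
have lamI := eigenvalue_of_incr a1 hj.
have lamZ := eigenvalue_of_zero a1 hj.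
have lamA := eigenvalue_of_all a1 hj.
have pw := evol_pointwise a1 a0 lam0 lamI lamZ lamA u0L t0 gen utS utc.
split => [x axx|].
  have /andP[ax _] := axx.
  rewrite (pw x axx); apply: cvg_sum_from1.
  apply: cvg_trans (evol_cvg a1 a0 lam0 lamI lamZ u0L t0 (ltW ax)).
  apply: near_eq_cvg; apply: nearW => N; apply: eq_bigr => n _.
  by rewrite eigenfunctionE// ?ltW// decayE// fcoefE//; congr (_ * _); ring.
exists (evol_slope a lam u0 t).
  exact: (evol_left_derivative a1 a0 lam0 lamI lamZ u0L t0 pw).
apply: cvg_sum_from1.
apply: cvg_trans (evol_slope_cvg a1 a0 lam0 lamI lamZ u0L t0).
apply: near_eq_cvg; apply: nearW => N; rewrite /series/= big_mkord.
apply: eq_bigr => n _.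
rewrite eigenfunction_slope// decayE// fcoefE//.
have := derive1_besselJ0_neq0 hj n; have := zero_gt0 hj n; move: a1.
generalize (bessel_coef j u0 a n.+1) (derive1 besselJ0 (j n.+1)) (j n.+1) (expR (- (eigenvalue_of a j n * t))) => b d z e a1' z0 d0.
by field; rewrite d0 !gt_eqF// subr_gt0.
Qed.
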